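(* Let $Q\subset\mathbb{C}P^2$ be a generic smooth quartic. Then there exists a Neeman example $\{Q_1,\dots,Q_{16}\}\subset Q$ such that the configuration of points $\{Q_1,\dots,Q_{16}\}$ is not pre-regular for any (singular holomorphic) foliation $\mathcal F$ of $\mathbb{C}P^2$ which leaves $Q$ invariant and has $2D$ as its trace divisor along $Q$, where $D=\sum_{j=1}^{16}Q_j-4D_\infty$.
   Context: Line at infinity. $L_\infty\subset\mathbb{C}P^2$ denotes a line transverse to the smooth quartic $Q$, and $D_\infty=Q\cap L_\infty$, regarded as a divisor of degree 4 on $Q$. $(X,Y)$ are affine coordinates on $\mathbb{C}P^2\setminus L_\infty\cong\mathbb{C}^2$, and $F(X,Y)=0$ is an affine equation of $Q$, with $F$ a polynomial of degree 4. Subscripts denote partial derivatives. Neeman example. Let $l_1,l_2$ be (equations of) two distinct bitangent lines to $Q$, and let $C$ be (the equation of) a cubic curve transverse to $Q$ which contains none of the points where $l_1=0$ or $l_2=0$ meets $Q$. Put $G=l_1l_2C^2$. The associated Neeman example is the configuration of 16 points $\{Q_1,\dots,Q_{16}\}=\{G=0\}\cap Q$, assumed to lie outside $L_\infty$: the points $Q_1,\dots,Q_{12}$ are those of $\{C=0\}\cap Q$, the points $Q_{13},Q_{14}$ are the two tangency points of $l_1=0$ with $Q$, and $Q_{15},Q_{16}$ are the two tangency points of $l_2=0$ with $Q$. Generic. The smooth quartic $Q$ is called generic if $L_\infty$, the affine coordinates $(X,Y)$, the equation $F$ and the bitangent lines $l_1,l_2$ can be chosen so that $Q_{13}=(0,0)$,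 $l_1(X,Y)=Y+aX$, $l_2(X,Y)=Y+aX+b$ with $a\neq0$, $b\neq0$, and, taking $C=F_X$ as the cubic, the following conditions hold: (1) the curve $C=F_X=0$ is transverse to $Q$; (2) $F_Y\neq0$ at the points of $\{l_1l_2=0\}\cap Q$; (3) $aF_X+\tfrac12 bF_{XX}+abF_{XY}\neq0$ at the point $Q_{13}$. Pre-regular configuration. Let $\mathcal F$ be a foliation leaving $Q$ invariant. Blow up $\mathbb{C}P^2$ once at each of the points $Q_1,\dots,Q_{16}$; let $\hat Q$ be the strict transform of $Q$ and $\hat{\mathcal F}$ the strict transform of $\mathcal F$. The configuration $\{Q_1,\dots,Q_{16}\}$ is pre-regular for $\mathcal F$ if $\hat Q$ is a leaf of $\hat{\mathcal F}$; in particular $\hat Q$ contains no singularities of $\hat{\mathcal F}$. Trace divisor. Let $\mathcal F$ be a foliation leaving $Q$ invariant whose singularities along $Q$ are $Q_1,\dots,Q_{16}$. Its trace divisor along $Q$ is $\sum_{j=1}^{16}m_jQ_j-LD_\infty$, where $m_j$ is the tangent multiplicity of $\mathcal F$ along $Q$ at $Q_j$ (the order of vanishing at $Q_j$ of the restriction to $Q$ of a local holomorphic vector field with isolated singularities defining $\mathcal F$), and $4L=\sum_{j=1}^{16} m_j$. Thus having $2D$ as trace divisor means that the singularities of $\mathcal F$ along $Q$ are exactly $Q_1,\dots,Q_{16}$ and that $m_j=2$ for every $j$. *)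

(* Defs.v *)
From mathcomp Require Export all_boot all_order all_algebra.
From mathcomp Require Export complex.
From mathcomp.multinomials Require Export mpoly.
From mathcomp Require Export reals.

Set Implicit Arguments.
Unset Strict Implicit.
Unset Printing Implicit Defensive.

Import GRing.Theory.
Local Open Scope ring_scope.

(** ** Plane projective curves

   A point of P^2 is a nonzero row vector up to scaling; two of them are the
   same point when they span the same line.  Curves are given by homogeneous
   equations in {mpoly K[3]}. *)

Definition same_point (K : fieldType) (v w : 'rV[K]_3) : bool := (v == w)%MS.

Definition on_curve (K : fieldType) (P : {mpoly K[3]}) (v : 'rV[K]_3) : bool :=
  (v != 0) && (P.@[v ord0] == 0).

Definition grad (K : fieldType) (P : {mpoly K[3]}) (v : 'rV[K]_3) : 'rV[K]_3 :=
  \row_i (P^`M(i)).@[v ord0].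

(* The gradients of P and F at v are linearly independent.  By Euler's relation
   this can be tested in K^3 rather than in an affine chart. *)
Definition indep_grad (K : fieldType) (P F : {mpoly K[3]}) (v : 'rV[K]_3) : bool :=
  row_free (col_mx (grad P v) (grad F v)).

Definition smooth_quartic (K : fieldType) (F : {mpoly K[3]}) : Prop :=
  F \is 4.-homog /\ (forall v, on_curve F v -> grad F v != 0).

Definition transverse (K : fieldType) (P F : {mpoly K[3]}) : Prop :=
  forall v, on_curve P v -> on_curve F v -> indep_grad P F v.

Definition tangent_at (K : fieldType) (P F : {mpoly K[3]}) (v : 'rV[K]_3) : Prop :=
  [/\ on_curve P v, on_curve F v & ~~ indep_grad P F v].

Definition is_line (K : fieldType) (l : {mpoly K[3]}) : Prop :=
  l \is 1.-homog /\ l != 0.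

(* Tangent at two distinct points, so that hyperflex lines are excluded. *)
Definition bitangent (K : fieldType) (l F : {mpoly K[3]}) : Prop :=
  is_line l /\
  exists p q, [/\ tangent_at l F p, tangent_at l F q & ~~ same_point p q].

(** ** Affine charts

   An invertible M gives the homogeneous coordinates (X, Y, Z) for which
   v = (X, Y, Z) *m M, hence affine coordinates (X, Y) = (X : Y : 1) off the
   line Z = 0; the origin of the chart is the last row of M. *)

Definition chart_origin (K : fieldType) (M : 'M[K]_3) : 'rV[K]_3 := row ord_max M.

Definition chart_coords (K : fieldType) : 3.-tuple {mpoly K[2]} :=
  [tuple 'X_ord0; 'X_ord_max; 1].

(* P((X, Y, 1) *m M).  As M is a matrix and not a class modulo scalars, for a
   curve of positive degree over an algebraically closed field all the scalar
   multiples of its affine equation are obtained. *)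
Definition affine_eq (K : fieldType) (M : 'M[K]_3) (P : {mpoly K[3]}) :
    {mpoly K[2]} :=
  P \mPo [tuple \sum_(k < 3) M k i *: tnth (chart_coords K) k | i < 3].

(* The line linf is Z = 0: its equation reads 1 in the chart (up to the choice
   of the equation of the line). *)
Definition affine_coordinates (K : fieldType) (linf : {mpoly K[3]}) (M : 'M[K]_3) :
    Prop :=
  [/\ M \in unitmx, is_line linf & affine_eq M linf = 1].

Definition centered_chart (K : fieldType) (M : 'M[K]_3) (p : 'rV[K]_3) : Prop :=
  M \in unitmx /\ same_point (chart_origin M) p.

(** ** Neeman examples *)

(* Q j for j < 12 are the points of C = 0, Q 12 and Q 13 the tangency points of
   l1, Q 14 and Q 15 those of l2. *)
Definition neeman_example (K : fieldType) (F linf l1 l2 C : {mpoly K[3]})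
    (Q : 'I_16 -> 'rV[K]_3) : Prop :=
  [/\ is_line linf /\ transverse linf F,
      [/\ bitangent l1 F, bitangent l2 F & forall c, l2 <> c *: l1],
      [/\ C \is 3.-homog, transverse C F
        & forall v, on_curve F v -> on_curve l1 v || on_curve l2 v ->
            ~~ on_curve C v],
      [/\ forall i j, same_point (Q i) (Q j) -> i = j
        & forall v, on_curve F v && on_curve (l1 * l2 * C ^+ 2) v <->
            v != 0 /\ exists j, same_point (Q j) v]
    & [/\ forall j : 'I_16, (j < 12)%N -> on_curve C (Q j),
          forall j : 'I_16, (12 <= j < 14)%N -> tangent_at l1 F (Q j),
          forall j : 'I_16, (14 <= j)%N -> tangent_at l2 F (Q j)
        & forall j, ~~ on_curve linf (Q j)]].

Definition generic_quartic (K : fieldType) (F : {mpoly K[3]}) : Prop :=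
  exists (M : 'M[K]_3) (linf l1 l2 C : {mpoly K[3]}) (a b : K),
  let f := affine_eq M F in
  let o : 'I_2 -> K := fun=> 0 in
  let fX := f^`M(ord0) in
  let fY := f^`M(ord_max) in
  [/\ affine_coordinates linf M /\ transverse linf F,
      [/\ a != 0, b != 0, bitangent l1 F & bitangent l2 F],
      [/\ tangent_at l1 F (chart_origin M),
          affine_eq M l1 = 'X_ord_max + a *: 'X_ord0
        & affine_eq M l2 = 'X_ord_max + a *: 'X_ord0 + b%:MP],
      [/\ C \is 3.-homog, affine_eq M C = fX & transverse C F]
    & (forall p : 'I_2 -> K,
          (affine_eq M (l1 * l2)).@[p] = 0 -> f.@[p] = 0 -> fY.@[p] != 0) /\
      a * fX.@[o] + b / 2%:R * (fX^`M(ord0)).@[o]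
        + a * b * (fX^`M(ord_max)).@[o] != 0].

(** ** Foliations

   A foliation of degree d on P^2 is A_0 dx_0 + A_1 dx_1 + A_2 dx_2 = 0 with
   A_i homogeneous of degree d + 1, annihilated by the radial field, and with
   isolated singularities, i.e. without common factor. *)

Definition foliation (K : fieldType) (d : nat) (A : 'I_3 -> {mpoly K[3]}) : Prop :=
  [/\ forall i, A i \is d.+1.-homog,
      \sum_i 'X_i * A i = 0
    & forall P B, (forall i, A i = P * B i) -> (msize P <= 1)%N].

Definition singular (K : fieldType) (A : 'I_3 -> {mpoly K[3]}) (v : 'rV[K]_3) : Prop :=
  forall i, (A i).@[v ord0] = 0.

(* The 2-form A /\ dF is a multiple of F. *)
Definition leaves_invariant (K : fieldType) (A : 'I_3 -> {mpoly K[3]})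
    (F : {mpoly K[3]}) : Prop :=
  forall i j, exists T, A i * F^`M(j) - A j * F^`M(i) = F * T.

(* Coefficients of dX and dY in the chart M. *)
Definition affine_form (K : fieldType) (M : 'M[K]_3) (A : 'I_3 -> {mpoly K[3]})
    (k : 'I_2) : {mpoly K[2]} :=
  \sum_(i < 3) M (widen_ord (leqnSn 2) k) i *: affine_eq M (A i).

(* For a curve f = 0 smooth at the origin, the restriction of g to it vanishes
   at the origin to order at least m: g lies in (f) + (X, Y)^m. *)
Definition order_ge (K : fieldType) (m : nat) (f g : {mpoly K[2]}) : Prop :=
  exists h, forall n : 'X_{1..2}, (mdeg n < m)%N -> (g - h * f)@_n = 0.

(* The vector field w_1 d/dX - w_0 d/dY, which has isolated singularities and
   defines the same foliation as w_0 dX + w_1 dY, vanishes on F = 0 to order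
   exactly m at p. *)
Definition tangent_multiplicity (K : fieldType) (A : 'I_3 -> {mpoly K[3]})
    (F : {mpoly K[3]}) (p : 'rV[K]_3) (m : nat) : Prop :=
  forall M, centered_chart M p ->
    (forall k, order_ge m (affine_eq M F) (affine_form M A k)) /\
    ~ (forall k, order_ge m.+1 (affine_eq M F) (affine_form M A k)).

(* The divisor \sum_j m_j Q_j - L D_oo on F = 0, as a multiplicity function on
   the points; D_oo is reduced because linf is transverse to F. *)
Definition config_divisor (K : fieldType) (F linf : {mpoly K[3]})
    (Q : 'I_16 -> 'rV[K]_3) (m : 'I_16 -> nat) (L : nat) (v : 'rV[K]_3) : int :=
  \sum_j (m j * same_point (Q j) v)%N%:Z
    - (L * (on_curve F v && on_curve linf v))%N%:Z.

Definition trace_divisor (K : fieldType) (A : 'I_3 -> {mpoly K[3]})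
    (F linf : {mpoly K[3]}) (Q : 'I_16 -> 'rV[K]_3) (T : 'rV[K]_3 -> int) : Prop :=
  (forall v, on_curve F v -> (singular A v <-> exists j, same_point (Q j) v)) /\
  exists (m : 'I_16 -> nat) (L : nat),
  [/\ forall j, tangent_multiplicity A F (Q j) (m j),
      (4 * L = \sum_j m j)%N
    & forall v, v != 0 -> T v = config_divisor F linf Q m L v].

(** ** Blowing up the origin of an affine chart

   Only the chart (x, t) |-> (x, t x) is used, with exceptional divisor x = 0:
   the other one is obtained by exchanging the first two rows of the matrix of
   the affine chart. *)

Definition blowup (K : fieldType) (g : {mpoly K[2]}) : {mpoly K[2]} :=
  g \mPo [tuple 'X_ord0; 'X_ord0 * 'X_ord_max].

(* dY pulls back to t dx + x dt. *)
Definition blowup_form (K : fieldType) (w : 'I_2 -> {mpoly K[2]}) (k : 'I_2) :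
    {mpoly K[2]} :=
  if k == ord0 then blowup (w ord0) + 'X_ord_max * blowup (w ord_max)
  else 'X_ord0 * blowup (w ord_max).

Definition strict_curve (K : fieldType) (f f' : {mpoly K[2]}) : Prop :=
  (exists n, blowup f = 'X_ord0 ^+ n * f') /\ ~ (exists g, f' = 'X_ord0 * g).

Definition strict_form (K : fieldType) (w w' : 'I_2 -> {mpoly K[2]}) : Prop :=
  (exists n, forall k, blowup_form w k = 'X_ord0 ^+ n * w' k) /\
  ~ (exists g : 'I_2 -> {mpoly K[2]}, forall k, w' k = 'X_ord0 * g k).

Definition leaves_invariant2 (K : fieldType) (w : 'I_2 -> {mpoly K[2]})
    (f : {mpoly K[2]}) : Prop :=
  exists T, w ord0 * f^`M(ord_max) - w ord_max * f^`M(ord0) = f * T.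

(* The strict transform of the (compact, connected) curve F = 0 is a leaf when
   it is invariant and contains no singularity of the strict transform of the
   foliation.  Off the exceptional divisors this is read on P^2; the last clause
   deals with the points (0, t) of each exceptional divisor. *)
Definition pre_regular (K : fieldType) (A : 'I_3 -> {mpoly K[3]})
    (F : {mpoly K[3]}) (Q : 'I_16 -> 'rV[K]_3) : Prop :=
  [/\ leaves_invariant A F,
      forall v, on_curve F v -> (forall j, ~~ same_point (Q j) v) -> ~ singular A v
    & forall j M, centered_chart M (Q j) ->
      forall f' w', strict_curve (affine_eq M F) f' ->
                    strict_form (affine_form M A) w' ->
      leaves_invariant2 w' f' /\
      forall p : 'I_2 -> K, p ord0 = 0 -> f'.@[p] = 0 ->
        ~ (forall k, (w' k).@[p] = 0)].

(* Main.v *)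
From HB Require Import structures.
Require Import Defs.
From mathcomp Require Import perm separable ring zify boolp.

Set Implicit Arguments.
Unset Strict Implicit.
Unset Printing Implicit Defensive.

Import GRing.Theory Num.Theory.
Local Open Scope ring_scope.

(** The cubic of the example is a union of three general lines. In the coordinates
   x_0, x_1, x_2 of the triangle that they form, C = x_0 x_1 x_2; put L = l_1 l_2.
   Let A be the homogeneous 1-form, with coefficients of degree d + 1, of a
   foliation as in the statement, and suppose that it is pre-regular.

   - The partial derivatives of F have no common zero, so their Koszul complex is
     exact and the invariance of the curve gives A = H dF + F B [koszul],
     [normal_form].
   - At each of the 16 points, a multiplicity 2 together with the regularity of the
     blown-up foliation on the strict transform of the curve means that A vanishes
     to order 2 and that its contraction with the lines through the point vanishes
     to order 3 [local_jets].
   - Hence H vanishes to order 2 along the curve at the 16 points, and is a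
     multiple h L C^2 modulo F. As the multiplicities are exactly 2, h has no zero
     on the curve; it is a constant c, and d = 10 [normal_form2].
   - B vanishes at the 12 points of C, so B = C M + F N [divide_xyz7]. The order 3
     conditions at these points determine M and N along each side
     [side_relations]. The gradients of F at the three vertices are independent,
     so the three descriptions fit together:
     M = - l dF - c L dC + F v + C m, with a single linear form l, and the radial
     relation makes the contraction of m with X equal to - c L [global_form].
   - At a point of tangency p, where dL = a dF, the order 3 condition then becomes
     2 l(p) = c a C(p) [tangency_relation].
   - The four points of tangency satisfy a linear relation sum_i k_i p_i = 0, and
     l is linear, so c times sum_i k_i a_i C(p_i) vanishes [no_preregular].

   The last sum is polynomial in the triangle. It is not identically zero: for the
   triangle with vertices p_1, p_2, p_3 the first three terms vanish and the
   fourth one does not [nz_weighted]. A general triangle therefore gives a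
   contradiction. The line at infinity of the example is a side of a second
   general triangle, which avoids the 16 points [generic_triangle]. *)

(** * Polynomials on lines *)

(** Constants and variables generate the ring of polynomials. *)
Lemma mpoly_ring_ind n (R : nzRingType) (P : {mpoly R[n]} -> Prop) :
    (forall c, P c%:MP) -> (forall i, P 'X_i) ->
    (forall p q, P p -> P q -> P (p + q)) ->
    (forall p q, P p -> P q -> P (p * q)) -> forall p, P p.
Proof.
move=> hC hX hD hM p; rewrite (mpolyE p).
apply: (big_ind P) => [|x y|m _]; [by rewrite -mpolyC0; apply: hC|exact: hD|].
rewrite -mul_mpolyC; apply: (hM) => //; rewrite mpolyXE_id.
apply: (big_ind P) => [|x y|i _]; [by rewrite -mpolyC1; apply: hC|exact: hM|].
elim: (m i) => [|k IH]; first by rewrite expr0 -mpolyC1; apply: hC.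
by rewrite exprS; apply: hM.
Qed.

Section LineSub.
Variables (n : nat) (K : nzRingType) (S : comNzRingType) (f : {rmorphism K -> S}).

(** Substitution of the line u + X w, whose points have coordinates in an extension
   S of the field of coefficients; a polynomial ring S gives pencils of lines. *)
Definition lsub (u w : 'I_n -> S) : {mpoly K[n]} -> {poly S} :=
  mmap (polyC \o f) (fun i => (u i)%:P + w i *: 'X).

HB.instance Definition _ u w := GRing.RMorphism.copy (lsub u w)
  (mmap (polyC \o f) (fun i => (u i)%:P + w i *: 'X)).

Lemma lsubC u w c : lsub u w c%:MP = (f c)%:P.
Proof. exact: mmapC. Qed.

Lemma lsubX u w i : lsub u w 'X_i = (u i)%:P + w i *: 'X.
Proof. by rewrite /lsub mmapX mmap1U. Qed.

Lemma lsubZ u w c P : lsub u w (c *: P) = f c *: lsub u w P.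
Proof. by rewrite -mul_mpolyC rmorphM /= lsubC mul_polyC. Qed.

Lemma horner_lsub u w P s :
  (lsub u w P).[s] = mmap f (fun i => u i + s * w i) P.
Proof.
elim/mpoly_ring_ind: P => [c|i|p q hp hq|p q hp hq].
- by rewrite lsubC hornerC mmapC.
- by rewrite lsubX mmapX mmap1U !hornerE mulrC.
- by rewrite rmorphD hornerD hp hq mmapD.
- by rewrite rmorphM hornerM hp hq rmorphM.
Qed.

Lemma deriv_lsub u w P :
  (lsub u w P)^`() = \sum_i w i *: lsub u w P^`M(i).
Proof.
elim/mpoly_ring_ind: P => [c|i|p q hp hq|p q hp hq].
- by rewrite lsubC derivC big1 // => j _; rewrite mderivC rmorph0 scaler0.
- rewrite lsubX derivD derivC add0r derivZ derivX.
  rewrite (bigD1 i) //= big1 => [|j /negPf hj].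
    rewrite addr0 mderivX mnm1E eqxx scale1r -/(mnm_sub _ _) .
    have -> : (U_(i) - U_(i))%MM = 0%MM :> 'X_{1..n}.
      by apply/mnmP => k; rewrite mnmBE subnn mnm0E.
    by rewrite mpolyX0 rmorph1.
  by rewrite mderivX mnm1E eq_sym hj scale0r rmorph0 scaler0.
- rewrite rmorphD derivD hp hq -big_split /=; apply: eq_bigr => i _.
  by rewrite mderivD rmorphD scalerDr.
- rewrite rmorphM derivM hp hq mulr_suml mulr_sumr -big_split /=.
  apply: eq_bigr => i _.
  by rewrite mderivM rmorphD !rmorphM scalerDr -!scalerAl -!scalerAr.
Qed.

End LineSub.

Section Field.
Variables (n : nat) (K : fieldType).
Implicit Types (P Q : {mpoly K[n]}) (u v w : 'I_n -> K).

(** Restriction to the line through u and w, parametrized by u + X w. *)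
Definition ev u w : {mpoly K[n]} -> {poly K} := lsub idfun u w.
HB.instance Definition _ u w := GRing.RMorphism.copy (ev u w) (lsub idfun u w).

Lemma horner_ev u w P s : (ev u w P).[s] = P.@[fun i => u i + s * w i].
Proof. exact: horner_lsub. Qed.

Lemma ev_at0 u w P : (ev u w P).[0] = P.@[u].
Proof. by rewrite horner_ev; apply: meval_eq => i; rewrite mul0r addr0. Qed.

Lemma deriv_ev u w P s :
  (ev u w P)^`().[s] = \sum_i w i * P^`M(i).@[fun i => u i + s * w i].
Proof.
rewrite deriv_lsub horner_sum; apply: eq_bigr => i _.
by rewrite hornerZ horner_ev.
Qed.

(** Derivative of P at v in the direction q. *)
Definition dd P v q : K := \sum_i q i * P^`M(i).@[v].

Lemma ddM P Q v q : dd (P * Q) v q = dd P v q * Q.@[v] + P.@[v] * dd Q v q.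
Proof.
rewrite /dd mulr_suml mulr_sumr -big_split /=; apply: eq_bigr => i _.
by rewrite mderivM mevalD !mevalM; ring.
Qed.

Lemma ddD P Q v q : dd (P + Q) v q = dd P v q + dd Q v q.
Proof.
by rewrite /dd -big_split /=; apply: eq_bigr => i _; rewrite mderivD mevalD mulrDr.
Qed.

Lemma homog_mdeg P d m : P \is d.-homog -> P@_m != 0 -> mdeg m = d.
Proof. by move=> /dhomogP hP; rewrite -mcoeff_msupp => /hP. Qed.

Lemma meval_homog P d v c : P \is d.-homog ->
  P.@[fun i => c * v i] = c ^+ d * P.@[v].
Proof.
move=> /dhomogP hP; rewrite /meval /mmap mulr_sumr; apply: eq_big_seq => m hm.
rewrite mulrCA; congr (_ * _).
have <- : mdeg m = d := hP _ hm.
rewrite /mmap1 mdegE -prodrXr -big_split /=.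
by apply: eq_bigr => i _; rewrite exprMn.
Qed.

Lemma dhomog_deriv P d i : P \is d.-homog -> P^`M(i) \is (d.-1).-homog.
Proof.
move=> hP; apply/dhomogP => m; rewrite mcoeff_msupp mcoeff_deriv => h.
have : P@_(m + U_(i)) != 0 by apply: contraNneq h => ->; rewrite mul0rn.
by move=> /(homog_mdeg hP) <-; rewrite mdegD mdeg1 addn1.
Qed.

Lemma euler P d : P \is d.-homog -> \sum_i 'X_i * P^`M(i) = P *+ d.
Proof.
move=> hP; apply/mpolyP => m; rewrite raddf_sum /= mcoeffMn.
have -> : \sum_i ('X_i * P^`M(i))@_m = \sum_i P@_m *+ m i.
  apply: eq_bigr => i _; rewrite mulrC.
  have [h|h] := boolP (U_(i) <= m)%MM.
    rewrite -[in LHS](submK h) addmC mcoeffMX mcoeff_deriv submK // mnmBE mnm1E eqxx.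
    congr (_ *+ _); rewrite subn1 prednK // lt0n.
    by have := h; rewrite lep1mP.
  have := h; rewrite lep1mP negbK => /eqP ->; rewrite mulr0n.
  apply/eqP; rewrite mcoeff_eq0; apply/negP => hm.
  have := msuppMX; move: hm; rewrite (perm_mem (msuppMX _ _)) => /mapP[m' _ e].
  by move: h; rewrite e lem_addr.
rewrite sumrMnr.
have [->|hm] := eqVneq P@_m 0; first by rewrite !mul0rn.
by rewrite -mdegE (homog_mdeg hP).
Qed.

Lemma dd_self P d v : P \is d.-homog -> dd P v v = P.@[v] *+ d.
Proof.
move=> hP; rewrite -mevalMn -(euler hP) raddf_sum /=.
by apply: eq_bigr => i _; rewrite mevalM mevalXU.
Qed.

(** The value at w is the coefficient of the largest possible degree. *)
Lemma size_mon (m : 'X_{1..n}) u w :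
  (size (ev u w 'X_[m]) <= (mdeg m).+1)%N /\
  (ev u w 'X_[m])`_(mdeg m) = 'X_[m].@[w].
Proof.
rewrite mpolyXE_id !rmorph_prod /= mdegE.
under eq_bigr do rewrite rmorphXn /= [ev _ _ _]lsubX.
under [X in _ = X]eq_bigr do rewrite rmorphXn /= mevalXU.
apply: (big_rec3 (fun (a : nat) (p : {poly K}) (c : K) => (size p <= a.+1)%N /\ p`_a = c)).
  by rewrite size_poly1 coefC.
move=> i a p c _ [hs <-].
have : (size ((((u i)%:P + w i *: 'X) ^+ m i) : {poly K}) <= (m i).+1)%N /\
       (((u i)%:P + w i *: 'X) ^+ m i)`_(m i) = w i ^+ m i.
  elim: (m i) => [|k [IH1 IH2]]; first by rewrite !expr0 size_poly1 coefC.
  rewrite exprS mulrDl mul_polyC -scalerAl.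
  split.
    apply: (leq_trans (size_polyD _ _)); rewrite geq_max; apply/andP; split.
      by apply: (leq_trans (size_scale_leq _ _)); apply: leqW.
    apply: (leq_trans (size_scale_leq _ _)); apply: (leq_trans (size_polyMleq _ _)).
    by rewrite size_polyX add2n.
  rewrite coefD !coefZ coefXM /= IH2 (nth_default _ IH1) mulr0 add0r.
  by rewrite exprS.
move=> [h1 h2]; split.
  rewrite (leq_trans (size_polyMleq _ _)) //.
  by move: h1 hs; case: (size _) => [|x] /=; lia.
rewrite coefM (bigD1 (inord (m i))) //= inordK ?ltnS ?leq_addr //.
rewrite addKn h2 big1 ?addr0 // => j hj.
have [lt|gt|e] := ltngtP j (m i).
- by rewrite [p`__]nth_default ?mulr0 // (leq_trans hs) //; lia.
- by rewrite [X in X * _]nth_default ?mul0r // (leq_trans h1).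
- by case/eqP: hj; apply: val_inj; rewrite /= inordK ?e // ltnS leq_addr.
Qed.

Lemma ev_sum u w P : ev u w P = \sum_(m <- msupp P) P@_m *: ev u w 'X_[m].
Proof.
rewrite {1}(mpolyE P) raddf_sum /=; apply: eq_bigr => m _.
exact: lsubZ.
Qed.

Lemma size_ev P d u w : P \is d.-homog -> (size (ev u w P) <= d.+1)%N.
Proof.
move=> /dhomogP hP; rewrite ev_sum big_seq.
apply: (big_ind (fun p : {poly K} => size p <= d.+1)%N); first by rewrite size_poly0.
  move=> p q hp hq; rewrite (leq_trans (size_polyD _ _)) // geq_max hp.
  exact: hq.
move=> m /hP <-; rewrite (leq_trans (size_scale_leq _ _)) //.
exact: (size_mon _ _ _).1.
Qed.

Lemma coef_ev P d u w : P \is d.-homog -> (ev u w P)`_d = P.@[w].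
Proof.
move=> /dhomogP hP; rewrite ev_sum coef_sum {3}(mpolyE P) raddf_sum /=.
apply: eq_big_seq => m /hP <-.
by rewrite coefZ mevalZ (size_mon _ _ _).2.
Qed.

Lemma size_ev_eq P d u w : P \is d.-homog -> P.@[w] != 0 ->
  size (ev u w P) = d.+1.
Proof.
move=> hP h; apply/eqP; rewrite eqn_leq size_ev //=.
by apply: contraNT h; rewrite -leqNgt => h; rewrite -(coef_ev u w hP) nth_default.
Qed.

Lemma pihomogM P Q k d : P \is k.-homog -> (k <= d)%N ->
  pihomog mdeg d (P * Q) = P * pihomog mdeg (d - k) Q.
Proof.
move=> hP hkd; rewrite (pihomog_partitionE (leqnn (msize Q))).
rewrite mulr_sumr !raddf_sum /= mulr_sumr; apply: eq_bigr => i _.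
have [e|ne] := eqVneq (i : nat) (d - k)%N.
  rewrite -e pihomog_id pihomog_dE // e -{2}(subnKC hkd).
  exact: dhomogM hP (pihomogP _ _ _).
rewrite (pihomog_ne0 ne (pihomogP _ _ _)) mulr0.
apply: (@pihomog_ne0 _ _ _ (k + i)%N); first by apply: contraNneq ne; lia.
exact: dhomogM hP (pihomogP _ _ _).
Qed.

Lemma pihomogM0 P Q k d : P \is k.-homog -> (d < k)%N ->
  pihomog mdeg d (P * Q) = 0.
Proof.
move=> hP hkd; rewrite (pihomog_partitionE (leqnn (msize Q))).
rewrite mulr_sumr !raddf_sum /= big1 // => i _.
apply: (@pihomog_ne0 _ _ _ (k + i)%N); first by lia.
exact: dhomogM hP (pihomogP _ _ _).
Qed.

End Field.

(** * Division by a linear form *)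

Lemma mmap_homog n (K : nzRingType) (S : comNzRingType) (f : {rmorphism K -> S})
    (P : {mpoly K[n]}) d (c : S) (h : 'I_n -> S) : P \is d.-homog ->
  mmap f (fun i => c * h i) P = c ^+ d * mmap f h P.
Proof.
move=> /dhomogP hP; rewrite /mmap mulr_sumr; apply: eq_big_seq => m hm.
rewrite mulrCA; congr (_ * _).
have <- : mdeg m = d := hP _ hm.
rewrite /mmap1 mdegE -prodrXr -big_split /=.
by apply: eq_bigr => i _; rewrite exprMn.
Qed.

Lemma map_lsub n (K : nzRingType) (S S' : comNzRingType) (f : {rmorphism K -> S})
    (g : {rmorphism S -> S'}) (u w : 'I_n -> S) (P : {mpoly K[n]}) :
  map_poly g (lsub f u w P) = lsub (g \o f) (g \o u) (g \o w) P.
Proof.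
elim/mpoly_ring_ind: P => [c|i|p q hp hq|p q hp hq].
- by rewrite !lsubC map_polyC.
- by rewrite !lsubX rmorphD /= map_polyC map_polyZ map_polyX.
- by rewrite !rmorphD /= hp hq.
- by rewrite !rmorphM /= hp hq.
Qed.

Lemma mmap_ext n (K : nzRingType) (S : nzRingType) (f : K -> S)
    (h1 h2 : 'I_n -> S) (P : {mpoly K[n]}) :
  h1 =1 h2 -> mmap f h1 P = mmap f h2 P.
Proof.
move=> e; apply: eq_bigr => m _; congr (_ * _).
by apply: eq_bigr => i _; rewrite e.
Qed.

Lemma morph_congr n (K : nzRingType) (S : comNzRingType) (nu : S)
    (f g : {rmorphism {mpoly K[n]} -> S}) :
    (forall c, f c%:MP = g c%:MP) ->
    (forall i, exists q, f 'X_i - g 'X_i = nu * q) ->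
  forall P, exists Q, f P - g P = nu * Q.
Proof.
move=> hC hX; elim/mpoly_ring_ind => [c|i|p q [x hx] [y hy]|p q [x hx] [y hy]].
- by exists 0; rewrite hC subrr mulr0.
- exact: hX.
- by exists (x + y); rewrite !rmorphD mulrDr -hx -hy; ring.
- exists (x * f q + g p * y); rewrite !rmorphM.
  have -> : nu * (x * f q + g p * y) = (nu * x) * f q + g p * (nu * y) by ring.
  by rewrite -hx -hy; ring.
Qed.

Section Frame.
Variables (n : nat) (K : fieldType).
Implicit Types (P Q F : {mpoly K[n]}) (u v w r : 'I_n -> K).

(** Linear coordinates al, be, nu dual to u, w, r; the line through u and w is
   nu = 0. *)
Definition frame u w r (al be nu : {mpoly K[n]}) : Prop :=
  [/\ al \is 1.-homog, be \is 1.-homog, nu \is 1.-homog,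
      forall i, 'X_i = u i *: al + w i *: be + r i *: nu
    & [/\ ev u w al = 1, ev u w be = 'X & ev u w nu = 0]].

Variables (u w r : 'I_n -> K) (al be nu : {mpoly K[n]}).
Hypothesis fr : frame u w r al be nu.

Lemma frame_al0 : al != 0.
Proof.
case: fr => _ _ _ _ [h _ _]; apply/eqP => e; move: h; rewrite e rmorph0.
by move/eqP; rewrite eq_sym oner_eq0.
Qed.

(** Modulo nu, the form P is P (u al + w be), that is al^d P (u + (be / al) w) in
   the field of fractions. *)
Lemma vanish_line P d : P \is d.-homog -> ev u w P = 0 ->
  exists2 P', P' \is (d.-1).-homog & P = nu * P'.
Proof.
move=> hP h0.
pose psi : {mpoly K[n]} -> {mpoly K[n]} :=
  mmap (@mpolyC n K) (fun i => u i *: al + w i *: be).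
have h1 : psi P = 0.
  apply/eqP; rewrite -tofrac_eq0.
  pose f : {rmorphism K -> {fraction {mpoly K[n]}}} :=
    @tofrac {mpoly K[n]} \o @mpolyC n K.
  pose al' := tofrac al; pose s := tofrac be / al'.
  have hal : al' != 0 by rewrite tofrac_eq0 frame_al0.
  have -> : tofrac (psi P) = mmap f (fun i => al' * (f (u i) + s * f (w i))) P.
    rewrite /psi; elim/mpoly_ring_ind: {+}P => [c|i|p q hp hq|p q hp hq].
    - by rewrite !mmapC.
    - rewrite !mmapX !mmap1U rmorphD -!mul_mpolyC !rmorphM /= mulrDr mulrA.
      by rewrite /s [al' * (_ / _)]mulrC divfK // mulrC; congr (_ + _); rewrite mulrC.
    - by rewrite !mmapD rmorphD /= hp hq.
    - by rewrite !rmorphM /= hp hq.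
  rewrite (mmap_homog f al' (fun i => f (u i) + s * f (w i)) hP).
  rewrite -(horner_lsub f (f \o u) (f \o w)) -[lsub _ _ _ _](map_lsub idfun f).
  by rewrite -[lsub _ _ _ _]/(ev u w P) h0 rmorph0 horner0 mulr0.
have [c|i|Q] := @morph_congr n K _ nu idfun
  (mmap (@mpolyC n K) (fun i => u i *: al + w i *: be)) _ _ P.
- by rewrite /= mmapC.
- exists (r i)%:MP; rewrite /= mmapX mmap1U; case: fr => _ _ _ -> _.
  by rewrite -!mul_mpolyC; ring.
rewrite /= -[mmap _ _ _]/(psi P) h1 subr0 => e.
have [d0|d0] := posnP d.
  exists 0; first exact: dhomog0.
  case: fr => _ _ hnu _ _.
  by rewrite mulr0 -(pihomog_dE hP) e (pihomogM0 _ hnu) // d0.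
exists (pihomog mdeg d.-1 Q); first exact: pihomogP.
case: fr => _ _ hnu _ _.
by rewrite -(pihomog_dE hP) e (pihomogM _ hnu) // subn1.
Qed.

Lemma lift_line (g : {poly K}) d : (size g <= d.+1)%N ->
  exists2 G : {mpoly K[n]}, G \is d.-homog & ev u w G = g.
Proof.
move=> hs; case: fr => hal hbe _ _ [eal ebe _].
exists (\sum_(k < d.+1) g`_k *: (al ^+ (d - k) * be ^+ k)).
  apply: rpred_sum => k _; apply: dhomogZ.
  have := dhomogM (dhomogMn (d - k) hal) (dhomogMn k hbe).
  by rewrite !mul1n subnK // -ltnS.
rewrite raddf_sum /=.
have e : g = \poly_(k < d.+1) g`_k.
  apply/polyP => k; rewrite coef_poly; case: ltnP => // h.
  by rewrite nth_default // (leq_trans hs).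
rewrite [RHS]e poly_def; apply: eq_bigr => k _.
by rewrite [LHS]lsubZ rmorphM !rmorphXn /= -/(ev u w) eal ebe expr1n mul1r.
Qed.

(** The quotient of the restrictions lifts to a form a, and P - F a vanishes on the
   line. The last clause says that a = 0 when its degree would be negative. *)
Lemma divide_line F e P d : F \is e.-homog -> F.@[w] != 0 -> P \is d.-homog ->
    ev u w F %| ev u w P ->
  exists a b : {mpoly K[n]},
    [/\ a \is (d - e).-homog, b \is (d.-1).-homog, P = F * a + nu * b
      & (a == 0) || (e <= d)%N].
Proof.
move=> hF hFw hP /dvdpP[g hg].
have [g0|g0] := eqVneq g 0.
  have [|b hb ->] := vanish_line hP; first by rewrite hg g0 mul0r.
  by exists 0, b; rewrite mulr0 add0r eqxx; split=> //; apply: dhomog0.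
have sF := size_ev_eq u hF hFw.
have F0 : ev u w F != 0 by rewrite -size_poly_gt0 sF.
have := size_ev u w hP; rewrite hg size_mul // sF addnS /= => hs.
have hed : (e <= d)%N.
  have : (0 < size g)%N by rewrite size_poly_gt0.
  by move: hs; set k := size _; clearbody k; lia.
have [|a ha ea] := @lift_line g (d - e).
  by move: hs; set k := size _; clearbody k; lia.
have hPF : P - F * a \is d.-homog.
  by rewrite rpredB //; have := dhomogM hF ha; rewrite subnKC.
have [|b hb e1] := vanish_line hPF.
  by rewrite rmorphB rmorphM /= ea hg mulrC subrr.
by exists a, b; split=> //; rewrite ?hed ?orbT // -e1 addrC subrK.
Qed.

End Frame.

(** * Common zeros of forms *)

Lemma size_mul_bound (R : nzRingType) (p q : {poly R}) a b :
  (size p <= a)%N -> (size q <= b.+1)%N -> (size (p * q)%R <= a + b)%N.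
Proof.
move=> hp hq; apply: (leq_trans (size_polyMleq _ _)).
rewrite -subn1 leq_subLR; apply: (leq_trans (leq_add hp hq)).
by rewrite addnS add1n.
Qed.

Lemma size1_coef0 (R : nzRingType) (p : {poly R}) :
  (size p <= 1)%N -> p != 0 -> p`_0 != 0.
Proof. by move=> h; apply: contraNneq => e; rewrite (size1_polyC h) e. Qed.

Section Ideal2.
Variables (n : nat) (K : fieldType) (P Q : {mpoly K[n]}).

(** The ideal generated by P and Q. *)
Definition ideal2 (f : {mpoly K[n]}) : Prop := exists x y, f = x * P + y * Q.

Lemma ideal2_0 : ideal2 0.
Proof. by exists 0, 0; rewrite !mul0r addr0. Qed.
Lemma ideal2_D f g : ideal2 f -> ideal2 g -> ideal2 (f + g).
Proof. by move=> [x [y ->]] [x' [y' ->]]; exists (x + x'), (y + y'); ring. Qed.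
Lemma ideal2_M f g : ideal2 g -> ideal2 (f * g).
Proof. by move=> [x [y ->]]; exists (f * x), (f * y); ring. Qed.
Lemma ideal2_Z c g : ideal2 g -> ideal2 (c *: g).
Proof. by rewrite -mul_mpolyC; apply: ideal2_M. Qed.
Lemma ideal2_l : ideal2 P.
Proof. by exists 1, 0; ring. Qed.
Lemma ideal2_r : ideal2 Q.
Proof. by exists 0, 1; ring. Qed.

(** The coefficients of a homogeneous combination can be replaced by their
   homogeneous parts, which vanish in negative degree. *)
Lemma ideal2_homog da db d f : P \is da.-homog -> Q \is db.-homog ->
    f \is d.-homog -> ideal2 f ->
  exists x y : {mpoly K[n]},
    [/\ x \is (d - da).-homog, y \is (d - db).-homog, f = x * P + y * Q
      & (d < db)%N -> y = 0].
Proof.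
move=> hP hQ hf [x [y e]].
exists (if (da <= d)%N then pihomog mdeg (d - da) x else 0).
exists (if (db <= d)%N then pihomog mdeg (d - db) y else 0).
split.
- by case: ifP => _; rewrite ?dhomog0 ?pihomogP.
- by case: ifP => _; rewrite ?dhomog0 ?pihomogP.
- rewrite -(pihomog_dE hf) e pihomogD ![_ * P]mulrC ![_ * Q]mulrC; congr (_ + _).
    by case: leqP => h; [rewrite (pihomogM _ hP)|rewrite (pihomogM0 _ hP) ?mulr0].
  by case: leqP => h; [rewrite (pihomogM _ hQ)|rewrite (pihomogM0 _ hQ) ?mulr0].
- by rewrite ltnNge => /negbTE ->.
Qed.

End Ideal2.

Section CommonZero.
Variables (n : nat) (K : closedFieldType).
Variables (u w r : 'I_n.+1 -> K) (al be nu : {mpoly K[n.+1]}).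
Hypothesis fr : frame u w r al be nu.
Variables (P Q : {mpoly K[n.+1]}) (da db : nat).
Hypotheses (hP : P \is da.-homog) (hQ : Q \is db.-homog).
Hypotheses (hPw : P.@[w] != 0) (hPQ : coprimep (ev u w P) (ev u w Q)).

Local Notation I := (ideal2 P Q).

Let evP0 : ev u w P != 0.
Proof. by rewrite -size_poly_gt0 (size_ev_eq u hP hPw). Qed.

Let ev_nu : ev u w nu = 0.
Proof. by case: fr => _ _ _ _ []. Qed.

Let nu0 f : nu != 0 -> nu * f = 0 -> f = 0.
Proof. by move=> h /eqP; rewrite mulf_eq0 (negPf h) => /eqP. Qed.

(** P and Q have no common zero on the line nu = 0, so nu is not a zero divisor
   modulo (P, Q): a relation x P + y Q = 0 on the line is a multiple of (Q, - P). *)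
Lemma ideal2_nu d f : nu != 0 -> f \is d.-homog -> I (nu * f) -> I f.
Proof.
move=> nuN0 hf hI.
have hnf : nu * f \is d.+1.-homog.
  by case: fr => _ _ hnu _ _; have := dhomogM hnu hf; rewrite add1n.
have [x [y [hx hy e y0]]] := ideal2_homog hP hQ hnf hI.
have [lt|le] := ltnP d.+1 db.
  have ex : ev u w x = 0.
    apply/eqP; have /eqP := congr1 (ev u w) e.
    rewrite (y0 lt) mul0r addr0 !rmorphM /= ev_nu mul0r eq_sym mulf_eq0.
    by rewrite (negPf evP0) orbF.
  have [x' _ ex'] := vanish_line fr hx ex.
  exists x', 0; apply/(mulfI nuN0); rewrite e (y0 lt) ex'; ring.
have dy : ev u w P %| ev u w y.
  rewrite -(Gauss_dvdpl _ hPQ) -[_ * _]addr0.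
  have /eqP := congr1 (ev u w) e.
  rewrite rmorphD !rmorphM /= ev_nu mul0r eq_sym addrC addr_eq0 => /eqP ->.
  by rewrite addr0 dvdpNr dvdp_mull.
have [c [y' [hc hy' ey hca]]] := divide_line fr hP hPw hy dy.
have hxc : x + c * Q \is (d.+1 - da).-homog.
  rewrite rpredD //; case/orP: hca => [/eqP ->|h].
    by rewrite mul0r dhomog0.
  have -> : (d.+1 - da = d.+1 - db - da + db)%N by clear -le h; lia.
  exact: dhomogM.
have exc : ev u w (x + c * Q) = 0.
  apply/eqP; have /eqP := congr1 (ev u w) e.
  rewrite ey !(rmorphD, rmorphM) /= ev_nu !mul0r addr0 eq_sym.
  have -> : ev u w x * ev u w P + ev u w P * ev u w c * ev u w Q =
     (ev u w x + ev u w c * ev u w Q) * ev u w P by ring.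
  by rewrite mulf_eq0 (negPf evP0) orbF.
have [x' _ ex'] := vanish_line fr hxc exc.
exists x', y'; apply/(mulfI nuN0).
have -> : nu * (x' * P + y' * Q) = (nu * x') * P + nu * y' * Q by ring.
by rewrite -ex' e ey; ring.
Qed.

Lemma ideal2_nuX k d f : nu != 0 -> f \is d.-homog -> I (nu ^+ k * f) -> I f.
Proof.
move=> nuN0 hf; elim: k => [|k IH]; first by rewrite mul1r.
rewrite exprS -mulrA => h; apply: IH.
apply: (ideal2_nu (d := (1 * k + d)%N)) => //.
by case: fr => _ _ hnu _ _; apply: dhomogM => //; apply: dhomogMn.
Qed.

(** By the relation of Bezout on the line, (P, Q) contains, modulo nu, every form
   of degree at least da + db. *)
Lemma reduce_line d f : (da + db <= d)%N -> f \is d.-homog ->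
  exists2 f', f' \is (d.-1).-homog & I (f - nu * f').
Proof.
move=> hd hf.
have /Bezout_eq1_coprimepP [[U V] /= eUV] := hPQ.
have sP := size_ev_eq u hP hPw.
pose y : {poly K} := (ev u w f * V) %% ev u w P.
have sy : (size y <= da)%N by rewrite -ltnS -sP ltn_modp.
pose x : {poly K} := (ev u w f * V) %/ ev u w P * ev u w Q + ev u w f * U.
have exy : ev u w f = x * ev u w P + y * ev u w Q.
  have h := divp_eq (ev u w f * V) (ev u w P); rewrite -/y in h.
  rewrite -{1}[ev u w f]mulr1 -eUV mulrDr.
  rewrite (mulrA _ V) h /x.
  by move: (_ %/ _) => z; ring.
have sx : (size x <= (d - da).+1)%N.
  have [->|x0] := eqVneq x 0; first by rewrite size_poly0.
  have : (size (x * ev u w P)%R <= d.+1)%N.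
    have -> : x * ev u w P = ev u w f - y * ev u w Q by rewrite exy addrK.
    apply: (leq_trans (size_polyD _ _)); rewrite geq_max size_ev //=.
    rewrite size_polyN; apply: leq_trans (leqW hd).
    exact: size_mul_bound sy (size_ev u w hQ).
  rewrite size_mul // sP addnS /= => h.
  have hda : (da <= d)%N by clear -hd; lia.
  by rewrite -subSn // (leq_subRL _ (leqW hda)) addnC.
have [X hX eX] := lift_line fr sx.
have [Y hY eY] : exists2 G : {mpoly K[n.+1]}, G \is (d - db).-homog & ev u w G = y.
  by apply: (lift_line fr); apply: (leq_trans sy); clear -hd; lia.
have hf' : f - (X * P + Y * Q) \is d.-homog.
  have h1 := dhomogM hX hP; have h2 := dhomogM hY hQ.
  rewrite subnK in h1; last by clear -hd; lia.
  rewrite subnK in h2; last by clear -hd; lia.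
  by rewrite rpredB ?rpredD.
have [|f' hf1 e] := vanish_line fr hf'.
  by rewrite !(rmorphB, rmorphD, rmorphM) /= eX eY exy subrr.
exists f' => //; exists X, Y; rewrite -e; ring.
Qed.

Lemma reduce_lineX k f : f \is (da + db + k).-homog ->
  exists2 f', f' \is (da + db).-homog & I (f - nu ^+ k * f').
Proof.
elim: k f => [|k IH] f hf.
  by exists f; [rewrite addn0 in hf|rewrite mul1r subrr; apply: ideal2_0].
have [|f1 hf1 i1] := reduce_line _ hf; first by lia.
rewrite addnS /= in hf1; have [f2 hf2 i2] := IH _ hf1.
exists f2 => //.
have -> : f - nu ^+ k.+1 * f2 = (f - nu * f1) + nu * (f1 - nu ^+ k * f2).
  by rewrite exprS; ring.
by apply: ideal2_D => //; apply: ideal2_M.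
Qed.

(** The homogeneous form nu^N phi (x / nu). *)
Definition homg (x : {mpoly K[n.+1]}) N (phi : {poly K}) : {mpoly K[n.+1]} :=
  \sum_(i < N.+1) phi`_i *: (x ^+ i * nu ^+ (N - i)).

Lemma homg_XsubC x N (s : K) (phi : {poly K}) : (size phi <= N.+1)%N ->
  homg x N.+1 (('X - s%:P) * phi) = (x - s *: nu) * homg x N phi.
Proof.
move=> hs; rewrite /homg.
have e i : (('X - s%:P) * phi)`_i = (if i == 0%N then 0 else phi`_i.-1) - s * phi`_i.
  by rewrite mulrBl coefB coefXM coefCM.
transitivity (\sum_(i < N.+2) ((if i == 0%N :> nat then 0 else phi`_i.-1) *: (x ^+ i * nu ^+ (N.+1 - i))
    - (s * phi`_i) *: (x ^+ i * nu ^+ (N.+1 - i)))).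
  by apply: eq_bigr => i _; rewrite e scalerBl.
rewrite sumrB [RHS]mulrBl; congr (_ - _).
  rewrite big_ord_recl /= scale0r add0r mulr_sumr; apply: eq_bigr => i _.
  rewrite /= /bump /= add1n subSS -[RHS]scalerAr; congr (_ *: _).
  by rewrite exprS mulrA.
rewrite big_ord_recr /= (nth_default _ hs) mulr0 scale0r addr0 mulr_sumr.
apply: eq_bigr => i _; rewrite subSn; last by rewrite -ltnS.
rewrite -[RHS]scalerAl -[in RHS]scalerAr scalerA; congr (_ *: _).
by rewrite exprS mulrCA.
Qed.

Lemma homg_homog x N (phi : {poly K}) : x \is 1.-homog -> homg x N phi \is N.-homog.
Proof.
case: fr => _ _ hnu _ _ hx; apply: rpred_sum => i _; apply: dhomogZ.
have := dhomogM (dhomogMn i hx) (dhomogMn (N - i) hnu).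
by rewrite !mul1n subnKC // -ltnS.
Qed.

(** The factors X - s of phi are taken off one at a time; one of them is the first
   to leave the ideal, and s is an eigenvalue of x / nu. *)
Lemma eigen_poly x N m g (phi : {poly K}) : nu != 0 -> x \is 1.-homog -> g \is m.-homog ->
    ~ I g -> phi != 0 -> (size phi <= N.+1)%N -> I (homg x N phi * g) ->
  exists s h m', [/\ h * g \is m'.-homog, ~ I (h * g) & I ((x - s *: nu) * (h * g))].
Proof.
move=> nuN0 hx hg ng; elim: N phi => [|N IH] phi phi0 hs hI.
  have h0 := size1_coef0 hs phi0.
  move: hI; rewrite /homg big_ord1 /= mul1r -scalerAl mul1r.
  by move=> /(ideal2_Z (phi`_0)^-1); rewrite scalerA mulVf ?scale1r.
have [s1|s1] := leqP (size phi) 1.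
  have h0 := size1_coef0 s1 phi0.
  move: hI; rewrite /homg big_ord_recl /= big1.
    rewrite addr0 mul1r -scalerAl => /(ideal2_Z (phi`_0)^-1).
    by rewrite scalerA mulVf // scale1r => /(ideal2_nuX nuN0 hg).
  by move=> i _; rewrite nth_default ?scale0r // (leq_trans s1).
have /closed_rootP[s /factor_theorem[psi e]] : size phi != 1%N.
  by rewrite neq_ltn s1 orbT.
have psi0 : psi != 0 by apply: contraNneq phi0; rewrite e => ->; rewrite mul0r.
have hs' : (size psi <= N.+1)%N.
  by move: hs; rewrite e size_Mmonic ?monicXsubC // size_XsubC addn2.
move: hI; rewrite e [psi * _]mulrC homg_XsubC // => hI.
have [h|h] := EM (I (homg x N psi * g)); first exact: (IH psi).
exists s, (homg x N psi), (N + m)%N; split=> //.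
  by apply: dhomogM => //; apply: homg_homog.
by rewrite mulrA.
Qed.

(** Modulo (P, Q), every multiple of g is, up to a power of nu, given by a form of
   degree da + db. These forms make up a space of finite dimension, so the powers of
   x / nu satisfy a polynomial relation on g. *)
Lemma eigen x m g : nu != 0 -> x \is 1.-homog -> g \is m.-homog -> ~ I g ->
  exists s h m', [/\ h * g \is m'.-homog, ~ I (h * g) & I ((x - s *: nu) * (h * g))].
Proof.
move=> nuN0 hx hg ng.
pose V := dhomog n.+1 K (da + db); pose N := \dim {:V}.
have hnu : nu \is 1.-homog by case: fr.
have hmon i : (i <= N)%N ->
    x ^+ i * nu ^+ (N - i) * nu ^+ (da + db) * g \is (da + db + (N + m)).-homog.
  move=> hi; have := dhomogM (dhomogM (dhomogM (dhomogMn i hx) (dhomogMn (N - i) hnu))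
    (dhomogMn (da + db) hnu)) hg.
  by have -> : (1 * i + 1 * (N - i) + 1 * (da + db) + m = da + db + (N + m))%N
    by clear -hi; lia.
have hr (i : 'I_N.+1) : {rho : V | I (x ^+ i * nu ^+ (N - i) * nu ^+ (da + db) * g
    - nu ^+ (N + m) * (mpoly_of_dhomog rho))}.
  apply: cid; have [|f' hf' h] := @reduce_lineX (N + m) _ (hmon i _); first by rewrite -ltnS.
  by exists (DHomog hf').
pose X := [tuple sval (hr i) | i < N.+1].
have : ~~ free X.
  apply/negP; rewrite /free size_tuple => /eqP e.
  by have := dimvS (subvf <<X>>%VS); rewrite e ltnn.
move/freeP => /= hX.
have [k [hk [i0 hi0]]] : exists k : 'I_N.+1 -> K,
    \sum_(i < N.+1) k i *: X`_i = 0 /\ exists i, k i != 0.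
  apply: contrapT => hn; apply: hX => k hk i; apply: contrapT => /eqP hi.
  by apply: hn; exists k; split=> //; exists i.
pose phi := \poly_(i < N.+1) k (inord i).
have cphi (i : 'I_N.+1) : phi`_i = k i by rewrite coef_poly ltn_ord inord_val.
have phi0 : phi != 0.
  by apply: contraNneq hi0 => e; rewrite -cphi e coef0.
apply: (eigen_poly (x := x) (N := N) nuN0 hx hg ng phi0 (size_poly _ _)).
apply: (ideal2_nuX (k := da + db) (d := (N + m)%N)) => //.
  by apply: dhomogM => //; apply: homg_homog.
have -> : nu ^+ (da + db) * (homg x N phi * g) =
    \sum_(i < N.+1) k i *: (x ^+ i * nu ^+ (N - i) * nu ^+ (da + db) * g).
  rewrite /homg mulr_suml mulr_sumr; apply: eq_bigr => i _.
  by rewrite cphi -scalerAl -scalerAr; congr (_ *: _); rewrite mulrCA mulrA.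
have -> : \sum_(i < N.+1) k i *: (x ^+ i * nu ^+ (N - i) * nu ^+ (da + db) * g) =
   \sum_(i < N.+1) k i *: (x ^+ i * nu ^+ (N - i) * nu ^+ (da + db) * g
     - nu ^+ (N + m) * mpoly_of_dhomog X`_i).
  have e0 : \sum_(i < N.+1) nu ^+ (N + m) * mpoly_of_dhomog (k i *: X`_i) = 0.
    by rewrite -mulr_sumr -raddf_sum hk raddf0 mulr0.
  transitivity (\sum_(i < N.+1) k i *: (x ^+ i * nu ^+ (N - i) * nu ^+ (da + db) * g)
    - \sum_(i < N.+1) nu ^+ (N + m) * mpoly_of_dhomog (k i *: X`_i)).
    by rewrite e0 subr0.
  rewrite -sumrB; apply: eq_bigr => i _.
  by rewrite scalerBr linearZ /= -scalerAr.
apply: (big_ind I); [exact: ideal2_0|exact: ideal2_D|move=> i _].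
apply: ideal2_Z; rewrite -tnth_nth tnth_mktuple.
exact: (svalP (hr i)).
Qed.

(** A weak Nullstellensatz. Eigenvalues of al / nu and then of be / nu on multiples
   of g, modulo (P, Q), are the coordinates of a point v. A form T acts on the
   eigenvector as nu^d T(v), so a form that annihilates it vanishes at v. *)
Lemma common_zero G e g m : G \is e.-homog -> g \is m.-homog -> nu != 0 ->
    I (G * g) -> ~ I g ->
  exists v, [/\ exists i, v i != 0, P.@[v] = 0, Q.@[v] = 0 & G.@[v] = 0].
Proof.
move=> hG hg nuN0 hGg ng; case: (fr) => hal hbe hnu hX _.
have [s [h [m1 [hg1 ng1 i1]]]] := eigen nuN0 hal hg ng.
have [s' [h' [m2 [hg2 ng2 i2]]]] := eigen nuN0 hbe hg1 ng1.
set g2 := h' * _ in hg2 ng2 i2.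
have i1' : I ((al - s *: nu) * g2) by rewrite mulrCA; apply: ideal2_M.
pose v i := u i * s + w i * s' + r i.
have key T : I (T * g2 - mmap (@mpolyC _ K) (fun i => nu * (v i)%:MP) T * g2).
  elim/mpoly_ring_ind: T => [c|i|p q hp hq|p q hp hq].
  - by rewrite mmapC subrr; apply: ideal2_0.
  - rewrite mmapX mmap1U hX.
    have -> : (u i *: al + w i *: be + r i *: nu) * g2 - nu * (v i)%:MP * g2 =
      u i *: ((al - s *: nu) * g2) + w i *: ((be - s' *: nu) * g2).
      by rewrite /v -!mul_mpolyC !rmorphD !rmorphM /=; ring.
    by apply: ideal2_D; apply: ideal2_Z.
  - rewrite mmapD; move: (mmap _ _ p) (mmap _ _ q) hp hq => a b hp hq.
    have -> : (p + q) * g2 - (a + b) * g2 = (p * g2 - a * g2) + (q * g2 - b * g2) by ring.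
    exact: ideal2_D.
  - rewrite rmorphM /=; move: (mmap _ _ p) (mmap _ _ q) hp hq => a b hp hq.
    have -> : (p * q) * g2 - (a * b) * g2 = p * (q * g2 - b * g2) + b * (p * g2 - a * g2) by ring.
    by apply: ideal2_D; apply: ideal2_M.
have key2 T d : T \is d.-homog -> I (T * g2) -> T.@[v] = 0.
  move=> hT hI; have := key T.
  rewrite (mmap_homog _ nu (fun i => (v i)%:MP) hT) => hI2.
  have h3 : I ((nu ^+ d * mmap (@mpolyC _ K) (fun i => (v i)%:MP) T) * g2).
    have -> : forall y, y * g2 = T * g2 + (-1) * (T * g2 - y * g2) by move=> y; ring.
    by apply: ideal2_D => //; apply: ideal2_M.
  have e3 : mmap (@mpolyC n.+1 K) (fun i => (v i)%:MP) T = (T.@[v])%:MP.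
    elim/mpoly_ring_ind: {+}T => [c|i|p q hp hq|p q hp hq].
    - by rewrite mmapC mevalC.
    - by rewrite mmapX mmap1U mevalXU.
    - by rewrite mmapD mevalD hp hq mpolyCD.
    - by rewrite rmorphM /= hp hq mevalM mpolyCM.
  apply/eqP; apply: contrapT => /negP hv; apply: ng2.
  apply: (ideal2_nuX (k := d) nuN0 hg2).
  have -> : nu ^+ d * g2 = (T.@[v])^-1 *:
     ((nu ^+ d * mmap (@mpolyC _ K) (fun i => (v i)%:MP) T) * g2).
    by rewrite e3 [_ * _%:MP]mulrC mul_mpolyC -scalerAl scalerA mulVf // scale1r.
  exact: ideal2_Z.
exists v; split.
- apply: contrapT => hv; apply: ng2.
  have v0 i : v i = 0 by apply: contrapT => /eqP hi; apply: hv; exists i.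
  have := key nu.
  rewrite (mmap_ext _ (h2 := fun i => 0 * 0)); last by move=> i; rewrite v0 mpolyC0 !mulr0.
  rewrite (mmap_homog _ 0 (fun _ => 0) hnu) expr1 !mul0r subr0.
  exact: (ideal2_nu nuN0 hg2).
- by apply: (key2 P _ hP); rewrite mulrC; apply: ideal2_M; apply: ideal2_l.
- by apply: (key2 Q _ hQ); rewrite mulrC; apply: ideal2_M; apply: ideal2_r.
- apply: (key2 G _ hG); rewrite /g2 !mulrA [G * h']mulrC -!mulrA; apply: ideal2_M.
  by rewrite mulrCA; apply: ideal2_M.
Qed.

End CommonZero.

(** * Coordinate frames and regular sequences *)

Section Three.
Variables (i j k : 'I_3) (huniq : uniq [:: i; j; k]).

Lemma ord3P l : [\/ l = i, l = j | l = k].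
Proof.
move: huniq; case: i j k l => [[|[|[|//]]] hi] [[|[|[|//]]] hj] [[|[|[|//]]] hk]
  [[|[|[|//]]] hl] //= _; by [constructor 1; apply: val_inj
  |constructor 2; apply: val_inj|constructor 3; apply: val_inj].
Qed.

Lemma neq3 : [/\ (i == j) = false, (i == k) = false & (j == k) = false] /\
  [/\ (j == i) = false, (k == i) = false & (k == j) = false].
Proof.
move: huniq; rewrite /= !inE !andbT negb_or => /andP[/andP[/negPf h1 /negPf h2] /negPf h3].
by rewrite h1 h2 h3 eq_sym h1 eq_sym h2 eq_sym h3.
Qed.

Lemma sum3 (V : nmodType) (f : 'I_3 -> V) : \sum_l f l = f i + f j + f k.
Proof.
have [[h1 h2 h3] [h4 h5 h6]] := neq3.
rewrite (bigD1 i) //= (bigD1 j) ?h4 //= (bigD1 k) ?h5 ?h6 //= big1 ?addr0 ?addrA //.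
by move=> l /andP[/andP[]]; case: (ord3P l) => ->; rewrite eqxx.
Qed.
End Three.

Lemma uniq3_perm1 (i j k : 'I_3) : uniq [:: i; j; k] -> uniq [:: j; k; i].
Proof. by rewrite -(rot_uniq 1). Qed.

Lemma exists3 (i : 'I_3) : exists j k, uniq [:: i; j; k].
Proof.
by case: i => [[|[|[|//]]] hi];
 [exists (inord 1), (inord 2)|exists (inord 0), (inord 2)|exists (inord 0), (inord 1)];
 rewrite /= !inE -!val_eqE /= !inordK.
Qed.

Section Coord.
Variable K : fieldType.

(** Vertex j of the coordinate triangle. *)
Definition e_ (j : 'I_3) : 'I_3 -> K := fun l => (l == j)%:R.

Lemma dhomogXU n (i : 'I_n) : ('X_i : {mpoly K[n]}) \is 1.-homog.
Proof. by rewrite dhomogX; apply/eqP; apply: mdeg1. Qed.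

Lemma frame_coord (i j k : 'I_3) : uniq [:: i; j; k] ->
  frame (e_ j) (e_ k) (e_ i) 'X_j 'X_k ('X_i : {mpoly K[3]}).
Proof.
move=> hu; have [[h1 h2 h3] [h4 h5 h6]] := neq3 hu.
split; try exact: dhomogXU.
  move=> l; rewrite /e_; case: (ord3P hu l) => ->;
    by rewrite ?eqxx ?h1 ?h2 ?h3 ?h4 ?h5 ?h6 ?scale1r ?scale0r ?addr0 ?add0r.
by split; rewrite [LHS]lsubX /e_ ?eqxx ?h1 ?h2 ?h3 ?h4 ?h5 ?h6 ?scale1r ?scale0r ?addr0 ?add0r.
Qed.

Lemma XN0 (i : 'I_3) : ('X_i : {mpoly K[3]}) != 0.
Proof. by apply/eqP => /(congr1 (meval (fun=> 1))); rewrite mevalXU meval0 => /eqP; rewrite oner_eq0. Qed.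

End Coord.
Arguments e_ {K}.

Section Regular.
Variables (n : nat) (K : fieldType).
Variables (u w r : 'I_n.+1 -> K) (al be nu : {mpoly K[n.+1]}).
Hypothesis fr : frame u w r al be nu.
Variables (P Q : {mpoly K[n.+1]}) (da db : nat).
Hypotheses (hP : P \is da.-homog) (hQ : Q \is db.-homog).
Hypotheses (hPw : P.@[w] != 0) (hPQ : coprimep (ev u w P) (ev u w Q)).

Lemma homog_quo (x R : {mpoly K[n.+1]}) D : R \is D.-homog -> x * P = R ->
  x \is (D - da).-homog.
Proof.
have P0 : P != 0 by apply: contraNneq hPw => ->; rewrite meval0.
move=> hR e; have := pihomog_dE hR; rewrite -e mulrC.
have [h|h] := leqP da D; first by rewrite (pihomogM _ hP) // => /(mulfI P0) <-; apply: pihomogP.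
by rewrite (pihomogM0 _ hP) // => /esym/eqP; rewrite mulf_eq0 (negPf P0) => /eqP ->; apply: dhomog0.
Qed.

(** By descent on the degree: x and y are divided by Q and P on the line nu = 0, and
   what remains is divisible by nu. *)
Lemma regular2 d (x y : {mpoly K[n.+1]}) : nu != 0 -> y \is d.-homog ->
  x * P + y * Q = 0 -> exists g, x = g * Q /\ y = - g * P.
Proof.
have P0 : P != 0 by apply: contraNneq hPw => ->; rewrite meval0.
have evP0 : ev u w P != 0 by rewrite -size_poly_gt0 (size_ev_eq u hP hPw).
have ev_nu : ev u w nu = 0 by case: fr => _ _ _ _ [].
move=> nuN0; elim/ltn_ind: d x y => d IH x y hy e.
have [y0|yN0] := eqVneq y 0.
  exists 0; rewrite y0 mul0r addr0 in e *; rewrite oppr0 !mul0r; split=> //.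
  by move/eqP: e; rewrite mulf_eq0 (negPf P0) orbF => /eqP.
have dy : ev u w P %| ev u w y.
  rewrite -(Gauss_dvdpl _ hPQ).
  have /eqP := congr1 (ev u w) e.
  by rewrite rmorph0 rmorphD !rmorphM /= addrC addr_eq0 => /eqP ->; rewrite dvdpNr dvdp_mull.
have [c [y' [hc hy' ey hca]]] := divide_line fr hP hPw hy dy.
have e1 : (x + c * Q) * P = - (nu * y' * Q) by rewrite -[RHS]add0r -e ey; ring.
have hx : x + c * Q \is (d + db - da).-homog.
  have [c0|cN0] := eqVneq c 0.
    rewrite c0 mul0r addr0; apply: (homog_quo (R := - (y * Q))).
      by rewrite rpredN; apply: dhomogM.
    by apply/eqP; rewrite -addr_eq0 e.
  apply: (homog_quo (R := - (nu * y' * Q))) => //.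
  have -> : nu * y' = y - c * P by rewrite ey; ring.
  rewrite rpredN; apply: dhomogM => //; rewrite rpredB //.
  have := dhomogM hc hP; rewrite subnK //.
  by move: hca; rewrite (negPf cN0).
have exc : ev u w (x + c * Q) = 0.
  apply/eqP; have /eqP := congr1 (ev u w) e1.
  by rewrite rmorphN !rmorphM /= ev_nu !mul0r oppr0 mulf_eq0 (negPf evP0) orbF.
have [x' _ ex'] := vanish_line fr hx exc.
have e2 : x' * P + y' * Q = 0.
  by apply: (mulfI nuN0); rewrite mulr0 mulrDr !mulrA -ex' e1 addNr.
have [y'0|y'N0] := eqVneq y' 0.
  exists (- c); move: e1; rewrite ey y'0 mulr0 mul0r oppr0 addr0 => /eqP.
  rewrite mulf_eq0 (negPf P0) orbF addr_eq0 => /eqP ->.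
  by split; ring.
have d0 : (0 < d)%N.
  case: (posnP d) => // d0; rewrite d0 in hy hca hc.
  have hca' : c * P \is 0.-homog.
    case/orP: hca => [/eqP ->|]; first by rewrite mul0r dhomog0.
    by rewrite leqn0 => /eqP da0; have := dhomogM hc hP; rewrite da0.
  case: fr => _ _ hnu _ _; have := dhomogM hnu hy'.
  have h0 : nu * y' \is 0.-homog.
    have -> : nu * y' = y - c * P by rewrite ey; ring.
    by rewrite rpredB.
  rewrite d0 => h1; have := dhomog_uniq _ h0 h1.
  by rewrite mulf_neq0 // => /(_ isT).
have [|g [eg1 eg2]] := IH d.-1 _ x' y' hy' e2; first by rewrite prednK.
exists (nu * g - c); split.
  have -> : x = nu * x' - c * Q by rewrite -ex'; ring.
  by rewrite eg1; ring.
by rewrite ey eg2; ring.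
Qed.
End Regular.

(** * Linear forms *)

Section Linear.
Variable K : fieldType.

Lemma linear_form n (l : {mpoly K[n]}) : l \is 1.-homog -> l = \sum_i l@_U_(i) *: 'X_i.
Proof.
move=> hl; apply/mpolyP => m; rewrite raddf_sum /=.
have [e|h] := eqVneq (mdeg m) 1%N.
  have : mdeg m == 1%N by rewrite e.
  rewrite mdeg_eq1 => /existsP[i /eqP ->].
  rewrite (bigD1 i) //= big1 => [|j /negPf hj]; first by rewrite mcoeffZ mcoeffX eqxx mulr1 addr0.
  by rewrite mcoeffZ mcoeffX eq_mnm1 hj mulr0.
rewrite big1 => [|j _].
  by apply/eqP; apply: contraT => /(homog_mdeg hl) e; rewrite e eqxx in h.
rewrite mcoeffZ mcoeffX; case: eqP => e; last by rewrite mulr0.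
by case/eqP: h; rewrite -e mdeg1.
Qed.

Lemma meval_linear n (l : {mpoly K[n]}) v : l \is 1.-homog -> l.@[v] = \sum_i v i * l@_U_(i).
Proof.
move=> hl; rewrite {1}(linear_form hl) raddf_sum; apply: eq_bigr => i _ /=.
by rewrite mevalZ mevalXU mulrC.
Qed.

Lemma deriv_linear n (l : {mpoly K[n]}) i : l \is 1.-homog -> l^`M(i) = (l@_U_(i))%:MP.
Proof.
move=> hl; rewrite {1}(linear_form hl) raddf_sum (bigD1 i) //= big1 => [|j /negPf hj].
  rewrite mderivZ mderivX mnm1E eqxx scale1r addr0.
  have -> : (U_(i) - U_(i))%MM = 0%MM :> 'X_{1..n}.
    by apply/mnmP => k; rewrite mnmBE subnn mnm0E.
  by rewrite mpolyX0 -mul_mpolyC mulr1.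
by rewrite mderivZ mderivX mnm1E hj scale0r scaler0.
Qed.

Lemma dd_linear n (l : {mpoly K[n]}) v w : l \is 1.-homog -> dd l v w = l.@[w].
Proof.
move=> hl; rewrite meval_linear //; apply: eq_bigr => i _.
by rewrite deriv_linear // mevalC.
Qed.

Lemma linear_coef n (l : {mpoly K[n]}) i : l \is 1.-homog ->
  l@_U_(i) = l.@[fun j => (j == i)%:R].
Proof.
move=> hl; rewrite meval_linear // (bigD1 i) //= big1 => [|j /negPf ->]; last by rewrite mul0r.
by rewrite eqxx mul1r addr0.
Qed.

Lemma linear_neq0 n (l : {mpoly K[n]}) : l \is 1.-homog -> l != 0 -> exists v, l.@[v] != 0.
Proof.
move=> hl l0; apply: contrapT => hn; case/eqP: l0; rewrite (linear_form hl).
apply: big1 => i _; suff -> : l@_U_(i) = 0 by rewrite scale0r.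
rewrite linear_coef //; apply/eqP; apply: contraT => hi.
by case: hn; exists (fun j => (j == i)%:R).
Qed.

Lemma coef1_ev n (p q : 'I_n -> K) P : (ev p q P)`_1 = dd P p q.
Proof.
rewrite -[LHS]mulr1n -coef_deriv -horner_coef0 deriv_ev.
by apply: eq_bigr => i _; congr (_ * _); apply: meval_eq => j; rewrite mul0r addr0.
Qed.

Lemma ev_linear n (p q : 'I_n -> K) (l : {mpoly K[n]}) : l \is 1.-homog -> ev p q l = (l.@[p])%:P + l.@[q] *: 'X.
Proof.
move=> hl; apply/polyP => i; rewrite coefD coefC coefZ coefX.
case: i => [|[|i]] /=; rewrite ?mulr0 ?addr0 ?add0r ?mulr1.
- by rewrite -horner_coef0 ev_at0.
- by rewrite coef1_ev dd_linear.
- by rewrite nth_default // (leq_trans (size_ev _ _ hl)).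
Qed.

End Linear.

(** * Foliations tangent to a smooth quartic *)

Lemma separable_dvdp (K : closedFieldType) (p q : {poly K}) :
  separable_poly p -> (forall x, root p x -> root q x) -> p %| q.
Proof.
move=> hs hr; have [rs e] := closed_field_poly_normal p.
have p0 := separable_poly_neq0 hs.
have c0 : lead_coef p != 0 by rewrite lead_coef_eq0.
rewrite e dvdpZl //; apply: uniq_roots_dvdp.
  apply/allP => x hx; apply: hr; rewrite e rootZ //.
  by rewrite root_prod_XsubC.
rewrite uniq_rootsE -separable_prod_XsubC.
by move: hs; rewrite e separable_poly.unlock derivZ coprimepZl // coprimepZr.
Qed.

Lemma pihomog_mul n (K : fieldType) (P Q : {mpoly K[n]}) k D : P \is k.-homog ->
  pihomog mdeg D (P * Q) = P * (if (k <= D)%N then pihomog mdeg (D - k) Q else 0).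
Proof.
move=> hP; case: leqP => h; first exact: pihomogM.
by rewrite (pihomogM0 _ hP) // mulr0.
Qed.

Section Plane.
Variable K : numClosedFieldType.
Implicit Types (P Q H : {mpoly K[3]}) (v p q : 'I_3 -> K).

Lemma mpoly_natr_neq0 m : (0 < m)%N -> (m%:R : {mpoly K[3]}) != 0.
Proof. by move=> h; rewrite -mpolyC_nat mpolyC_eq0 pnatr_eq0 -lt0n. Qed.

Section Quartic.
Variable F : {mpoly K[3]}.
Hypothesis hF : F \is 4.-homog.
Hypothesis hsm : forall v, (exists i, v i != 0) -> F.@[v] = 0 ->
  exists i, (F^`M(i)).@[v] != 0.
Hypothesis hvert : forall i, F.@[e_ i] != 0.
Hypothesis hsep : forall j k, j != k -> separable_poly (ev (e_ j) (e_ k) F).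

Lemma quartic_neq0 : F != 0.
Proof. by apply: contraNneq (hvert ord0) => ->; rewrite meval0. Qed.

Lemma quartic_deriv_homog i : F^`M(i) \is 3.-homog.
Proof. exact: (dhomog_deriv i hF). Qed.

Lemma dF_vert i : (F^`M(i)).@[e_ i] != 0.
Proof.
have := dd_self (e_ i) hF; rewrite /dd (bigD1 i) //= big1 => [|l /negPf hl].
  rewrite /e_ eqxx mul1r addr0 -/(e_ i) => ->.
  by rewrite -mulr_natr mulf_neq0 ?hvert // pnatr_eq0.
by rewrite /e_ hl mul0r.
Qed.

(** By Euler's relation, at a common zero of F_j and F_k on the side X_i = 0 the
   restriction of F has a multiple root. *)
Lemma side_coprime i j k : uniq [:: i; j; k] ->
  coprimep (ev (e_ j) (e_ k) F^`M(k)) (ev (e_ j) (e_ k) F^`M(j)).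
Proof.
move=> hu; have [[h1 h2 h3] [h4 h5 h6]] := neq3 hu.
apply: Pdiv.ClosedField.root_coprimep => t /rootP hk; apply/negP => /eqP hj.
have d0 : (ev (e_ j) (e_ k) F)^`().[t] = 0.
  have ei : e_ k i = 0 :> K by rewrite /e_ h2.
  have ej : e_ k j = 0 :> K by rewrite /e_ h3.
  have ek : e_ k k = 1 :> K by rewrite /e_ eqxx.
  rewrite deriv_ev (sum3 hu) ei ej ek !mul0r !add0r mul1r.
  by rewrite -horner_ev.
have f0 : (ev (e_ j) (e_ k) F).[t] = 0.
  apply/eqP; have := dd_self (fun l => e_ j l + t * e_ k l) hF.
  have ei : e_ j i + t * e_ k i = 0 by rewrite /e_ h1 h2 mulr0 addr0.
  rewrite -horner_ev /dd (sum3 hu) -!horner_ev hk hj !mulr0 !addr0 ei mul0r.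
  move=> /esym/eqP.
  by rewrite -mulr_natr mulf_eq0 pnatr_eq0 orbF.
have := hsep (negbT h3); rewrite separable_poly.unlock => /coprimep_root h.
by have := h t; rewrite d0 eqxx => h'; have /h' : root (ev (e_ j) (e_ k) F) t by apply/rootP.
Qed.

(** Exactness of the Koszul complex of the partial derivatives of F: if t_i were not
   in the ideal (F_j, F_k), it would be annihilated by F_i modulo this ideal, and the
   three derivatives would have a common zero. *)
Lemma koszul i j k m (ti tj tk : {mpoly K[3]}) : uniq [:: i; j; k] ->
    ti \is m.-homog -> tj \is m.-homog -> tk \is m.-homog ->
    ti * F^`M(i) + tj * F^`M(j) + tk * F^`M(k) = 0 ->
  exists a b g, [/\ ti = a * F^`M(j) + b * F^`M(k),
     tj = - a * F^`M(i) + g * F^`M(k) & tk = - b * F^`M(i) - g * F^`M(j)].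
Proof.
move=> hu hi hj hk e.
have fr := @frame_coord K _ _ _ hu; have X0 := XN0 K i.
have cop := side_coprime hu; have hw := dF_vert k.
have hI : ideal2 F^`M(k) F^`M(j) ti.
  apply: contrapT => nI.
  have [|v [hv v1 v2 v3]] := common_zero fr (quartic_deriv_homog k) (quartic_deriv_homog j) hw cop (quartic_deriv_homog i) hi X0 _ nI.
    exists (- tk), (- tj); rewrite mulrC.
    have -> : ti * F^`M(i) = (ti * F^`M(i) + tj * F^`M(j) + tk * F^`M(k))
       - tj * F^`M(j) - tk * F^`M(k) by ring.
    by rewrite e; ring.
  have d0 l : (F^`M(l)).@[v] = 0 by case: (ord3P hu l) => ->.
  have f0 : F.@[v] = 0.
    apply/eqP; have := dd_self v hF; rewrite /dd big1 => [/esym/eqP|l _].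
      by rewrite -mulr_natr mulf_eq0 pnatr_eq0 orbF.
    by rewrite d0 mulr0.
  by have [l] := hsm hv f0; rewrite d0 eqxx.
have [b [a [hb ha eti a0]]] := ideal2_homog (quartic_deriv_homog k) (quartic_deriv_homog j) hi hI.
have hy : tj + a * F^`M(i) \is m.-homog.
  rewrite rpredD //; have [lt|le] := ltnP m 3.
    by rewrite a0 // mul0r dhomog0.
  by have := dhomogM ha (quartic_deriv_homog i); rewrite subnK.
have e2 : (tk + b * F^`M(i)) * F^`M(k) + (tj + a * F^`M(i)) * F^`M(j) = 0.
  by rewrite -[RHS]e eti; ring.
have [g [e3 e4]] := regular2 fr (quartic_deriv_homog k) (quartic_deriv_homog j) hw cop X0 hy e2.
exists a, b, (- g); split; first by rewrite eti addrC.
  by have -> : tj = (tj + a * F^`M(i)) - a * F^`M(i) by [ring]; rewrite e4; ring.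
by have -> : tk = (tk + b * F^`M(i)) - b * F^`M(i) by [ring]; rewrite e3; ring.
Qed.

(** Contracting the relation between A /\ dF and F T with the radial field expresses
   4 A by T. Now T /\ dF = 0, so T is a multiple of dF by the Koszul complex, and
   Euler's relation brings in H and F B. *)
Lemma normal_form d (A : 'I_3 -> {mpoly K[3]}) :
    (forall l, A l \is d.+1.-homog) -> \sum_l 'X_l * A l = 0 ->
    (forall l m, exists T, A l * F^`M(m) - A m * F^`M(l) = F * T) ->
  exists H B, [/\ H \is (d - 2).-homog, forall l, B l \is (d - 3).-homog
    & forall l, A l = H * F^`M(l) + F * B l].
Proof.
move=> hA hR hT.
have [j [k hu]] := exists3 ord0; move: hu; set i : 'I_3 := ord0 => hu.
have [[h1 h2 h3] [h4 h5 h6]] := neq3 hu.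
have hT' l m : exists2 T, T \is d.-homog & A l * F^`M(m) - A m * F^`M(l) = F * T.
  have [T eT] := hT l m.
  have hlhs : A l * F^`M(m) - A m * F^`M(l) \is (d.+1 + 3).-homog.
    by rewrite rpredB //; apply: dhomogM; rewrite ?quartic_deriv_homog.
  exists (pihomog mdeg d T); first exact: pihomogP.
  by rewrite -(pihomog_dE hlhs) eT (pihomog_mul _ _ hF) addSnnS leq_addl addnK.
have [Ti hTi ei] := hT' j k; have [Tj hTj ej] := hT' k i; have [Tk hTk ek] := hT' i j.
move: hR (euler hF); rewrite !(sum3 hu) => hR heul.
have F0 := quartic_neq0.
have e0 : Ti * F^`M(i) + Tj * F^`M(j) + Tk * F^`M(k) = 0.
  apply: (mulfI F0); rewrite mulr0 !mulrDr !mulrA -ei -ej -ek; ring.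
have [a [b [g [e1 e2 e3]]]] := koszul hu hTi hTj hTk e0.
have four0 := @mpoly_natr_neq0 4 isT.
have quo x y : F * y = 4%:R * F * x -> y = 4%:R * x.
  by move=> h; apply: (mulfI F0); rewrite h; ring.
have E1 : 'X_j * Tk - 'X_k * Tj = 4%:R * A i.
  apply: quo.
  have -> : F * ('X_j * Tk - 'X_k * Tj) = 'X_j * (F * Tk) - 'X_k * (F * Tj) by ring.
  have -> : 4%:R * F * A i = (F *+ 4) * A i - ('X_i * A i + 'X_j * A j + 'X_k * A k) * F^`M(i).
    by rewrite hR -mulr_natr; ring.
  by rewrite -ej -ek -heul; ring.
have E2 : 'X_k * Ti - 'X_i * Tk = 4%:R * A j.
  apply: quo.
  have -> : F * ('X_k * Ti - 'X_i * Tk) = 'X_k * (F * Ti) - 'X_i * (F * Tk) by ring.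
  have -> : 4%:R * F * A j = (F *+ 4) * A j - ('X_i * A i + 'X_j * A j + 'X_k * A k) * F^`M(j).
    by rewrite hR -mulr_natr; ring.
  by rewrite -ei -ek -heul; ring.
have E3 : 'X_i * Tj - 'X_j * Ti = 4%:R * A k.
  apply: quo.
  have -> : F * ('X_i * Tj - 'X_j * Ti) = 'X_i * (F * Tj) - 'X_j * (F * Ti) by ring.
  have -> : 4%:R * F * A k = (F *+ 4) * A k - ('X_i * A i + 'X_j * A j + 'X_k * A k) * F^`M(k).
    by rewrite hR -mulr_natr; ring.
  by rewrite -ei -ej -heul; ring.
pose q : {mpoly K[3]} := (4%:R^-1)%:MP.
have q4 x : x = q * (4%:R * x).
  by rewrite mulrA /q -mpolyC_nat -mpolyCM mulVf ?mpolyC1 ?mul1r // pnatr_eq0.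
pose H := q * ('X_k * a - 'X_j * b + 'X_i * g).
pose B l := if l == i then - g else if l == j then b else - a.
have HB l : A l = H * F^`M(l) + F * B l.
  rewrite (q4 (A l)) {2}(q4 F) [4%:R * F]mulr_natl -heul /H /B.
  case: (ord3P hu l) => ->; rewrite ?eqxx ?h4 ?h5 ?h6 -?E1 -?E2 -?E3 ?e1 ?e2 ?e3 /=.
  - by ring.
  - by ring.
  - by ring.
exists (if (2 <= d)%N then pihomog mdeg (d - 2) H else 0).
exists (fun l => if (3 <= d)%N then pihomog mdeg (d - 3) (B l) else 0).
split=> [|l|l].
- by case: ifP => _; rewrite ?dhomog0 ?pihomogP.
- by case: ifP => _; rewrite ?dhomog0 ?pihomogP.
rewrite -(pihomog_dE (hA l)) HB pihomogD [H * _]mulrC [_ * F^`M(l)]mulrC; congr (_ + _).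
  by rewrite (pihomog_mul _ _ (quartic_deriv_homog l)).
by rewrite (pihomog_mul _ _ hF).
Qed.

End Quartic.
End Plane.

(** * The multiplier H *)

Section Divide.
Variable K : numClosedFieldType.
Implicit Types (P Q H : {mpoly K[3]}) (v p q : 'I_3 -> K).

Variable F : {mpoly K[3]}.
Hypothesis hF : F \is 4.-homog.
Hypothesis hsm : forall v, (exists i, v i != 0) -> F.@[v] = 0 ->
  exists i, (F^`M(i)).@[v] != 0.
Hypothesis hvert : forall i, F.@[e_ i] != 0.
Hypothesis hsep : forall j k, j != k -> separable_poly (ev (e_ j) (e_ k) F).

Lemma side_param i j k p : uniq [:: i; j; k] -> p i = 0 -> p j != 0 ->
  p =1 (fun l => p j * (e_ j l + p k / p j * e_ k l)).
Proof.
move=> hu pi pj l; have [[h1 h2 h3] [h4 h5 h6]] := neq3 hu.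
by case: (ord3P hu l) => ->; rewrite /e_ ?eqxx ?h1 ?h2 ?h3 ?h4 ?h5 ?h6
   ?mulr0 ?mulr1 ?addr0 ?add0r ?mulr0 ?mulr1 ?pi // mulrC divfK.
Qed.

(** The vertices are not on the curve; and F_j(p) = 0 would imply F_k(p) = 0 by
   Euler's relation. *)
Lemma side_point i j k p : uniq [:: i; j; k] -> p i = 0 ->
    (exists l, p l != 0) -> F.@[p] = 0 ->
  [/\ p j != 0, p k != 0 & (F^`M(j)).@[p] != 0].
Proof.
move=> hu pi pN0 Fp; have [[h1 h2 h3] [h4 h5 h6]] := neq3 hu.
have pN j' k' : uniq [:: i; j'; k'] -> p j' != 0.
  move=> hu'; apply/eqP => pj.
  have e : p =1 (fun l => p k' * e_ k' l).
    have [[h1' h2' h3'] [h4' h5' h6']] := neq3 hu'.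
    by move=> l; case: (ord3P hu' l) => ->; rewrite /e_ ?eqxx ?h1' ?h2' ?h3' ?mulr0 ?mulr1.
  move/eqP: Fp; rewrite (meval_eq _ e) (meval_homog _ _ hF) mulf_eq0 (negPf (hvert k')) orbF.
  rewrite expf_eq0 /= => /eqP pk'; case: pN0 => l; rewrite e pk' mul0r eqxx.
  by [].
have hu' : uniq [:: i; k; j].
  by rewrite /= !inE h1 h2 h6.
have pj := pN _ _ hu; have pk := pN _ _ hu'; split=> //.
apply/eqP => Fj.
have Fk : (F^`M(k)).@[p] = 0.
  have := dd_self p hF; rewrite /dd (sum3 hu) pi Fj Fp mul0r mulr0 add0r mul0rn add0r.
  by move=> /eqP; rewrite mulf_eq0 (negPf pk) => /eqP.
have e := side_param hu pi pj.
have z l : (F^`M(l)).@[p] = 0 -> root (ev (e_ j) (e_ k) F^`M(l)) (p k / p j).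
  rewrite (meval_eq _ e) (meval_homog _ _ (quartic_deriv_homog hF l)) => /eqP.
  by rewrite mulf_eq0 expf_eq0 (negPf pj) /= -horner_ev.
have /coprimep_root h := side_coprime hF hsep hu.
by have /eqP := h _ (z k Fk); rewrite (rootP (z j Fj)).
Qed.

(** H vanishes to order at least 2 at p along the curve F = 0. *)
Definition tang2 H p := H.@[p] = 0 /\ forall q, dd F p q = 0 -> dd H p q = 0.

Lemma tang2_cancel U V W p : F.@[p] = 0 -> U.@[p] != 0 ->
  tang2 (U * V + F * W) p -> tang2 V p.
Proof.
move=> Fp Up [h1 h2].
have Vp : V.@[p] = 0.
  move: h1; rewrite mevalD !mevalM Fp mul0r addr0 => /eqP.
  by rewrite mulf_eq0 (negPf Up) => /eqP.
split=> // q hq; have := h2 q hq.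
rewrite ddD !ddM hq Vp Fp mulr0 add0r !mul0r !addr0 => /eqP.
by rewrite mulf_eq0 (negPf Up) => /eqP.
Qed.

(** The four zeros of F on the side are simple. *)
Lemma side_divide i j k d P : uniq [:: i; j; k] -> P \is d.-homog ->
    (forall v, v i = 0 -> (exists l, v l != 0) -> F.@[v] = 0 -> P.@[v] = 0) ->
  exists x y : {mpoly K[3]},
    [/\ x \is (d - 4).-homog, y \is (d.-1).-homog & P = F * x + 'X_i * y].
Proof.
move=> hu hP hz; have [[h1 h2 h3] [h4 h5 h6]] := neq3 hu.
have dv : ev (e_ j) (e_ k) F %| ev (e_ j) (e_ k) P.
  apply: separable_dvdp; first by apply: hsep; rewrite h3.
  move=> t /rootP; rewrite horner_ev => ht; apply/rootP; rewrite horner_ev.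
  apply: hz => //; first by rewrite /e_ h1 h2 mulr0 addr0.
  by exists j; rewrite /e_ eqxx h3 mulr0 addr0 oner_eq0.
by have [x [y [hx hy e _]]] := divide_line (@frame_coord K _ _ _ hu) hF (hvert k) hP dv;
  exists x, y.
Qed.

Lemma dd_dir p l c m : dd F p (fun i => e_ l i + c * e_ m i) =
  (F^`M(l)).@[p] + c * (F^`M(m)).@[p].
Proof.
rewrite /dd; under eq_bigr do rewrite mulrDl -mulrA.
rewrite big_split -mulr_sumr /=; congr (_ + _ * _).
  rewrite (bigD1 l) //= big1 => [|i /negPf hi]; first by rewrite /e_ eqxx mul1r addr0.
  by rewrite /e_ hi mul0r.
rewrite (bigD1 m) //= big1 => [|i /negPf hi]; first by rewrite /e_ eqxx mul1r addr0.
by rewrite /e_ hi mul0r.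
Qed.

Lemma ddX i p q : dd 'X_i p q = q i :> K.
Proof. by rewrite dd_linear ?mevalXU // dhomogXU. Qed.

(** The side is transverse to the curve, so the quotient of H by X_i still vanishes
   at the points of the side, and can be divided again. *)
Lemma side_divide2 i j k d H : uniq [:: i; j; k] -> H \is d.-homog ->
    (forall v, v i = 0 -> (exists l, v l != 0) -> F.@[v] = 0 -> tang2 H v) ->
  exists2 H2, H2 \is (d - 2).-homog & exists W, H = 'X_i ^+ 2 * H2 + F * W.
Proof.
move=> hu hH ht; have [[h1 h2 h3] [h4 h5 h6]] := neq3 hu.
have [|x [y [hx hy e]]] := side_divide hu hH.
  by move=> v vi v0 Fv; case: (ht v vi v0 Fv).
have [|x' [y' [hx' hy' e']]] := side_divide hu hy.
  move=> v vi v0 Fv; have [vj vk Fj] := side_point hu vi v0 Fv.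
  have [_ h] := ht v vi v0 Fv.
  pose q : 'I_3 -> K := fun l => e_ i l + (- (F^`M(i)).@[v] / (F^`M(j)).@[v]) * e_ j l.
  have hq : dd F v q = 0 by rewrite dd_dir divfK // addrN.
  have := h q hq; rewrite e ddD !ddM hq ddX Fv mevalXU vi !mul0r !add0r addr0.
  by rewrite /q /e_ eqxx h1 mulr0 addr0 mul1r.
exists y'; first by move: hy'; rewrite -subn1 -subn1 -subnDA.
by exists (x + 'X_i * x'); rewrite e e'; ring.
Qed.

(** The restriction of F to the line l = 0 has the double zeros p1 and p2 and no
   other; the parametrization u + X w is chosen to pass through the given
   representatives of these points. *)
Definition bitan (l : {mpoly K[3]}) (p1 p2 : 'I_3 -> K) : Prop :=
  exists u w r al be, [/\ frame u w r al be l, F.@[w] != 0 & exists t1 t2 c,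
    [/\ t1 != t2, c != 0, ev u w F = c *: (('X - t1%:P) ^+ 2 * ('X - t2%:P) ^+ 2),
        p1 =1 (fun i => u i + t1 * w i) & p2 =1 (fun i => u i + t2 * w i)]].

Lemma double_root (p : {poly K}) t : root p t -> root p^`() t -> ('X - t%:P) ^+ 2 %| p.
Proof.
move=> /factor_theorem [q ->]; rewrite derivM derivXsubC mulr1 rootE !hornerE subrr mulr0 add0r.
by move=> /factor_theorem [q' ->]; rewrite -mulrA dvdp_mull.
Qed.

Lemma bitan_divide l p1 p2 d H : bitan l p1 p2 -> H \is d.-homog ->
    tang2 H p1 -> tang2 H p2 ->
  exists2 H2, H2 \is (d - 1).-homog & exists W, H = l * H2 + F * W.
Proof.
move=> [u [w [r [al [be [fr hw [t1 [t2 [c [t12 c0 eF e1 e2]]]]]]]]]] hH ht1 ht2.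
have key t p : p =1 (fun i => u i + t * w i) -> tang2 H p ->
    ('X - t%:P) ^+ 2 %| ev u w F -> ('X - t%:P) ^+ 2 %| ev u w H.
  move=> ep [hp hq] /dvdpP[g eg].
  have dw : dd F p w = 0.
    have := deriv_ev u w F t; rewrite eg expr2 !derivM !derivXsubC.
    have := hornerXsubC t t; rewrite subrr; move: ('X - t%:P) => z hz.
    rewrite !(hornerD, hornerM) hz.
    rewrite ?(mulr0, mul0r, addr0) => h; rewrite /dd.
    by under eq_bigr do rewrite (meval_eq _ ep).
  apply: double_root; apply/rootP; first by rewrite horner_ev -(meval_eq _ ep).
  rewrite deriv_ev; have := hq w dw; rewrite /dd.
  by under eq_bigr do rewrite (meval_eq _ ep).
have d1 : ('X - t1%:P) ^+ 2 %| ev u w H by apply: (key _ _ e1) => //; rewrite eF dvdpZr // dvdp_mulr.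
have d2 : ('X - t2%:P) ^+ 2 %| ev u w H by apply: (key _ _ e2) => //; rewrite eF dvdpZr // dvdp_mull.
have dv : ev u w F %| ev u w H.
  rewrite eF dvdpZl // Gauss_dvdp ?d1 //.
  by rewrite coprimep_expl // coprimep_expr // coprimep_XsubC root_XsubC eq_sym.
have [x [y [hx hy e _]]] := divide_line fr hF hw hH dv.
by exists y; [rewrite subn1|exists x; rewrite e addrC].
Qed.

Definition xyz : {mpoly K[3]} := \prod_(i < 3) 'X_i.

Lemma xyz3 i j k : uniq [:: i; j; k] -> xyz = 'X_i * 'X_j * 'X_k.
Proof.
move=> hu; have [[h1 h2 h3] [h4 h5 h6]] := neq3 hu.
rewrite /xyz (bigD1 i) //= (bigD1 j) ?h4 //= (bigD1 k) ?h5 ?h6 //= big1 ?mulr1 ?mulrA //.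
by move=> l /andP[/andP[]]; case: (ord3P hu l) => ->; rewrite eqxx.
Qed.

Variables (l1 l2 : {mpoly K[3]}) (p1 p2 p3 p4 : 'I_3 -> K).
Hypotheses (hb1 : bitan l1 p1 p2) (hb2 : bitan l2 p3 p4).
Hypotheses (hF1 : F.@[p1] = 0) (hF2 : F.@[p2] = 0) (hF3 : F.@[p3] = 0) (hF4 : F.@[p4] = 0).
Hypotheses (hC1 : xyz.@[p1] != 0) (hC2 : xyz.@[p2] != 0)
  (hC3 : xyz.@[p3] != 0) (hC4 : xyz.@[p4] != 0).
Hypotheses (h13 : l1.@[p3] != 0) (h14 : l1.@[p4] != 0).

(** H vanishes on the curve at least as much as L C^2; the three sides and the two
   bitangents are taken off one at a time. *)
Lemma divide_neeman d H : H \is d.-homog ->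
    (forall v i, v i = 0 -> (exists l, v l != 0) -> F.@[v] = 0 -> tang2 H v) ->
    tang2 H p1 -> tang2 H p2 -> tang2 H p3 -> tang2 H p4 ->
  exists2 h, h \is (d - 8).-homog & exists W, H = l1 * l2 * xyz ^+ 2 * h + F * W.
Proof.
move=> hH hs t1 t2 t3 t4.
have [j [k hu]] := exists3 ord0; move: hu; set i : 'I_3 := ord0 => hu.
have hu2 := uniq3_perm1 hu; have hu3 := uniq3_perm1 hu2.
have [H1 hH1 [W1 e1]] := side_divide2 hu hH (fun v => hs v i).
have [|H2 hH2 [W2 e2]] := side_divide2 hu2 hH1.
  move=> v vj v0 Fv; have [vk vi _] := side_point hu2 vj v0 Fv.
  apply: (@tang2_cancel ('X_i ^+ 2) H1 W1) => //; last by rewrite -e1; apply: hs vj v0 Fv.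
  by rewrite rmorphXn /= mevalXU expf_neq0.
have [|H3 hH3 [W3 e3]] := side_divide2 hu3 hH2.
  move=> v vk v0 Fv; have [vi vj _] := side_point hu3 vk v0 Fv.
  apply: (@tang2_cancel ('X_j ^+ 2) H2 W2) => //.
    by rewrite rmorphXn /= mevalXU expf_neq0.
  rewrite -e2; apply: (@tang2_cancel ('X_i ^+ 2) H1 W1) => //.
    by rewrite rmorphXn /= mevalXU expf_neq0.
  by rewrite -e1; apply: hs vk v0 Fv.
pose W := 'X_i ^+ 2 * 'X_j ^+ 2 * W3 + 'X_i ^+ 2 * W2 + W1.
have e4 : H = xyz ^+ 2 * H3 + F * W by rewrite e1 e2 e3 (xyz3 hu) /W; ring.
have t p : F.@[p] = 0 -> xyz.@[p] != 0 -> tang2 H p -> tang2 H3 p.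
  move=> Fp Cp tH; apply: (@tang2_cancel (xyz ^+ 2) H3 W) => //.
    by rewrite rmorphXn /= expf_neq0.
  by rewrite -e4.
have [H4 hH4 [W4 e5]] := bitan_divide hb1 hH3 (t _ hF1 hC1 t1) (t _ hF2 hC2 t2).
have t' p : F.@[p] = 0 -> xyz.@[p] != 0 -> l1.@[p] != 0 -> tang2 H p -> tang2 H4 p.
  move=> Fp Cp lp tH; apply: (@tang2_cancel l1 H4 W4) => //.
  by rewrite -e5; exact: t.
have [h hh [W5 e6]] := bitan_divide hb2 hH4 (t' _ hF3 hC3 h13 t3) (t' _ hF4 hC4 h14 t4).
exists h; first by have -> : (d - 8 = d - 2 - 2 - 2 - 1 - 1)%N by clear; lia.
exists (xyz ^+ 2 * l1 * W5 + xyz ^+ 2 * W4 + W).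
by rewrite e4 e5 e6; ring.
Qed.

Lemma point_on_F : exists2 v, (exists l, v l != 0) & F.@[v] = 0.
Proof.
have [j [k hu]] := exists3 ord0; have [[h1 h2 h3] [h4 h5 h6]] := neq3 hu.
have /closed_rootP[t /rootP] : size (ev (e_ j) (e_ k) F) != 1%N.
  by rewrite (size_ev_eq _ hF (hvert k)).
rewrite horner_ev => ht; exists (fun i => e_ j i + t * e_ k i) => //.
by exists j; rewrite /e_ eqxx h3 mulr0 addr0 oner_eq0.
Qed.

(** A weak theorem of Bezout: a curve of positive degree meets the quartic, for
   otherwise 1 would be in the ideal of the two forms. *)
Lemma nonvanishing_const e h : h \is e.-homog ->
  (forall v, (exists l, v l != 0) -> F.@[v] = 0 -> h.@[v] != 0) -> e = 0%N.
Proof.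
move=> hh hv; have [j [k hu]] := exists3 ord0; have [[h1 h2 h3] [h4 h5 h6]] := neq3 hu.
apply/eqP; apply: contrapT => /negP e0; rewrite -lt0n in e0.
have cop : coprimep (ev (e_ j) (e_ k) F) (ev (e_ j) (e_ k) h).
  apply: Pdiv.ClosedField.root_coprimep => t /rootP; rewrite !horner_ev => /hv; apply.
  by exists j; rewrite /e_ eqxx h3 mulr0 addr0 oner_eq0.
have n1 : ~ ideal2 F h 1.
  move=> [x [y /(congr1 (meval (fun=> 0 * 0)))]].
  rewrite mevalD !mevalM (meval_homog _ _ hF) (meval_homog _ _ hh) !expr0n.
  by rewrite -(prednK e0) !mul0r !mulr0 addr0 meval1 => /eqP; rewrite oner_eq0.
have [|v [v0 v1 v2 _]] := common_zero (@frame_coord K _ _ _ hu) hF hh (hvert k) cop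
   (dhomog0 _ _ 0) (dhomog1 _ _) (XN0 K ord0) _ n1.
  by rewrite mul0r; apply: ideal2_0.
by have := hv v v0 v1; rewrite v2 eqxx.
Qed.

(** The factor that remains after the division of H by L C^2 has no zero on the
   curve, so it is a constant. *)
Lemma normal_form2 d (A : 'I_3 -> {mpoly K[3]}) :
    (forall l, A l \is d.+1.-homog) -> \sum_l 'X_l * A l = 0 ->
    (forall l m, exists T, A l * F^`M(m) - A m * F^`M(l) = F * T) ->
    (forall e H B, H \is e.-homog -> (forall l, A l = H * F^`M(l) + F * B l) ->
       forall v, (exists l, v l != 0) ->
       F.@[v] = 0 -> (l1 * l2 * xyz).@[v] = 0 -> tang2 H v) ->
    (forall h B, (forall l, A l = l1 * l2 * xyz ^+ 2 * h * F^`M(l) + F * B l) ->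
       forall v, (exists l, v l != 0) -> F.@[v] = 0 -> h.@[v] != 0) ->
  exists (c : K) B, [/\ c != 0, forall l, A l \is 11.-homog, forall l, B l \is 7.-homog
    & forall l, A l = c%:MP * (l1 * l2 * xyz ^+ 2) * F^`M(l) + F * B l].
Proof.
move=> hA hR hT htang hmult.
have [H [B [hH hB eA]]] := normal_form hF hsm hvert hsep hA hR hT.
have pN0 p : xyz.@[p] != 0 -> exists l, p l != 0.
  move=> hC; apply: contrapT => hn; case/eqP: hC.
  rewrite /xyz rmorph_prod (bigD1 ord0) //= mevalXU.
  have -> : p ord0 = 0 by apply: contrapT => /eqP hp; apply: hn; exists ord0.
  by rewrite mul0r.
have lz l p q : bitan l p q -> l.@[p] = 0 /\ l.@[q] = 0.
  move=> [u [w [r [al [be [fr _ [t1 [t2 [c [_ _ _ e1 e2]]]]]]]]]].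
  case: fr => _ _ _ _ [_ _ e0].
  by rewrite (meval_eq _ e1) (meval_eq _ e2) -!horner_ev e0 !horner0.
have [l1p1 l1p2] := lz _ _ _ hb1; have [l2p3 l2p4] := lz _ _ _ hb2.
have ht := htang _ H B hH eA.
have [||||| h hh [W eH]] := divide_neeman hH.
- move=> v i vi v0 Fv; apply: ht => //.
  by rewrite mevalM /xyz rmorph_prod (bigD1 i) //= mevalXU vi mul0r mulr0.
- by apply: ht => //; [apply: pN0|rewrite !mevalM l1p1 !mul0r].
- by apply: ht => //; [apply: pN0|rewrite !mevalM l1p2 !mul0r].
- by apply: ht => //; [apply: pN0|rewrite !mevalM l2p3 mulr0 mul0r].
- by apply: ht => //; [apply: pN0|rewrite !mevalM l2p4 mulr0 mul0r].
have eA2 l : A l = l1 * l2 * xyz ^+ 2 * h * F^`M(l) + F * (W * F^`M(l) + B l).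
  by rewrite eA eH; ring.
have hv := hmult _ _ eA2.
have e0 := nonvanishing_const hh hv.
have [v v0 Fv] := point_on_F; have hvv := hv v v0 Fv.
have eh : h = (h@_0)%:MP.
  apply/mpolyP => m; rewrite mcoeffC; have [->|m0] := eqVneq m 0%MM; first by rewrite mulr1.
  rewrite mulr0; apply: contrapT => /eqP /(homog_mdeg hh); rewrite e0 => /eqP.
  by rewrite mdeg_eq0 (negPf m0).
have c0 : h@_0 != 0 by apply: contraNneq hvv => c0; rewrite eh c0 mpolyC0 meval0.
have hC : xyz \is 3.-homog.
  rewrite (xyz3 (i := ord0) (j := inord 1) (k := inord 2)); last first.
    by rewrite /= !inE -!val_eqE /= !inordK.
  by apply: (dhomogM (d := 2)); [apply: (dhomogM (d := 1))|]; apply: dhomogXU.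
have [hl1 hl2] : l1 \is 1.-homog /\ l2 \is 1.-homog.
  by split; [case: hb1|case: hb2] => u [w [r [al [be [[]]]]]].
have hG : l1 * l2 * xyz ^+ 2 \is 8.-homog.
  by apply: (dhomogM (d := 2)); [apply: (dhomogM (d := 1))|apply: (dhomogMn 2 hC)].
have d10 : d = 10%N.
  apply/eqP; rewrite eqn_leq; apply/andP; split; first by move: e0; clear; lia.
  rewrite leqNgt; apply/negP => lt.
  (* In lower degree H is a multiple of F, and the multiplier may be taken to be 0. *)
  have hH0 : H = F * pihomog mdeg (d - 2 - 4) W \/ H = 0.
    have eH' := pihomog_dE hH; move: eH'; rewrite eH pihomogD.
    have -> : pihomog mdeg (d - 2) (l1 * l2 * xyz ^+ 2 * h) = 0.
      have h8 : (d - 2 < 8)%N by clear -lt; lia.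
      exact: (pihomogM0 _ hG h8).
    rewrite add0r (pihomog_mul _ _ hF) -eH => <-; case: ifP => _; [by left|by right; rewrite mulr0].
  have [G eG] : exists G, H = F * G.
    by case: hH0 => ->; [eexists; reflexivity|exists 0; rewrite mulr0].
  have eA3 l : A l = l1 * l2 * xyz ^+ 2 * 0 * F^`M(l) + F * (G * F^`M(l) + B l).
    by rewrite eA eG; ring.
  by have := hmult _ _ eA3 v v0 Fv; rewrite meval0 eqxx.
exists h@_0, (fun l => W * F^`M(l) + B l); rewrite d10 in hA hH hB eH.
split=> // l; last by rewrite eA2 {1}eh; ring.
have := hB l; have h11 := hA l.
have h4 : F * (W * F^`M(l) + B l) \is 11.-homog.
  have -> : F * (W * F^`M(l) + B l) = A l - (h@_0)%:MP * (l1 * l2 * xyz ^+ 2) * F^`M(l).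
    by rewrite eA2 {1}eh; ring.
  rewrite rpredB // mul_mpolyC -scalerAl dhomogZ //.
  exact: (dhomogM hG (quartic_deriv_homog hF l)).
move=> _; have := pihomog_dE h4; rewrite (pihomog_mul _ _ hF) /=.
by move/(mulfI (quartic_neq0 hvert)) => <-; apply: pihomogP.
Qed.

End Divide.

(** * Pencils of lines and division by the cubic *)

Section Coefs.
Variable R : nzRingType.
Implicit Types p q : {poly R}.
Lemma coefM_0 p q : (p * q)`_0 = p`_0 * q`_0.
Proof. by rewrite coefM big_ord1. Qed.
Lemma coefM_1 p q : (p * q)`_1 = p`_0 * q`_1 + p`_1 * q`_0.
Proof. by rewrite coefM !big_ord_recl big_ord0 addr0. Qed.
Lemma coefM_2 p q : (p * q)`_2 = p`_0 * q`_2 + p`_1 * q`_1 + p`_2 * q`_0.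
Proof. by rewrite coefM !big_ord_recl big_ord0 addr0 addrA. Qed.
End Coefs.

Section Beta.
Variable K : fieldType.
Implicit Types (P Q : {mpoly K[3]}) (p q : 'I_3 -> K).

(** Direction of slope t in the plane of q0 and q1. *)
Definition dir q0 q1 (i : 'I_3) : {poly K} := (q0 i)%:P + q1 i *: 'X.

(** Restriction to the pencil of lines p + x (q0 + t q1), in K[t][x]. This is the
   pull-back by the blow-up of p, in its coordinates (x, t). *)
Definition beta p q0 q1 : {mpoly K[3]} -> {poly {poly K}} :=
  lsub (@polyC K) (fun i => (p i)%:P) (dir q0 q1).
HB.instance Definition _ p q0 q1 := GRing.RMorphism.copy (beta p q0 q1)
  (lsub (@polyC K) (fun i => (p i)%:P) (dir q0 q1)).

Lemma mmap_polyC p P : mmap (@polyC K) (fun i => (p i)%:P) P = (P.@[p])%:P.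
Proof.
elim/mpoly_ring_ind: P => [c|i|x y hx hy|x y hx hy].
- by rewrite mmapC mevalC.
- by rewrite mmapX mmap1U mevalXU.
- by rewrite mmapD mevalD hx hy polyCD.
- by rewrite rmorphM /= hx hy mevalM polyCM.
Qed.

Lemma beta0 p q0 q1 P : (beta p q0 q1 P)`_0 = (P.@[p])%:P.
Proof.
rewrite -horner_coef0 horner_lsub -mmap_polyC.
by apply: mmap_ext => i; rewrite mul0r addr0.
Qed.

Lemma beta1 p q0 q1 P : (beta p q0 q1 P)`_1 = (dd P p q0)%:P + (dd P p q1) *: 'X.
Proof.
have -> : (beta p q0 q1 P)`_1 = ((beta p q0 q1 P)^`()).[0].
  by rewrite horner_coef0 coef_deriv mulr1n.
rewrite deriv_lsub horner_sum /dd rmorph_sum scaler_suml -big_split /=.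
apply: eq_bigr => i _; rewrite hornerZ horner_coef0 -/(beta p q0 q1 _) beta0 /dir.
by rewrite mulrDl -polyCM -scalerAl [X in _ *: X]mulrC mul_polyC scalerA.
Qed.

Lemma deriv_beta p q0 q1 P :
  (beta p q0 q1 P)^`() = \sum_l (dir q0 q1 l)%:P * beta p q0 q1 P^`M(l).
Proof. by rewrite deriv_lsub; apply: eq_bigr => l _; rewrite mul_polyC. Qed.

Lemma beta_t0 p q0 q1 P n : ((beta p q0 q1 P)`_n).[0] = (ev p q0 P)`_n.
Proof.
have e : map_poly (horner_eval 0) (beta p q0 q1 P) = ev p q0 P.
  rewrite [LHS]map_lsub; elim/mpoly_ring_ind: P => [c|i|x y hx hy|x y hx hy].
  - by rewrite lsubC [RHS]lsubC /= /horner_eval hornerC.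
  - by rewrite lsubX [RHS]lsubX /= /horner_eval /dir hornerC hornerD hornerZ hornerX hornerC mulr0 addr0.
  - by rewrite !rmorphD /= hx hy.
  - by rewrite !rmorphM /= hx hy.
by rewrite -e coef_map.
Qed.

End Beta.

Section Core.
Variable K : numClosedFieldType.
Implicit Types (P Q H : {mpoly K[3]}) (v p q : 'I_3 -> K).

Variable F : {mpoly K[3]}.
Hypothesis hF : F \is 4.-homog.
Hypothesis hvert : forall i, F.@[e_ i] != 0.
Hypothesis hsep : forall j k, j != k -> separable_poly (ev (e_ j) (e_ k) F).

Local Notation C := (xyz K).

(** A form of degree at most 3 with four zeros on a line vanishes on it. *)
Lemma ev_side_vanish i j k d P : uniq [:: i; j; k] -> P \is d.-homog -> (d < 4)%N ->
    (forall v, v i = 0 -> (exists l, v l != 0) -> F.@[v] = 0 -> P.@[v] = 0) ->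
  ev (e_ j) (e_ k) P = 0.
Proof.
move=> hu hP d4 hz; have [[h1 h2 h3] [h4 h5 h6]] := neq3 hu.
have dv : ev (e_ j) (e_ k) F %| ev (e_ j) (e_ k) P.
  apply: separable_dvdp; first by apply: hsep; rewrite h3.
  move=> t /rootP; rewrite horner_ev => ht; apply/rootP; rewrite horner_ev.
  apply: hz => //; first by rewrite /e_ h1 h2 mulr0 addr0.
  by exists j; rewrite /e_ eqxx h3 mulr0 addr0 oner_eq0.
apply/eqP; apply: contraT => h0; have := dvdp_leq h0 dv.
rewrite (size_ev_eq _ hF (hvert k)) ltnNge => h.
have := leq_trans (size_ev (e_ j) (e_ k) hP) d4.
by rewrite (negPf h).
Qed.

Lemma side_vanish i j k d P : uniq [:: i; j; k] -> P \is d.-homog -> (d < 4)%N ->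
    (forall v, v i = 0 -> (exists l, v l != 0) -> F.@[v] = 0 -> P.@[v] = 0) ->
  exists2 y, y \is (d.-1).-homog & P = 'X_i * y.
Proof.
move=> hu hP d4 hz.
exact: (vanish_line (@frame_coord K _ _ _ hu) hP (ev_side_vanish hu hP d4 hz)).
Qed.

Lemma xyz_divide d P : P \is d.-homog ->
    (forall i j k, uniq [:: i; j; k] -> ev (e_ j) (e_ k) P = 0) ->
  exists2 y, y \is (d - 3).-homog & P = C * y.
Proof.
move=> hP hz.
have [j [k hu]] := exists3 ord0; move: hu; set i : 'I_3 := ord0 => hu.
have hu2 := uniq3_perm1 hu; have hu3 := uniq3_perm1 hu2.
have [[h1 h2 h3] [h4 h5 h6]] := neq3 hu.
have evX a b c : uniq [:: a; b; c] -> ev (e_ b) (e_ c) ('X_b : {mpoly K[3]}) = 1 /\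
    ev (e_ b) (e_ c) ('X_c : {mpoly K[3]}) = 'X.
  by move=> /(@frame_coord K) [_ _ _ _ [-> -> _]].
have [y1 hy1 e1] := vanish_line (@frame_coord K _ _ _ hu) hP (hz _ _ _ hu).
have z2 : ev (e_ k) (e_ i) y1 = 0.
  have := hz _ _ _ hu2; rewrite e1 rmorphM /= (evX _ _ _ hu2).2 => /eqP.
  by rewrite mulf_eq0 polyX_eq0 => /eqP.
have [y2 hy2 e2] := vanish_line (@frame_coord K _ _ _ hu2) hy1 z2.
have z3 : ev (e_ i) (e_ j) y2 = 0.
  have := hz _ _ _ hu3; rewrite e1 e2 !rmorphM /= (evX _ _ _ hu3).2 (evX _ _ _ hu3).1 => /eqP.
  by rewrite mul1r mulf_eq0 polyX_eq0 => /eqP.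
have [y3 hy3 e3] := vanish_line (@frame_coord K _ _ _ hu3) hy2 z3.
exists y3; last by rewrite e1 e2 e3 (xyz3 _ hu) !mulrA.
by have -> : (d - 3 = d.-1.-1.-1)%N by rewrite -!subn1 -!subnDA.
Qed.

Lemma linear_eq0 P : P \is 1.-homog -> (forall m, P.@[e_ m] = 0) -> P = 0.
Proof.
move=> hP hz; rewrite (linear_form hP) big1 // => i _.
by rewrite linear_coef // -/(e_ i) hz scale0r.
Qed.

Lemma ev_linear_eq0 P j k : P \is 1.-homog -> P.@[e_ j] = 0 -> P.@[e_ k] = 0 ->
  ev (e_ j) (e_ k) P = 0.
Proof. by move=> hP hj hk; rewrite ev_linear // hj hk polyC0 scale0r addr0. Qed.

(** The sides are divided out in turn; at the points of a side the other two
   coordinates are not 0, so the quotient keeps its zeros there. *)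
Lemma divide_xyz7 P : P \is 7.-homog ->
    (forall v i, v i = 0 -> (exists l, v l != 0) -> F.@[v] = 0 -> P.@[v] = 0) ->
  exists M N : {mpoly K[3]}, [/\ M \is 4.-homog, N \is 3.-homog & P = C * M + F * N].
Proof.
move=> hP hz.
have [j [k hu]] := exists3 ord0; move: hu; set i : 'I_3 := ord0 => hu.
have hu2 := uniq3_perm1 hu; have hu3 := uniq3_perm1 hu2.
have [x1 [y1 [hx1 hy1 e1]]] := side_divide hF hvert hsep hu hP (fun v => hz v i).
have [|x2 [y2 [hx2 hy2 e2]]] := side_divide hF hvert hsep hu2 hy1.
  move=> v vj v0 Fv; have [vk vi _] := side_point hF hvert hsep hu2 vj v0 Fv.
  have := hz v j vj v0 Fv; rewrite e1 mevalD !mevalM Fv mul0r add0r mevalXU => /eqP.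
  by rewrite mulf_eq0 (negPf vi) => /eqP.
have [|x3 [y3 [hx3 hy3 e3]]] := side_divide hF hvert hsep hu3 hy2.
  move=> v vk v0 Fv; have [vi vj _] := side_point hF hvert hsep hu3 vk v0 Fv.
  have := hz v k vk v0 Fv; rewrite e1 e2 !(mevalD, mevalM) Fv !mul0r !add0r !mevalXU => /eqP.
  by rewrite !mulf_eq0 (negPf vi) (negPf vj) => /eqP.
exists y3, (x1 + 'X_i * x2 + 'X_i * 'X_j * x3); split=> //.
  have h1 := dhomogM (dhomogXU K i) hx2.
  have h2 := dhomogM (dhomogM (dhomogXU K i) (dhomogXU K j)) hx3.
  by rewrite !rpredD.
by rewrite e1 e2 e3 (xyz3 _ hu); ring.
Qed.

End Core.

(** * The remainder B at the points of the cubic *)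

Local Opaque lsub beta ev mmap.

Section Jets.
Variable R : comNzRingType.
Implicit Types (g l x D f b m n : {poly R}).

(** The coefficient of x in c L C^2 dF + F B, at a point where C and F vanish. *)
Lemma jet_side1 g l x D f b (f1 b0 : R) : x`_0 = 0 -> f`_0 = 0 -> f`_1 = f1 -> b`_0 = b0 ->
  (g * (l * (x * x)) * D + f * b)`_1 = 0 -> f1 * b0 = 0.
Proof.
move=> x0 f0 <- <-; rewrite coefD !coefM_1 !coefM_0 x0 f0.
by rewrite !(mulr0, mul0r, add0r, addr0).
Qed.

(** The coefficient of x^2 in the contraction of c L C^2 dF + F C M + F^2 N with a
   direction, at a point where C and F vanish. *)
Lemma jet_side2 g l x D f m n (g0 l0 x1 D0 f1 m0 n0 : R) : x`_0 = 0 -> f`_0 = 0 ->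
    g`_0 = g0 -> l`_0 = l0 -> x`_1 = x1 -> D`_0 = D0 -> f`_1 = f1 -> m`_0 = m0 -> n`_0 = n0 ->
    (g * l * (x * x) * D + f * x * m + f * f * n)`_2 = 0 ->
  g0 * l0 * (x1 * x1) * D0 + f1 * x1 * m0 + f1 * f1 * n0 = 0.
Proof.
move=> x0 f0 <- <- <- <- <- <- <-.
rewrite !coefD !coefM_2 !coefM_1 !coefM_0 x0 f0.
by rewrite !(mulr0, mul0r, add0r, addr0).
Qed.

Lemma sum_form3 (e D m n : 'I_3 -> R) (g l x f : R) :
  \sum_k e k * (g * (l * (x * x)) * D k + f * (x * m k + f * n k)) =
  g * l * (x * x) * (\sum_k e k * D k) + f * x * (\sum_k e k * m k)
   + f * f * (\sum_k e k * n k).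
Proof.
by rewrite !mulr_sumr -!big_split /=; apply: eq_bigr => k _; ring.
Qed.
End Jets.

Lemma beta1_tangent (K : fieldType) p q0 q1 (P : {mpoly K[3]}) :
  dd P p q0 = 0 -> (beta p q0 q1 P)`_1 = dd P p q1 *: 'X.
Proof. by move=> h; rewrite beta1 h polyC0 add0r. Qed.


Section Core.
Variable K : numClosedFieldType.
Implicit Types (P Q H : {mpoly K[3]}) (v p q : 'I_3 -> K).

Variable F : {mpoly K[3]}.
Hypothesis hF : F \is 4.-homog.
Hypothesis hvert : forall i, F.@[e_ i] != 0.
Hypothesis hsep : forall j k, j != k -> separable_poly (ev (e_ j) (e_ k) F).

Local Notation C := (xyz K).

(** Linear independence of p and q0. *)
Definition indep2 p q0 := exists i j, p i * q0 j - p j * q0 i != 0.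

Variables (A B : 'I_3 -> {mpoly K[3]}) (L : {mpoly K[3]}) (c : K).
Hypothesis eA : forall l, A l = c%:MP * (L * C ^+ 2) * F^`M(l) + F * B l.
Hypothesis hR : \sum_l 'X_l * A l = 0.
Hypothesis hloc : forall p q0 q1, (exists l, p l != 0) -> F.@[p] = 0 -> (L * C).@[p] = 0 ->
  dd F p q0 = 0 -> dd F p q1 != 0 -> indep2 p q0 ->
  (forall l, (beta p q0 q1 (A l))`_1 = 0) /\
  (\sum_l (dir q0 q1 l)%:P * beta p q0 q1 (A l))`_2 = 0.

Lemma C_side p i : p i = 0 -> C.@[p] = 0.
Proof. by move=> pi; rewrite /xyz rmorph_prod (bigD1 i) //= mevalXU pi mul0r. Qed.

Lemma dC_side i j k p : uniq [:: i; j; k] -> p i = 0 ->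
  [/\ (C^`M(i)).@[p] = p j * p k, (C^`M(j)).@[p] = 0 & (C^`M(k)).@[p] = 0].
Proof.
move=> hu pi; have [[h1 h2 h3] [h4 h5 h6]] := neq3 hu.
have dX a b : (('X_a : {mpoly K[3]})^`M(b)).@[p] = (a == b)%:R.
  have := ddX a p (@e_ K b); rewrite /dd (bigD1 b) //= big1 => [|l /negPf hl].
    by rewrite /e_ eqxx mul1r addr0.
  by rewrite /e_ hl mul0r.
rewrite (xyz3 _ hu) !mderivM !mevalD !mevalM !mevalD !mevalM !dX !mevalXU pi.
by rewrite !eqxx h1 h2 h3 h4 h5 h6 /= ?mulr1n ?mulr0n; split; ring.
Qed.

(** At a point of the side X_i = 0 the vector q0 is tangent to the curve and e_ j is
   transverse to it. *)
Lemma side_data i j k p : uniq [:: i; j; k] -> p i = 0 -> (exists l, p l != 0) -> F.@[p] = 0 ->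
  let q0 : 'I_3 -> K := fun l => e_ i l + (- (F^`M(i)).@[p] / (F^`M(j)).@[p]) * e_ j l in
  [/\ dd F p q0 = 0, dd F p (e_ j) = (F^`M(j)).@[p], (F^`M(j)).@[p] != 0,
      (forall l, (beta p q0 (e_ j) (A l))`_1 = 0)
    & (\sum_l (dir q0 (e_ j) l)%:P * beta p q0 (e_ j) (A l))`_2 = 0].
Proof.
move=> hu pi p0 Fp q0; have [[h1 h2 h3] [h4 h5 h6]] := neq3 hu.
have [pj pk Fj] := side_point hF hvert hsep hu pi p0 Fp.
have d0 : dd F p q0 = 0 by rewrite dd_dir divfK // addrN.
have d1 : dd F p (e_ j) = (F^`M(j)).@[p].
  have := dd_dir F p j 0 j; rewrite mul0r addr0 => <-.
  by apply: eq_bigr => l _; rewrite mul0r addr0.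
have [|||||| a1 a2] := @hloc p q0 (e_ j) => //.
- by rewrite mevalM (C_side pi) mulr0.
- by rewrite d1.
- by exists i, k; rewrite pi /q0 /e_ eqxx h1 h5 h6 mul0r sub0r mulr0 addr0 mulr1 oppr_eq0.
Qed.

(** C vanishes at p, so the coefficient of x in A is that of F B. *)
Lemma B_side p i : p i = 0 -> (exists l, p l != 0) -> F.@[p] = 0 -> forall l, (B l).@[p] = 0.
Proof.
move=> pi p0 Fp l; have [j [k hu]] := exists3 i.
have [d0 d1 Fj ha _] := side_data hu pi p0 Fp.
set b := beta _ _ _ in ha.
have bC0 : (b C)`_0 = 0 by rewrite beta0 (C_side pi) polyC0.
have bF0 : (b F)`_0 = 0 by rewrite beta0 Fp polyC0.
have bF1 : (b F)`_1 = (F^`M(j)).@[p] *: 'X by rewrite (beta1_tangent _ d0) d1.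
have bB0 : (b (B l))`_0 = ((B l).@[p])%:P by rewrite beta0.
have ebA : b (A l) = b c%:MP * (b L * (b C * b C)) * b F^`M(l) + b F * b (B l).
  by rewrite eA expr2 /b !(rmorphD, rmorphM).
have := jet_side1 bC0 bF0 bF1 bB0 (etrans (esym (congr1 (fun x : {poly {poly K}} => x`_1) ebA)) (ha l)).
rewrite mulrC mul_polyC scalerA => /eqP; rewrite scaler_eq0 polyX_eq0 orbF mulf_eq0 (negPf Fj) orbF.
by move/eqP.
Qed.

Variables (M N : 'I_3 -> {mpoly K[3]}).
Hypothesis hN : forall l, N l \is 3.-homog.
Hypothesis eB : forall l, B l = C * M l + F * N l.

Lemma xyz_homog : C \is 3.-homog.
Proof.
have [j [k hu]] := exists3 ord0.
by rewrite (xyz3 _ hu); apply: (dhomogM (d := 2)); [apply: (dhomogM (d := 1))|]; apply: dhomogXU.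
Qed.

(** The contraction of A = c L C^2 dF + F C M + F^2 N with the radial field, divided
   by F. *)
Lemma radial : C * (4%:R * (c%:MP * L * C) + \sum_l 'X_l * M l) + F * (\sum_l 'X_l * N l) = 0.
Proof.
apply: (mulfI (quartic_neq0 hvert)); rewrite mulr0 -[RHS]hR.
under [RHS]eq_bigr => l _.
  have -> : 'X_l * A l = (c%:MP * (L * C ^+ 2)) * ('X_l * F^`M(l)) + F * C * ('X_l * M l)
     + F ^+ 2 * ('X_l * N l) by rewrite eA eB; ring.
  over.
by rewrite !big_split /= -!mulr_sumr (euler hF) -mulr_natl; ring.
Qed.

Lemma ev_C i j k : uniq [:: i; j; k] -> ev (e_ j) (e_ k) C = 0.
Proof.
move=> hu; rewrite (xyz3 _ hu) !rmorphM /=.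
by have [_ _ _ _ [_ _ ->]] := @frame_coord K _ _ _ hu; rewrite !mul0r.
Qed.

Lemma ev_F i j k : uniq [:: i; j; k] -> ev (e_ j) (e_ k) F != 0.
Proof. by move=> hu; rewrite -size_poly_gt0 (size_ev_eq _ hF (hvert k)). Qed.

Lemma radial_homog : \sum_l 'X_l * N l \is 4.-homog.
Proof. by apply: rpred_sum => l _; apply: (dhomogM (dhomogXU K l) (hN l)). Qed.

Lemma XN_side i j k : uniq [:: i; j; k] -> ev (e_ j) (e_ k) (\sum_l 'X_l * N l) = 0.
Proof.
move=> hu; apply/eqP; have /eqP := congr1 (ev (e_ j) (e_ k)) radial.
by rewrite rmorphD !rmorphM /= (ev_C hu) mul0r add0r rmorph0 mulf_eq0 (negPf (ev_F hu)).
Qed.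

(** By the radial relation X.N is divisible by C; after division by C, the form X.M
   is in the ideal (C, F). *)
Lemma radial_point p i : p i = 0 -> F.@[p] = 0 ->
  \sum_l p l * (M l).@[p] = 0 /\ \sum_l p l * (N l).@[p] = 0.
Proof.
move=> pi Fp; have [k hk ek] := xyz_divide radial_homog XN_side.
have e : 4%:R * (c%:MP * L * C) + \sum_l 'X_l * M l = - F * k.
  have C0 : C != 0.
    have [j [l hu]] := exists3 ord0.
    by rewrite (xyz3 _ hu) !mulf_neq0 // XN0.
  have h := radial; rewrite ek in h.
  apply: (mulfI C0); apply/eqP; rewrite -subr_eq0; apply/eqP; rewrite -[RHS]h.
  by move: (\sum_l _) => z; ring.
have ev_sum (f : 'I_3 -> {mpoly K[3]}) :
    (\sum_l 'X_l * f l).@[p] = \sum_l p l * (f l).@[p].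
  by rewrite raddf_sum; apply: eq_bigr => l _; rewrite /= mevalM mevalXU.
split; rewrite -ev_sum; last by rewrite ek mevalM (C_side pi) mul0r.
have := congr1 (meval p) e; rewrite mevalD !mevalM mevalN Fp (C_side pi).
by rewrite !mulr0 add0r oppr0 mul0r.
Qed.

(** The coefficient of x^2 in the contraction of A with the direction of slope t is
   F_j(p) t times a polynomial of degree 2 in t. Its three coefficients give N_j(p),
   M_j(p) and M_i(p); the values N_k(p) and M_k(p) follow from the radial relations. *)
Lemma side_relations i j k p : uniq [:: i; j; k] -> p i = 0 -> (exists l, p l != 0) -> F.@[p] = 0 ->
  let g := p j * p k in
  [/\ (N j).@[p] = 0, (N k).@[p] = 0,
      g * (M j).@[p] = - (F^`M(j)).@[p] * (N i).@[p],
      g * (M k).@[p] = - (F^`M(k)).@[p] * (N i).@[p] &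
      g * (M i).@[p] = - (F^`M(i)).@[p] * (N i).@[p] - c * L.@[p] * g ^+ 2].
Proof.
move=> hu pi p0 Fp g; have [[h1 h2 h3] [h4 h5 h6]] := neq3 hu.
have [pj pk Fj] := side_point hF hvert hsep hu pi p0 Fp.
have [d0 d1 _ _ ha] := side_data hu pi p0 Fp.
set r := - _ / _ in d0 ha; set q0 := (fun l => _) in d0 ha.
have [MR NR] := radial_point pi Fp.
have FR := dd_self p hF; rewrite Fp mul0rn /dd in FR.
rewrite !(sum3 hu) pi !mul0r !add0r in MR NR FR.
have g0 : g != 0 by rewrite mulf_neq0.
have [dCi dCj dCk] := dC_side hu pi.
have dCq0 : dd C p q0 = g.
  have -> : dd C p q0 = (C^`M(i)).@[p] + r * (C^`M(j)).@[p] by rewrite -dd_dir.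
  by rewrite dCi dCj mulr0 addr0.
have dCq1 : dd C p (e_ j) = 0.
  have := dd_dir C p j 0 j; rewrite mul0r addr0 dCj => <-.
  by apply: eq_bigr => l _; rewrite mul0r addr0.
pose b := beta p q0 (e_ j).
have eqA : \sum_l (dir q0 (e_ j) l)%:P * b (A l) =
   b c%:MP * b L * (b C * b C) * (b F)^`() + b F * b C * (\sum_l (dir q0 (e_ j) l)%:P * b (M l))
   + b F * b F * (\sum_l (dir q0 (e_ j) l)%:P * b (N l)).
  have -> : (b F)^`() = \sum_l (dir q0 (e_ j) l)%:P * b F^`M(l) := deriv_beta _ _ _ _.
  rewrite -(sum_form3 (fun l => (dir q0 (e_ j) l)%:P) (fun l => b F^`M(l))
    (fun l => b (M l)) (fun l => b (N l)) (b c%:MP) (b L) (b C) (b F)).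
  apply: eq_bigr => l _; congr (_ * _).
  by rewrite eA eB expr2 /b !(rmorphD, rmorphM).
have bC0 : (b C)`_0 = 0 by rewrite beta0 (C_side pi) polyC0.
have bF0 : (b F)`_0 = 0 by rewrite beta0 Fp polyC0.
have bC1 : (b C)`_1 = g%:P by rewrite beta1 dCq0 dCq1 scale0r addr0.
have bF1 : (b F)`_1 = (F^`M(j)).@[p] *: 'X by rewrite (beta1_tangent _ d0) d1.
have bD0 : ((b F)^`())`_0 = (F^`M(j)).@[p] *: 'X by rewrite coef_deriv mulr1n bF1.
have bS (f : 'I_3 -> {mpoly K[3]}) : (\sum_l (dir q0 (e_ j) l)%:P * b (f l))`_0 =
    ((f i).@[p] + r * (f j).@[p])%:P + (f j).@[p] *: 'X.
  rewrite coef_sum.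
  transitivity (\sum_l dir q0 (e_ j) l * ((f l).@[p])%:P).
    by apply: eq_bigr => l _; rewrite coefCM beta0.
  have di : dir q0 (e_ j) i = 1.
    by rewrite /dir /q0 /e_ eqxx h1 mulr0 addr0 scale0r addr0.
  have dj : dir q0 (e_ j) j = r%:P + 'X.
    by rewrite /dir /q0 /e_ eqxx h4 mulr1 add0r scale1r.
  have dk : dir q0 (e_ j) k = 0.
    by rewrite /dir /q0 /e_ h5 h6 mulr0 addr0 scale0r addr0.
  rewrite (sum3 hu) di dj dk polyCD (polyCM r) -mul_polyC; ring.
have bc0 : (b c%:MP)`_0 = c%:P by rewrite beta0 mevalC.
have bL0 : (b L)`_0 = (L.@[p])%:P by rewrite beta0.
have e := jet_side2 bC0 bF0 bc0 bL0 bC1 bD0 bF1 (bS M) (bS N)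
  (etrans (esym (congr1 (fun x : {poly {poly K}} => x`_2) eqA)) ha).
(* Both sides are divisible by the nonzero polynomial F_j(p) t. *)
have {}e : (c%:P * (L.@[p])%:P * (g%:P * g%:P) + g%:P * (((M i).@[p] + r * (M j).@[p])%:P + (M j).@[p] *: 'X)
   + (F^`M(j)).@[p] *: 'X * (((N i).@[p] + r * (N j).@[p])%:P + (N j).@[p] *: 'X)) = 0 :> {poly K}.
  have X0 : (F^`M(j)).@[p] *: 'X != 0 :> {poly K} by rewrite scaler_eq0 polyX_eq0 orbF.
  by apply: (mulfI X0); rewrite mulr0 -[RHS]e; ring.
have e0 : c * L.@[p] * g ^+ 2 + g * ((M i).@[p] + r * (M j).@[p]) = 0.
  have := congr1 (horner_eval 0) e.
  rewrite /horner_eval !(hornerD, hornerM, hornerC, hornerZ, hornerX, horner0) => h.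
  by rewrite -[RHS]h; ring.
have e1 : g * (M j).@[p] + (F^`M(j)).@[p] * ((N i).@[p] + r * (N j).@[p]) = 0.
  have := congr1 (fun x : {poly K} => x`_1) e.
  by rewrite !(coefD, coefM_1, coefC, coefZ, coefX, coef0) /= !(mulr0, mul0r, mulr1, add0r, addr0).
have e2 : (F^`M(j)).@[p] * (N j).@[p] = 0.
  have := congr1 (fun x : {poly K} => x`_2) e.
  rewrite !(coefD, coefM_2, coefM_1, coefM_0, coefC, coefZ, coefX, coef0) /= => h.
  by rewrite -[RHS]h; ring.
have Nj : (N j).@[p] = 0 by move/eqP: e2; rewrite mulf_eq0 (negPf Fj) => /eqP.
have Nk : (N k).@[p] = 0.
  by move/eqP: NR; rewrite Nj mulr0 add0r mulf_eq0 (negPf pk) => /eqP.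
have Mj : g * (M j).@[p] = - (F^`M(j)).@[p] * (N i).@[p].
  by move/eqP: e1; rewrite Nj mulr0 addr0 addr_eq0 mulNr => /eqP.
split=> //.
- apply: (mulfI pk).
  have -> : p k * (g * (M k).@[p]) = g * (p j * (M j).@[p] + p k * (M k).@[p]) - p j * (g * (M j).@[p]) by ring.
  have -> : p k * (- (F^`M(k)).@[p] * (N i).@[p]) =
      - (N i).@[p] * (p j * (F^`M(j)).@[p] + p k * (F^`M(k)).@[p]) + (N i).@[p] * (p j * (F^`M(j)).@[p]) by ring.
  by rewrite MR FR Mj; ring.
- have -> : g * (M i).@[p] = (c * L.@[p] * g ^+ 2 + g * ((M i).@[p] + r * (M j).@[p])) - r * (g * (M j).@[p])
    - c * L.@[p] * g ^+ 2 by ring.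
  by rewrite e0 Mj /r; field.
Qed.

End Core.

(** * Gluing along the triangle *)

Section Global.
Variable K : numClosedFieldType.
Implicit Types (P Q H : {mpoly K[3]}) (v p q : 'I_3 -> K).

Variable F : {mpoly K[3]}.
Hypothesis hF : F \is 4.-homog.
Hypothesis hvert : forall i, F.@[e_ i] != 0.
Hypothesis hsep : forall j k, j != k -> separable_poly (ev (e_ j) (e_ k) F).
Hypothesis hind : forall c : 'I_3 -> K,
  (forall l, \sum_m c m * (F^`M(l)).@[e_ m] = 0) -> forall m, c m = 0.

Local Notation C := (xyz K).

Variables (M N : 'I_3 -> {mpoly K[3]}) (L : {mpoly K[3]}) (c : K).
Hypothesis hL : L \is 2.-homog.
Hypothesis hM : forall l, M l \is 4.-homog.
Hypothesis hN : forall l, N l \is 3.-homog.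
Hypothesis hrad : C * (4%:R * (c%:MP * L * C) + \sum_l 'X_l * M l) + F * (\sum_l 'X_l * N l) = 0.
Hypothesis hrel : forall i j k p, uniq [:: i; j; k] -> p i = 0 -> (exists l, p l != 0) ->
  F.@[p] = 0 ->
  let g := p j * p k in
  [/\ (N j).@[p] = 0, (N k).@[p] = 0,
      g * (M j).@[p] = - (F^`M(j)).@[p] * (N i).@[p],
      g * (M k).@[p] = - (F^`M(k)).@[p] * (N i).@[p] &
      g * (M i).@[p] = - (F^`M(i)).@[p] * (N i).@[p] - c * L.@[p] * g ^+ 2].

(** N_i is a cubic that vanishes at the four points of each of the sides X_j = 0 and
   X_k = 0. *)
Lemma N_log i j k : uniq [:: i; j; k] ->
  exists2 l, l \is 1.-homog & N i = 'X_j * 'X_k * l.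
Proof.
move=> hu; have hu2 := uniq3_perm1 hu; have hu3 := uniq3_perm1 hu2.
have [|y hy e] := side_vanish hF hvert hsep hu2 (hN i) isT.
  by move=> v vj v0 Fv; case: (hrel hu2 vj v0 Fv).
have [|l hl e'] := side_vanish hF hvert hsep hu3 hy isT.
  move=> v vk v0 Fv; have [h _ _ _ _] := hrel hu3 vk v0 Fv.
  have [vi vj _] := side_point hF hvert hsep hu3 vk v0 Fv.
  by move/eqP: h; rewrite e mevalM mevalXU mulf_eq0 (negPf vj) => /eqP.
by exists l => //; rewrite e e' mulrA.
Qed.

Lemma xyz_deriv_homog l : C^`M(l) \is 2.-homog.
Proof. exact: (dhomog_deriv l (xyz_homog K)). Qed.

(** The relations at the four points of the side X_i = 0 give M modulo F and X_i. *)
Lemma M_side i : exists l (v : 'I_3 -> K),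
  [/\ l \is 1.-homog, forall j k, uniq [:: i; j; k] -> N i = 'X_j * 'X_k * l
   & forall s, exists y, M s + l * F^`M(s) + c%:MP * L * C^`M(s) = F * (v s)%:MP + 'X_i * y].
Proof.
have [j [k hu]] := exists3 i.
have [l hl eN] := N_log hu; exists l.
have hT s : M s + l * F^`M(s) + c%:MP * L * C^`M(s) \is 4.-homog.
  have h1 : l * F^`M(s) \is 4.-homog by apply: (dhomogM hl (quartic_deriv_homog hF s)).
  have h2 : c%:MP * L * C^`M(s) \is 4.-homog.
    by rewrite mul_mpolyC -scalerAl dhomogZ //; apply: (dhomogM hL (xyz_deriv_homog s)).
  by rewrite !rpredD.
have hz s p : p i = 0 -> (exists l, p l != 0) -> F.@[p] = 0 ->
    (M s + l * F^`M(s) + c%:MP * L * C^`M(s)).@[p] = 0.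
  move=> pi p0 Fp.
  have [pj pk _] := side_point hF hvert hsep hu pi p0 Fp.
  have [_ _ r1 r2 r3] := hrel hu pi p0 Fp.
  have [c1 c2 c3] := dC_side hu pi.
  have g0 : p j * p k != 0 by rewrite mulf_neq0.
  have eNp : (N i).@[p] = p j * p k * l.@[p] by rewrite eN !mevalM !mevalXU.
  rewrite !mevalD !mevalM mevalC; apply: (mulfI g0); rewrite mulr0 !mulrDr.
  by case: (ord3P hu s) => ->; rewrite ?c1 ?c2 ?c3 ?r1 ?r2 ?r3 eNp; ring.
have : forall s, exists w : K, exists y, M s + l * F^`M(s) + c%:MP * L * C^`M(s) = F * w%:MP + 'X_i * y.
  move=> s; have [x [y [hx _ e]]] := side_divide hF hvert hsep hu (hT s) (fun p => @hz s p).
  exists x@_0, y; rewrite e; congr (F * _ + _).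
  apply/mpolyP => m; rewrite mcoeffC; have [->|m0] := eqVneq m 0%MM; first by rewrite mulr1.
  rewrite mulr0; apply/eqP; apply: contraT => /(homog_mdeg hx)/eqP.
  by rewrite mdeg_eq0 (negPf m0).
move=> /fin_all_exists[v hv]; exists v; split=> // j' k' hu'.
have [[h1 h2 h3] [h4 h5 h6]] := neq3 hu'; have [[g1 g2 g3] [g4 g5 g6]] := neq3 hu.
move: g1 g2 g3; rewrite eN.
case: (ord3P hu' j) => ->; case: (ord3P hu' k) => ->; rewrite ?eqxx // => _ _ _.
by rewrite ['X_k' * _]mulrC.
Qed.

(** The descriptions of M along the sides agree at the vertices. The differences of
   the vectors v of two sides are therefore multiples of the gradient of F at their
   common vertex; as the gradients are independent, they vanish. Then v and l are
   common to the three sides, and the error is divisible by C. *)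
Lemma global_form : exists (al v : 'I_3 -> K) (m : 'I_3 -> {mpoly K[3]}),
  let l := \sum_s al s *: 'X_s in
  [/\ forall s, m s \is 1.-homog,
      forall s, M s = - (l * F^`M(s)) - c%:MP * L * C^`M(s) + F * (v s)%:MP + C * m s
    & \sum_s 'X_s * m s = - (c%:MP * L)].
Proof.
have /fin_all_exists[ll /fin_all_exists[vv hlv]] := M_side.
have hl i : ll i \is 1.-homog by case: (hlv i).
have hv i s : exists y, M s + ll i * F^`M(s) + c%:MP * L * C^`M(s) = F * (vv i s)%:MP + 'X_i * y.
  by case: (hlv i).
have hNl i j k : uniq [:: i; j; k] -> N i = 'X_j * 'X_k * ll i by case: (hlv i) => _ h _; apply: h.
have hvtx i m s : i != m ->
    (M s).@[e_ m] = F.@[e_ m] * vv i s - (ll i).@[e_ m] * (F^`M(s)).@[e_ m].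
  move=> im; have [y /(congr1 (meval (e_ m)))] := hv i s.
  have emi : e_ m i = 0 :> K by rewrite /e_ (negPf im).
  have -> : (F * (vv i s)%:MP + 'X_i * y).@[e_ m] = F.@[e_ m] * vv i s.
    by rewrite mevalD !mevalM mevalC mevalXU emi mul0r addr0.
  move=> <-; rewrite !mevalD !mevalM mevalC.
  suff -> : (C^`M(s)).@[e_ m] = 0 by ring.
  have [j [k hu]] := exists3 i; have [d1 d2 d3] := dC_side hu emi.
  case: (ord3P hu s) => ->; rewrite ?d1 ?d2 ?d3 //.
  have [[h1 h2 h3] [h4 h5 h6]] := neq3 hu.
  by case: (ord3P hu m) im => ->; rewrite ?eqxx // /e_ ?h3 ?h6 ?mulr0 ?mul0r.
have [j [k hu]] := exists3 ord0; move: hu; set i : 'I_3 := ord0 => hu.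
have [[h1 h2 h3] [h4 h5 h6]] := neq3 hu.
(* The linear forms of the sides a and b are compared at their common vertex m. *)
pose ka (a b m : 'I_3) : K := ((ll a).@[e_ m] - (ll b).@[e_ m]) / F.@[e_ m].
have hka a b m s : a != m -> b != m ->
    vv a s - vv b s = ka a b m * (F^`M(s)).@[e_ m].
  move=> am bm; apply: (mulfI (hvert m)).
  have := hvtx b m s bm; rewrite (hvtx a m s am) => e.
  rewrite /ka mulrBr; apply/eqP; rewrite -subr_eq0; apply/eqP.
  have -> : F.@[e_ m] * (((ll a).@[e_ m] - (ll b).@[e_ m]) / F.@[e_ m] * (F^`M(s)).@[e_ m]) =
      ((ll a).@[e_ m] - (ll b).@[e_ m]) * (F^`M(s)).@[e_ m] by field; apply: hvert.
  by move/eqP: e; rewrite -subr_eq0 => /eqP <-; ring.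
(* The cyclic sum of the differences of the vectors vv is zero, and is a linear
   combination of the gradients at the three vertices. *)
have ka0 := hind (c := fun m => if m == k then ka i j k else if m == i then ka j k i else ka k i j).
have {}ka0 : [/\ ka i j k = 0, ka j k i = 0 & ka k i j = 0].
  have h s : \sum_m (if m == k then ka i j k else if m == i then ka j k i else ka k i j)
      * (F^`M(s)).@[e_ m] = 0.
    rewrite (sum3 hu) !eqxx h2 h3 h4.
    rewrite -(hka i j k s) ?h2 ?h3 // -(hka j k i s) ?h4 ?h5 // -(hka k i j s) ?h6 ?h1 //.
    by ring.
  by have := ka0 h; move=> z; have := z i; have := z j; have := z k; rewrite !eqxx h2 h3 h4.
case: ka0 => ka1 ka2 ka3.
have vij s : vv i s = vv j s by apply/eqP; rewrite -subr_eq0 (hka i j k s) ?h2 ?h3 // ka1 mul0r.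
have vik s : vv i s = vv k s.
  by apply/esym/eqP; rewrite -subr_eq0 (hka k i j s) ?h1 ?h6 // ka3 mul0r.
have kaE a b m : ka a b m = 0 -> (ll a).@[e_ m] = (ll b).@[e_ m].
  move=> /eqP; rewrite /ka mulf_eq0 invr_eq0 (negPf (hvert m)) orbF subr_eq0.
  by move/eqP.
have l1 := kaE _ _ _ ka1; have l2 := kaE _ _ _ ka2; have l3 := kaE _ _ _ ka3.
pose al m := if m == i then (ll j).@[e_ i] else if m == j then (ll k).@[e_ j] else (ll i).@[e_ k].
pose l : {mpoly K[3]} := \sum_s al s *: 'X_s.
have hl1 : l \is 1.-homog by apply: rpred_sum => s _; rewrite dhomogZ // dhomogXU.
have le m : l.@[e_ m] = al m.
  rewrite /l raddf_sum (bigD1 m) //= big1 => [|s /negPf sm].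
    by rewrite mevalZ mevalXU /e_ eqxx mulr1 addr0.
  by rewrite mevalZ mevalXU /e_ sm mulr0.
have alE a m : a != m -> (ll a).@[e_ m] = al m.
  rewrite /al; case: (ord3P hu m) => ->; case: (ord3P hu a) => ->;
    rewrite ?eqxx ?h1 ?h2 ?h3 ?h4 ?h5 ?h6 //.
pose D s := M s + l * F^`M(s) + c%:MP * L * C^`M(s) - F * (vv i s)%:MP.
have hD s : D s \is 4.-homog.
  have d1 : l * F^`M(s) \is 4.-homog by apply: (dhomogM hl1 (quartic_deriv_homog hF s)).
  have d2 : c%:MP * L * C^`M(s) \is 4.-homog.
    by rewrite mul_mpolyC -scalerAl dhomogZ //; apply: (dhomogM hL (xyz_deriv_homog s)).
  have d3 : F * (vv i s)%:MP \is 4.-homog by rewrite mulrC mul_mpolyC dhomogZ.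
  exact: (rpredB (rpredD (rpredD (hM s) d1) d2) d3).
have Dz s a b d : uniq [:: a; b; d] -> ev (e_ b) (e_ d) (D s) = 0.
  move=> hu'; have [[g1 g2 g3] [g4 g5 g6]] := neq3 hu'.
  have [y ey] := hv a s.
  have -> : D s = (l - ll a) * F^`M(s) + 'X_a * y.
    have ev : vv i s = vv a s by case: (ord3P hu a) => ->.
    have -> : 'X_a * y = (F * (vv a s)%:MP + 'X_a * y) - F * (vv a s)%:MP by ring.
    by rewrite -ey /D ev; ring.
  have [_ _ _ _ [_ _ eX]] := @frame_coord K _ _ _ hu'.
  rewrite rmorphD !rmorphM /= eX mul0r addr0.
  have -> : ev (e_ b) (e_ d) (l - ll a) = 0.
    apply: ev_linear_eq0; first exact: (rpredB hl1 (hl a)).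
      by rewrite mevalB le alE ?subrr ?g1.
    by rewrite mevalB le alE ?subrr ?g2.
  by rewrite mul0r.
have /fin_all_exists2[m hm em] s := xyz_divide (hD s) (@Dz s).
exists al, (vv i), m => /=; rewrite -/l.
have eM s : M s = - (l * F^`M(s)) - c%:MP * L * C^`M(s) + F * (vv i s)%:MP + C * m s.
  by rewrite -em /D; ring.
split=> //.
pose lam : {mpoly K[3]} := \sum_s ll s + \sum_s 'X_s * (vv i s)%:MP - 4%:R * l.
have eNR : \sum_s 'X_s * N s = C * \sum_s ll s.
  rewrite mulr_sumr; apply: eq_bigr => s _; have [a [b hs]] := exists3 s.
  by rewrite (hNl _ _ _ hs) (xyz3 _ hs) !mulrA.
have eMR : \sum_s 'X_s * M s = - l * (F *+ 4) - (c%:MP * L) * (C *+ 3)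
    + F * (\sum_s 'X_s * (vv i s)%:MP) + C * (\sum_s 'X_s * m s).
  rewrite -(euler hF) -(euler (xyz_homog K)) !mulr_sumr -sumrB -!big_split /=.
  by apply: eq_bigr => s _; rewrite eM; ring.
have C0 : C != 0 by rewrite (xyz3 _ hu) !mulf_neq0 // XN0.
have key : C * (c%:MP * L + \sum_s 'X_s * m s) + F * lam = 0.
  apply: (mulfI C0); rewrite mulr0 -[RHS]hrad eMR eNR /lam.
  move: (\sum_s ll s) (\sum_s _ * _%:MP) (\sum_s _ * m s) => x y z.
  by rewrite -[F *+ 4]mulr_natl -[C *+ 3]mulr_natl; ring.
have hlam : lam \is 1.-homog.
  have d1 : \sum_s ll s \is 1.-homog by apply: rpred_sum.
  have d2 : \sum_s 'X_s * (vv i s)%:MP \is 1.-homog.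
    by apply: rpred_sum => s _; rewrite mulrC mul_mpolyC dhomogZ // dhomogXU.
  have d3 : 4%:R * l \is 1.-homog by rewrite mulr_natl rpredMn.
  exact: (rpredB (rpredD d1 d2) d3).
(* lam vanishes on the three sides, where C does and F does not. *)
have lam0 : lam = 0.
  apply: linear_eq0 => // d; have [a [b hs]] := exists3 d.
  have hs2 := uniq3_perm1 (uniq3_perm1 hs).
  have eC : ev (e_ d) (e_ a) C = 0 by apply: ev_C hs2.
  have z : ev (e_ d) (e_ a) lam = 0.
    apply/eqP; have /eqP := congr1 (ev (e_ d) (e_ a)) key.
    rewrite rmorphD !rmorphM /= eC mul0r add0r rmorph0 mulf_eq0.
    by rewrite (negPf (ev_F hF hvert hs2)).
  by rewrite -(ev_at0 (e_ d) (e_ a)) z horner0.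
move: key; rewrite lam0 mulr0 addr0 => /eqP; rewrite mulf_eq0 (negPf C0) /= addrC.
by rewrite addr_eq0 => /eqP.
Qed.

End Global.

(** * The relation at a point of tangency *)

Section TangentJets.
Variable R : comNzRingType.
Implicit Types (g l x f d m n k w : {poly R}).

(** The coefficient of x in c L C^2 dF - F C (l dF + c L dC) + F C^2 m + F^2 n, at a
   point where F and L vanish. *)
Lemma jet_tangent1 g w x f d k l m n : f`_0 = 0 -> w`_0 = 0 ->
  (g * w * (x * x) * d - f * x * (l * d + g * w * k) + f * (x * x) * m + f * f * n)`_1 =
  g`_0 * w`_1 * (x`_0 * x`_0) * d`_0 - f`_1 * x`_0 * (l`_0 * d`_0) + f`_1 * (x`_0 * x`_0) * m`_0.
Proof.
move=> f0 w0; rewrite !(coefD, coefN, coefM_1, coefM_0) f0 w0.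
by rewrite !(mulr0, mul0r, add0r, addr0).
Qed.

Lemma jet_tangent2 g w x f d k l m n : f`_0 = 0 -> w`_0 = 0 -> g`_1 = 0 ->
  (g * w * (x * x) * d - f * x * (l * d + g * w * k) + f * (x * x) * m + f * f * n)`_2 =
  g`_0 * (w`_2 * (x`_0 * x`_0) * d`_0 + w`_1 * (x`_0 * x`_1 + x`_1 * x`_0) * d`_0
    + w`_1 * (x`_0 * x`_0) * d`_1)
  - (f`_1 * x`_0 * (l`_0 * d`_1 + l`_1 * d`_0 + g`_0 * w`_1 * k`_0)
     + (f`_1 * x`_1 + f`_2 * x`_0) * (l`_0 * d`_0))
  + (f`_1 * (x`_0 * x`_0) * m`_1
     + (f`_1 * (x`_0 * x`_1 + x`_1 * x`_0) + f`_2 * (x`_0 * x`_0)) * m`_0)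
  + f`_1 * f`_1 * n`_0.
Proof.
move=> f0 w0 g1; rewrite !(coefD, coefN, coefM_2, coefM_1, coefM_0) f0 w0 g1.
by rewrite !(mulr0, mul0r, add0r, addr0); ring.
Qed.

Lemma sum_form4 (e D G m n : 'I_3 -> R) (g w x f l : R) :
  \sum_s e s * (g * w * (x * x) * D s - f * x * (l * D s + g * w * G s)
    + f * (x * x) * m s + f * f * n s) =
  g * w * (x * x) * (\sum_s e s * D s) - f * x * (l * (\sum_s e s * D s)
    + g * w * (\sum_s e s * G s))
   + f * (x * x) * (\sum_s e s * m s) + f * f * (\sum_s e s * n s).
Proof.
rewrite (eq_bigr (fun s => (g * w * (x * x) - f * x * l) * (e s * D s)
    + (- (f * x * (g * w))) * (e s * G s) + (f * (x * x)) * (e s * m s)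
    + (f * f) * (e s * n s))); last by move=> s _; ring.
rewrite !big_split /= -!mulr_sumr.
by move: (\sum_s e s * D s) (\sum_s e s * G s) (\sum_s e s * m s) (\sum_s e s * n s)
  => y1 y2 y3 y4; ring.
Qed.
End TangentJets.

Lemma rmorph_form (S T : comNzRingType) (b : {rmorphism S -> T}) (g w x d f l k m n : S) :
  b (g * w * (x * x) * d - f * x * (l * d + g * w * k) + f * (x * x) * m + f * f * n) =
  b g * b w * (b x * b x) * b d - b f * b x * (b l * b d + b g * b w * b k)
   + b f * (b x * b x) * b m + b f * b f * b n.
Proof. by rewrite !rmorphD rmorphN !rmorphM !rmorphD !rmorphM. Qed.

Section TangentEq.
Variables (K : fieldType) (c la ka l0 eps : K).
Variables (f2 w2 x1 l1 k0 m1 m0 n0 : {poly K}).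

(** The factor eps t is taken off, m0 is replaced by its value, and t is set to 0. *)
Lemma tangent_cancel : eps != 0 -> ka%:P * m0 = (l0 - c * la * ka) *: (eps *: 'X) ->
  c%:P * (w2 * (ka%:P * ka%:P) * (eps *: 'X) + ((la * eps) *: 'X) * (ka%:P * x1 + x1 * ka%:P) * (eps *: 'X)
    + ((la * eps) *: 'X) * (ka%:P * ka%:P) * (f2 + f2))
  - ((eps *: 'X) * ka%:P * (l0%:P * (f2 + f2) + l1 * (eps *: 'X) + c%:P * ((la * eps) *: 'X) * k0)
     + ((eps *: 'X) * x1 + f2 * ka%:P) * (l0%:P * (eps *: 'X)))
  + ((eps *: 'X) * (ka%:P * ka%:P) * m1
     + ((eps *: 'X) * (ka%:P * x1 + x1 * ka%:P) + f2 * (ka%:P * ka%:P)) * m0)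
  + (eps *: 'X) * (eps *: 'X) * n0 = 0 ->
  w2.[0] = 0 -> m1.[0] = 0 -> f2.[0] * ka * (c * la * ka - l0 - l0) = 0.
Proof.
move=> e0 hm h hw hm1.
have h' : (eps *: 'X) * (c%:P * (w2 * (ka%:P * ka%:P) + la%:P * 'X * (eps%:P * (ka%:P * x1 + x1 * ka%:P))
   + la%:P * (ka%:P * ka%:P) * (f2 + f2))
  - (ka%:P * (l0%:P * (f2 + f2) + 'X * (eps%:P * l1) + 'X * (c%:P * (la * eps)%:P * k0))
     + ('X * (eps%:P * x1) + f2 * ka%:P) * l0%:P)
  + (ka%:P * ka%:P) * m1
     + ('X * (eps%:P * (x1 + x1)) + f2 * ka%:P) * (l0 - c * la * ka)%:P
  + 'X * (eps%:P * n0)) = 0.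
  rewrite -[RHS]h -!mul_polyC.
  have -> : ((eps%:P * 'X) * (ka%:P * x1 + x1 * ka%:P) + f2 * (ka%:P * ka%:P)) * m0 =
    (eps%:P * 'X * (x1 + x1) + f2 * ka%:P) * (ka%:P * m0) by ring.
  by rewrite hm -!mul_polyC polyCM; ring.
have X0 : eps *: 'X != 0 :> {poly K} by rewrite scaler_eq0 polyX_eq0 orbF.
move/eqP: h'; rewrite mulf_eq0 (negPf X0) /= => /eqP /(congr1 (horner_eval 0)).
rewrite /horner_eval !(hornerD, hornerN, hornerM, hornerC, hornerX, horner0) hw hm1 => h'.
by rewrite -[RHS]h'; ring.
Qed.
End TangentEq.

Section Tangency.
Variable K : numClosedFieldType.
Implicit Types (P Q H : {mpoly K[3]}) (v p q : 'I_3 -> K).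
Variables (F C L l : {mpoly K[3]}) (c : K) (A m n : 'I_3 -> {mpoly K[3]}).
Hypothesis hL : L \is 2.-homog.
Hypothesis hm : forall s, m s \is 1.-homog.
Hypothesis eA : forall s, A s = c%:MP * L * (C * C) * F^`M(s)
  - F * C * (l * F^`M(s) + c%:MP * L * C^`M(s)) + F * (C * C) * m s + F * F * n s.
Hypothesis em : \sum_s 'X_s * m s = - (c%:MP * L).

(** The coefficient of x in A gives C(p) m(p) = (l(p) - c la C(p)) dF(p). In the
   contraction, the coefficient of x^2 divided by t and taken at t = 0 is then the
   second order term of F along q0 times C(p) (c la C(p) - 2 l(p)). *)
Lemma tangency_relation p q0 q1 la :
    F.@[p] = 0 -> L.@[p] = 0 -> C.@[p] != 0 ->
    (forall q, dd L p q = la * dd F p q) ->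
    dd F p q0 = 0 -> L.@[q0] = 0 -> (ev p q0 F)`_2 != 0 -> dd F p q1 != 0 ->
    (forall s, (beta p q0 q1 (A s))`_1 = 0) ->
    (\sum_s (dir q0 q1 s)%:P * beta p q0 q1 (A s))`_2 = 0 ->
  c * la * C.@[p] = l.@[p] + l.@[p].
Proof.
move=> Fp Lp Cp hla d0 Lq hf2 d1 ha hb.
have [b hb'] : exists b : {rmorphism {mpoly K[3]} -> {poly {poly K}}},
    forall P, b P = beta p q0 q1 P by exists (beta p q0 q1).
have bF0 : (b F)`_0 = 0 by rewrite hb' beta0 Fp polyC0.
have bL0 : (b L)`_0 = 0 by rewrite hb' beta0 Lp polyC0.
have bC0 : (b C)`_0 = (C.@[p])%:P by rewrite hb' beta0.
have bl0 : (b l)`_0 = (l.@[p])%:P by rewrite hb' beta0.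
have bc0 : (b c%:MP)`_0 = c%:P by rewrite hb' beta0 mevalC.
have bc1 : (b c%:MP)`_1 = 0.
  rewrite hb' beta1 /dd !big1 ?scale0r ?addr0 ?polyC0 // => s _; rewrite mderivC meval0 mulr0 //.
have bF1 : (b F)`_1 = dd F p q1 *: 'X by rewrite hb' (beta1_tangent _ d0).
have bL1 : (b L)`_1 = (la * dd F p q1) *: 'X.
  by rewrite hb' -hla; apply: beta1_tangent; rewrite hla d0 mulr0.
have ebA s : b (A s) = b c%:MP * b L * (b C * b C) * b F^`M(s)
  - b F * b C * (b l * b F^`M(s) + b c%:MP * b L * b C^`M(s))
  + b F * (b C * b C) * b (m s) + b F * b F * b (n s).
  by rewrite eA rmorph_form.
have {}ha s : (b (A s))`_1 = 0 by rewrite hb'.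
have {}hb : (\sum_s (dir q0 q1 s)%:P * b (A s))`_2 = 0.
  by under eq_bigr => s _ do rewrite hb'.
have X0 : dd F p q1 *: 'X != 0 :> {poly K} by rewrite scaler_eq0 polyX_eq0 orbF.
have rel1 s : C.@[p] * (m s).@[p] = (l.@[p] - c * la * C.@[p]) * (F^`M(s)).@[p].
  have := etrans (esym (congr1 (fun x : {poly {poly K}} => x`_1) (ebA s))) (ha s).
  rewrite (jet_tangent1 _ _ _ _ _ _ _ bF0 bL0).
  have e1 : (b F^`M(s))`_0 = ((F^`M(s)).@[p])%:P by rewrite hb' beta0.
  have e2 : (b (m s))`_0 = ((m s).@[p])%:P by rewrite hb' beta0.
  move: bF1 bL1 bC0 bl0 bc0 e1 e2.
  move: (b F)`_1 (b L)`_1 (b C)`_0 (b l)`_0 (b c%:MP)`_0 (b F^`M(s))`_0 (b (m s))`_0.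
  move=> _ _ _ _ _ _ _ -> -> -> -> -> -> -> h.
  have : (dd F p q1 *: 'X) * (C.@[p] * (C.@[p] * (m s).@[p]
      - (l.@[p] - c * la * C.@[p]) * (F^`M(s)).@[p]))%:P = 0.
    rewrite -[RHS]h -!mul_polyC !(polyCM, polyCB); ring.
  move/eqP; rewrite mulf_eq0 (negPf X0) polyC_eq0 mulf_eq0 (negPf Cp) /= subr_eq0.
  by move/eqP.
pose Phi := (b F)^`().
have ePhi : \sum_s (dir q0 q1 s)%:P * b F^`M(s) = Phi.
  by rewrite /Phi hb' deriv_beta; apply: eq_bigr => s _; rewrite hb'.
pose Gam := \sum_s (dir q0 q1 s)%:P * b C^`M(s).
pose mu := \sum_s (dir q0 q1 s)%:P * b (m s).
pose eta := \sum_s (dir q0 q1 s)%:P * b (n s).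
have eS : \sum_s (dir q0 q1 s)%:P * b (A s) =
   b c%:MP * b L * (b C * b C) * Phi - b F * b C * (b l * Phi + b c%:MP * b L * Gam)
   + b F * (b C * b C) * mu + b F * b F * eta.
  rewrite -ePhi /Gam /mu /eta -(sum_form4 (fun s => (dir q0 q1 s)%:P) (fun s => b F^`M(s))
   (fun s => b C^`M(s)) (fun s => b (m s)) (fun s => b (n s))).
  by apply: eq_bigr => s _; rewrite ebA.
have Phi0 : Phi`_0 = dd F p q1 *: 'X by rewrite coef_deriv mulr1n bF1.
have Phi1 : Phi`_1 = (b F)`_2 + (b F)`_2 by rewrite coef_deriv mulr2n.
have mu0 : (C.@[p])%:P * mu`_0 = (l.@[p] - c * la * C.@[p]) *: (dd F p q1 *: 'X).
  have e : Phi`_0 = \sum_s dir q0 q1 s * ((F^`M(s)).@[p])%:P.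
    by rewrite -ePhi coef_sum; apply: eq_bigr => s _; rewrite coefCM hb' beta0.
  rewrite -Phi0 e scaler_sumr /mu coef_sum mulr_sumr; apply: eq_bigr => s _.
  rewrite coefCM hb' beta0 mulrCA -polyCM rel1 -mul_polyC polyCM; ring.
have mu1 : (mu`_1).[0] = 0.
  rewrite /mu coef_sum horner_sum.
  have := congr1 (meval q0) em; rewrite raddf_sum mevalN mevalM Lq mulr0 oppr0 => e.
  rewrite -[RHS]e; apply: eq_bigr => s _.
  rewrite coefCM hornerM hb' beta_t0 (coef_ev _ _ (hm s)) /= mevalM mevalXU; congr (_ * _).
  by rewrite /dir hornerD hornerC hornerZ hornerX mulr0 addr0.
have w2 : ((b L)`_2).[0] = 0 by rewrite hb' beta_t0 (coef_ev _ _ hL).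
have := etrans (esym (congr1 (fun x : {poly {poly K}} => x`_2) eS)) hb.
rewrite (jet_tangent2 _ _ _ _ _ _ bF0 bL0 bc1).
have f2E : ((b F)`_2).[0] = (ev p q0 F)`_2 by rewrite hb' beta_t0.
move: bF1 bL1 bC0 bl0 bc0 Phi0 Phi1 mu0 mu1 w2 f2E.
move: (b F)`_1 (b L)`_1 (b C)`_0 (b l)`_0 (b c%:MP)`_0 Phi`_0 Phi`_1 mu`_0 mu`_1
  (b L)`_2 (b F)`_2 => _ _ _ _ _ _ _ mu0 mu1 w2 f2 -> -> -> -> -> -> -> hmu0 hmu1 hw2 hf2E h.
have := tangent_cancel d1 hmu0 h hw2 hmu1.
rewrite hf2E => /eqP; rewrite !mulf_eq0 (negPf hf2) (negPf Cp) /= -addrA -opprD subr_eq0.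
by move/eqP.
Qed.
End Tangency.

Local Transparent lsub beta ev mmap.

(** * The contradiction in the coordinates of the triangle *)

Section BitangentPoint.
Variable K : numClosedFieldType.
Variable F : {mpoly K[3]}.

Lemma ev_shift n (u w : 'I_n -> K) (p : 'I_n -> K) t (P : {mpoly K[n]}) :
  p =1 (fun i => u i + t * w i) -> ev p w P = ev u w P \Po ('X + t%:P).
Proof.
move=> ep; elim/mpoly_ring_ind: P => [a|i|x y hx hy|x y hx hy].
- by rewrite [ev _ _ _]lsubC [ev u w _]lsubC comp_polyC.
- rewrite [ev _ _ _]lsubX [ev u w _]lsubX comp_polyD comp_polyC comp_polyZ comp_polyX ep.
  by rewrite scalerDr -!mul_polyC polyCD polyCM; ring.
- by rewrite !rmorphD /= hx hy.
- by rewrite !rmorphM /= hx hy.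
Qed.

Lemma bitan_sym l p1 p2 : bitan F l p1 p2 -> bitan F l p2 p1.
Proof.
move=> [u [w [r [al [be [fr hw [t1 [t2 [c [t12 c0 eF e1 e2]]]]]]]]]].
exists u, w, r, al, be; split=> //; exists t2, t1, c; split=> //; first by rewrite eq_sym.
by rewrite eF mulrC.
Qed.

(** The second point w on the line gives the tangent direction, and the contact is
   of order exactly 2. *)
Lemma bitan_point l p1 p2 : bitan F l p1 p2 ->
  [/\ l.@[p1] = 0, F.@[p1] = 0 & exists w,
    [/\ F.@[w] != 0, l.@[w] = 0, dd F p1 w = 0 & (ev p1 w F)`_2 != 0]].
Proof.
move=> [u [w [r [al [be [fr hw [t1 [t2 [c [t12 c0 eF e1 e2]]]]]]]]]].
case: fr => _ _ hl _ [_ _ e0].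
have eS : ev p1 w F = c *: ('X ^+ 2 * ('X + (t1 - t2)%:P) ^+ 2).
  rewrite (ev_shift _ e1) eF comp_polyZ comp_polyM !expr2 !comp_polyM !comp_polyB.
  rewrite comp_polyX !comp_polyC polyCB; congr (c *: _); ring.
have eq0 : (ev p1 w F)`_0 = 0 by rewrite eS coefZ !coefM_0 coefX !mul0r mulr0.
have eq1 : (ev p1 w F)`_1 = 0.
  by rewrite eS coefZ expr2 !coefM_1 !coefM_0 !coefX /= !(mul0r, mulr0, addr0).
split.
- by rewrite (meval_eq _ e1) -horner_ev e0 horner0.
- by rewrite -(ev_at0 p1 w) horner_coef0.
exists w; split=> //.
- by rewrite -(coef_ev u w hl) e0 coef0.
- by rewrite -coef1_ev.
- rewrite eS coefZ coefXnM /= subnn expr2 coefM_0 coefD coefX coefC /= add0r.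
  by rewrite !mulf_neq0 // subr_eq0.
Qed.
End BitangentPoint.

Section Main.
Variable K : numClosedFieldType.
Implicit Types (P Q H : {mpoly K[3]}) (v p q : 'I_3 -> K).

Variable F : {mpoly K[3]}.
Hypothesis hF : F \is 4.-homog.
Hypothesis hsm : forall v, (exists i, v i != 0) -> F.@[v] = 0 ->
  exists i, (F^`M(i)).@[v] != 0.
Hypothesis hvert : forall i, F.@[e_ i] != 0.
Hypothesis hsep : forall j k, j != k -> separable_poly (ev (e_ j) (e_ k) F).
Hypothesis hind : forall c : 'I_3 -> K,
  (forall l, \sum_m c m * (F^`M(l)).@[e_ m] = 0) -> forall m, c m = 0.
Local Notation C := (xyz K).

Lemma dd_e p l P : dd P p (e_ l) = (P^`M(l)).@[p].
Proof.
rewrite /dd (bigD1 l) //= big1 => [|i /negPf hi]; first by rewrite /e_ eqxx mul1r addr0.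
by rewrite /e_ hi mul0r.
Qed.

Lemma not_indep2 p q : (exists l, p l != 0) -> ~ indep2 p q -> exists t, q =1 (fun l => t * p l).
Proof.
move=> [i pi] h; exists (q i / p i) => l.
have /eqP : p i * q l - p l * q i == 0.
  by apply: contraT => hn; case: h; exists i, l.
move/eqP; rewrite subr_eq0 => /eqP e; apply: (mulfI pi); rewrite e; field.
exact: pi.
Qed.

Variables (l1 l2 : {mpoly K[3]}) (p1 p2 p3 p4 : 'I_3 -> K).
Hypotheses (hb1 : bitan F l1 p1 p2) (hb2 : bitan F l2 p3 p4).
Hypotheses (hC1 : C.@[p1] != 0) (hC2 : C.@[p2] != 0) (hC3 : C.@[p3] != 0) (hC4 : C.@[p4] != 0).
Hypotheses (h13 : l1.@[p3] != 0) (h14 : l1.@[p4] != 0).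
Local Notation L := (l1 * l2).

Variables (d : nat) (A : 'I_3 -> {mpoly K[3]}).
Hypothesis hA : forall l, A l \is d.+1.-homog.
Hypothesis hR : \sum_l 'X_l * A l = 0.
Hypothesis hinv : forall l m, exists T, A l * F^`M(m) - A m * F^`M(l) = F * T.
Hypothesis hsing : forall p, (exists l, p l != 0) -> F.@[p] = 0 -> (L * C).@[p] = 0 ->
  forall l, (A l).@[p] = 0.
Hypothesis hloc : forall p q0 q1, (exists l, p l != 0) -> F.@[p] = 0 -> (L * C).@[p] = 0 ->
  dd F p q0 = 0 -> dd F p q1 != 0 -> indep2 p q0 ->
  (forall l, (beta p q0 q1 (A l))`_1 = 0) /\
  (\sum_l (dir q0 q1 l)%:P * beta p q0 q1 (A l))`_2 = 0.
Hypothesis hmult : forall h B, (forall l, A l = L * C ^+ 2 * h * F^`M(l) + F * B l) ->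
  forall v, (exists l, v l != 0) -> F.@[v] = 0 -> h.@[v] != 0.

(** The value of A at p is H(p) dF(p), so H(p) = 0; the coefficient of x in A, at
   t = 0, is then the derivative of H along q times dF(p). *)
Lemma tang2_loc e H B p : H \is e.-homog -> (forall l, A l = H * F^`M(l) + F * B l) ->
  (exists l, p l != 0) -> F.@[p] = 0 -> (L * C).@[p] = 0 -> tang2 F H p.
Proof.
move=> hH eA p0 Fp LCp; have [l Fl] := hsm p0 Fp.
have Hp : H.@[p] = 0.
  have := hsing p0 Fp LCp l; rewrite eA mevalD !mevalM Fp mul0r addr0 => /eqP.
  by rewrite mulf_eq0 (negPf Fl) orbF => /eqP.
split=> // q hq; have [hi|hi] := EM (indep2 p q); last first.
  have [t et] := not_indep2 p0 hi; rewrite /dd.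
  under eq_bigr do rewrite et -mulrA.
  by rewrite -mulr_sumr -/(dd H p p) (dd_self p hH) Hp mul0rn mulr0.
have d1 : dd F p (e_ l) != 0 by rewrite dd_e.
have [/(_ l) ha _] := hloc p0 Fp LCp hq d1 hi.
have [b hb] : exists b : {rmorphism {mpoly K[3]} -> {poly {poly K}}},
  forall P, b P = beta p q (e_ l) P by exists (beta p q (e_ l)).
move: ha; rewrite -hb eA rmorphD !rmorphM coefD !coefM_1.
have -> : (b H)`_0 = 0 by rewrite hb beta0 Hp polyC0.
have -> : (b F)`_0 = 0 by rewrite hb beta0 Fp polyC0.
have -> : (b F)`_1 = dd F p (e_ l) *: 'X by rewrite hb (beta1_tangent _ hq).
rewrite !mul0r !add0r.
have -> : (b F^`M(l))`_0 = ((F^`M(l)).@[p])%:P by rewrite hb beta0.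
have -> : (b H)`_1 = (dd H p q)%:P + (dd H p (e_ l)) *: 'X by rewrite hb beta1.
move=> /(congr1 (horner_eval 0)).
rewrite /horner_eval !(hornerD, hornerM, hornerC, hornerZ, hornerX, horner0).
rewrite !(mulr0, mul0r, addr0) => /eqP; rewrite mulf_eq0 (negPf Fl) orbF.
by move/eqP.
Qed.

Variables (k1 k2 k3 k4 a1 a2 a3 a4 : K).
Hypotheses (ha1 : forall q, dd L p1 q = a1 * dd F p1 q) (ha2 : forall q, dd L p2 q = a2 * dd F p2 q)
  (ha3 : forall q, dd L p3 q = a3 * dd F p3 q) (ha4 : forall q, dd L p4 q = a4 * dd F p4 q).
Hypothesis hk : forall l, k1 * p1 l + k2 * p2 l + k3 * p3 l + k4 * p4 l = 0.
Hypothesis hne : k1 * (a1 * C.@[p1]) + k2 * (a2 * C.@[p2]) + k3 * (a3 * C.@[p3])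
  + k4 * (a4 * C.@[p4]) != 0.

(** The relations at the four points of tangency, added with the coefficients of a
   linear relation between these points: the linear form l disappears. *)
Lemma no_preregular : False.
Proof.
have [l1p1 Fp1 [w1 [Fw1 lw1 dw1 sw1]]] := bitan_point hb1.
have [l1p2 Fp2 [w2 [Fw2 lw2 dw2 sw2]]] := bitan_point (bitan_sym hb1).
have [l2p3 Fp3 [w3 [Fw3 lw3 dw3 sw3]]] := bitan_point hb2.
have [l2p4 Fp4 [w4 [Fw4 lw4 dw4 sw4]]] := bitan_point (bitan_sym hb2).
have [c [B [c0 hA11 hB eA]]] := normal_form2 hF hsm hvert hsep hb1 hb2 Fp1 Fp2 Fp3 Fp4
  hC1 hC2 hC3 hC4 h13 h14 hA hR hinv
  (fun e H B hH eA v nz Fv Lv => tang2_loc hH eA nz Fv Lv) hmult.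
have [hl1 hl2] : l1 \is 1.-homog /\ l2 \is 1.-homog.
  by split; [case: hb1|case: hb2] => u [w [r [al [be [[]]]]]].
have hL : L \is 2.-homog by apply: (dhomogM (d := 1)).
have hBz l : forall v i, v i = 0 -> (exists l, v l != 0) -> F.@[v] = 0 -> (B l).@[v] = 0.
  by move=> v i vi v0 Fv; apply: (B_side hF hvert hsep eA hloc vi v0 Fv).
have hMN l : exists MN : {mpoly K[3]} * {mpoly K[3]},
    [/\ MN.1 \is 4.-homog, MN.2 \is 3.-homog & B l = C * MN.1 + F * MN.2].
  have [M [N [h1 h2 h3]]] := divide_xyz7 hF hvert hsep (hB l) (hBz l).
  by exists (M, N).
have /fin_all_exists[MN hMN'] := hMN.
pose M l := (MN l).1; pose N l := (MN l).2.
have hM l : M l \is 4.-homog by case: (hMN' l).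
have hN l : N l \is 3.-homog by case: (hMN' l).
have eB l : B l = C * M l + F * N l by case: (hMN' l).
have hrad := radial hF hvert eA hR eB.
have hrel := side_relations hF hvert hsep eA hR hloc hN eB.
have [al [v [m [hm eM em]]]] := global_form hF hvert hsep hind hL hM hN hrad hrel.
set l := \sum_s al s *: 'X_s in eM.
have eA' s : A s = c%:MP * L * (C * C) * F^`M(s)
  - F * C * (l * F^`M(s) + c%:MP * L * C^`M(s)) + F * (C * C) * m s + F * F * (N s + C * (v s)%:MP).
  by rewrite eA eB eM; ring.
have pN0 p : C.@[p] != 0 -> exists l, p l != 0.
  move=> hC; apply: contrapT => hn; case/eqP: hC.
  have h0 : p ord0 = 0 by apply: contrapT => /eqP hp; apply: hn; exists ord0.
  exact: (C_side h0).
have rel p w la : C.@[p] != 0 -> F.@[p] = 0 -> L.@[p] = 0 -> F.@[w] != 0 -> L.@[w] = 0 ->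
   dd F p w = 0 -> (ev p w F)`_2 != 0 -> (forall q, dd L p q = la * dd F p q) ->
   c * (la * C.@[p]) = 2%:R * l.@[p].
  move=> Cp Fp Lp Fw Lw dw sw hla; have p0 := pN0 p Cp.
  have [s Fs] := hsm p0 Fp.
  have d1 : dd F p (e_ s) != 0 by rewrite dd_e.
  have hi : indep2 p w.
    apply: contrapT => hn; have [t et] := not_indep2 p0 hn.
    by move: Fw; rewrite (meval_eq _ et) (meval_homog _ _ hF) Fp mulr0 eqxx.
  have LCp : (L * C).@[p] = 0 by rewrite mevalM Lp mul0r.
  have [ha hb] := hloc p0 Fp LCp dw d1 hi.
  rewrite mulrA (tangency_relation hL hm eA' em Fp Lp Cp hla dw Lw sw d1 ha hb).
  by rewrite mulr_natl.
have LE p : l1.@[p] = 0 -> L.@[p] = 0 by move=> h; rewrite mevalM h mul0r.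
have LE' p : l2.@[p] = 0 -> L.@[p] = 0 by move=> h; rewrite mevalM h mulr0.
have r1 := rel _ _ _ hC1 Fp1 (LE _ l1p1) Fw1 (LE _ lw1) dw1 sw1 ha1.
have r2 := rel _ _ _ hC2 Fp2 (LE _ l1p2) Fw2 (LE _ lw2) dw2 sw2 ha2.
have r3 := rel _ _ _ hC3 Fp3 (LE' _ l2p3) Fw3 (LE' _ lw3) dw3 sw3 ha3.
have r4 := rel _ _ _ hC4 Fp4 (LE' _ l2p4) Fw4 (LE' _ lw4) dw4 sw4 ha4.
have lE p : l.@[p] = \sum_s al s * p s.
  by rewrite /l raddf_sum; apply: eq_bigr => s _; rewrite /= mevalZ mevalXU.
have : c * (k1 * (a1 * C.@[p1]) + k2 * (a2 * C.@[p2]) + k3 * (a3 * C.@[p3])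
  + k4 * (a4 * C.@[p4])) = 0.
  rewrite !mulrDr ![c * (_ * (_ * _))]mulrCA r1 r2 r3 r4 !lE.
  rewrite ![_ * (2%:R * _)]mulrCA -!mulrDr !mulr_sumr -!big_split big1 ?mulr0 // => s _ /=.
  have -> : k1 * (al s * p1 s) + k2 * (al s * p2 s) + k3 * (al s * p3 s) + k4 * (al s * p4 s)
    = al s * (k1 * p1 s + k2 * p2 s + k3 * p3 s + k4 * p4 s) by ring.
  by rewrite hk mulr0.
by move/eqP; rewrite mulf_eq0 (negPf c0) (negPf hne).
Qed.

End Main.

(** * Blowing up a point of the curve *)

Section Eta.
Variable K : fieldType.
Implicit Types (g : {mpoly K[2]}) (P : {mpoly K[3]}).

Lemma ord2P (i : 'I_2) : i = ord0 \/ i = ord_max.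
Proof. by case: i => [[|[|[]]] // h]; [left|right]; apply: val_inj. Qed.

(** The isomorphism of K[X, Y] with K[t][x] that sends X to x and Y to t. *)
Definition eta : {mpoly K[2]} -> {poly {poly K}} :=
  mmap (polyC \o @polyC K) (fun i : 'I_2 => if i == ord0 then 'X else 'X%:P).
HB.instance Definition _ := GRing.RMorphism.copy eta
  (mmap (polyC \o @polyC K) (fun i : 'I_2 => if i == ord0 then 'X else 'X%:P)).

Lemma etaC c : eta c%:MP = c%:P%:P. Proof. exact: mmapC. Qed.
Lemma eta0 : eta 'X_ord0 = 'X. Proof. by rewrite /eta mmapX mmap1U. Qed.
Lemma eta1 : eta 'X_ord_max = 'X%:P. Proof. by rewrite /eta mmapX mmap1U. Qed.

(** The inverse of the previous isomorphism. *)
Definition theta (P : {poly {poly K}}) : {mpoly K[2]} :=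
  (map_poly (horner_eval 'X_ord_max \o map_poly (@mpolyC 2 K)) P).['X_ord0].
HB.instance Definition _ := GRing.RMorphism.copy theta
  (horner_eval 'X_ord0 \o map_poly (horner_eval 'X_ord_max \o map_poly (@mpolyC 2 K))).

Lemma thetaX : theta 'X = 'X_ord0.
Proof. by rewrite /theta map_polyX hornerX. Qed.

Lemma etaK : cancel eta theta.
Proof.
elim/mpoly_ring_ind => [c|i|p q hp hq|p q hp hq].
- by rewrite etaC /theta map_polyC hornerC /= /horner_eval map_polyC hornerC.
- case: (ord2P i) => ->; first by rewrite eta0 thetaX.
  by rewrite eta1 /theta map_polyC hornerC /= /horner_eval map_polyX hornerX.
- by rewrite !rmorphD /= hp hq.
- by rewrite !rmorphM /= hp hq.
Qed.

Lemma eta_at0 g : ((eta g)`_0).[0] = g.@[fun=> 0].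
Proof.
rewrite -horner_coef0; elim/mpoly_ring_ind: g => [c|i|p q hp hq|p q hp hq].
- by rewrite etaC !hornerC mevalC.
- by case: (ord2P i) => ->; rewrite ?eta0 ?eta1 ?hornerX ?hornerC ?hornerX mevalXU // hornerC.
- by rewrite rmorphD /= !hornerD hp hq mevalD.
- by rewrite rmorphM /= !hornerM hp hq mevalM.
Qed.

(** Divisibility by a power of X is read on the coefficients in x. *)
Lemma eta_dvd n g : (forall k, (k < n)%N -> (eta g)`_k = 0) ->
  exists g', g = 'X_ord0 ^+ n * g'.
Proof.
move=> h; exists (theta (drop_poly n (eta g))).
rewrite -thetaX -rmorphXn -rmorphM /= mulrC -[LHS]etaK; congr theta.
rewrite -[LHS](poly_take_drop n) [X in X + _](_ : _ = 0) ?add0r //.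
by apply/polyP => k; rewrite coef_take_poly coef0; case: ifP => // /h.
Qed.

Lemma eta_dvdE n g g' : g = 'X_ord0 ^+ n * g' ->
  (forall k, (k < n)%N -> (eta g)`_k = 0) /\ (eta g)`_n = (eta g')`_0.
Proof.
move=> ->; rewrite rmorphM rmorphXn /= eta0; split=> [k hk|].
  by rewrite coefXnM hk.
by rewrite coefXnM ltnn subnn.
Qed.

(** Pull-back by the blow-up (x, t) |-> (x, t x), as a polynomial in x over K[t]. *)
Definition bl g := eta (blowup g).
HB.instance Definition _ := GRing.RMorphism.copy bl
  (eta \o comp_mpoly [tuple 'X_ord0; 'X_ord0 * 'X_ord_max]).

Lemma blE g : eta (blowup g) = bl g. Proof. by []. Qed.

Lemma bl_split g h f : bl g = bl (g - h * f) + bl h * bl f.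
Proof. by rewrite rmorphB rmorphM subrK. Qed.

Lemma blC c : bl c%:MP = c%:P%:P.
Proof. by rewrite /bl /blowup comp_mpolyC etaC. Qed.
Lemma bl0 : bl 'X_ord0 = 'X.
Proof. by rewrite /bl /blowup comp_mpolyXU eta0. Qed.
Lemma bl1 : bl 'X_ord_max = 'X * 'X%:P.
Proof. by rewrite /bl /blowup comp_mpolyXU rmorphM /= eta0 eta1. Qed.
Lemma blZ c g : bl (c *: g) = c%:P%:P * bl g.
Proof. by rewrite -mul_mpolyC rmorphM /= blC. Qed.

Lemma bl_coef0 g : (bl g)`_0 = (g.@[fun=> 0])%:P.
Proof.
rewrite -horner_coef0; elim/mpoly_ring_ind: g => [c|i|p q hp hq|p q hp hq].
- by rewrite blC hornerC mevalC.
- by case: (ord2P i) => ->; rewrite ?bl0 ?bl1 ?hornerM hornerX ?mul0r mevalXU.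
- by rewrite rmorphD /= !hornerD hp hq mevalD polyCD.
- by rewrite rmorphM /= !hornerM hp hq mevalM polyCM.
Qed.

Lemma bl_mon n : bl 'X_[n] = 'X ^+ (mdeg n) * ('X ^+ (n ord_max))%:P.
Proof.
rewrite mpolyXE_id !big_ord_recl big_ord0 mulr1 rmorphM !rmorphXn /=.
have -> : lift ord0 ord0 = ord_max :> 'I_2 by apply: val_inj.
rewrite bl0 bl1 mdegE !big_ord_recl big_ord0 addn0.
have -> : lift ord0 ord0 = ord_max :> 'I_2 by apply: val_inj.
by rewrite exprMn mulrA exprD.
Qed.

Lemma bl_order m g : (forall n : 'X_{1..2}, (mdeg n < m)%N -> g@_n = 0) ->
  forall k, (k < m)%N -> (bl g)`_k = 0.
Proof.
move=> h k hk; rewrite (mpolyE g) rmorph_sum coef_sum big1_seq // => n /= hn.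
have hm : (m <= mdeg n)%N.
  by rewrite leqNgt; apply/negP => /h e; move: hn; rewrite mcoeff_msupp e eqxx.
by rewrite blZ bl_mon mulrCA coefXnM (leq_trans hk hm).
Qed.

(** In a chart with rows q0, q1 and p, the blow-up of the origin is the pencil of the
   lines through p. *)
Lemma bl_affine (M : 'M[K]_3) (q0 q1 p : 'I_3 -> K) P :
    (forall i, M ord0 i = q0 i) -> (forall i, M 1 i = q1 i) -> (forall i, M ord_max i = p i) ->
  bl (affine_eq M P) = beta p q0 q1 P.
Proof.
move=> h0 h1 h2; elim/mpoly_ring_ind: P => [c|i|x y hx hy|x y hx hy].
- by rewrite /affine_eq comp_mpolyC blC [RHS]lsubC.
- rewrite /affine_eq comp_mpolyXU [RHS]lsubX -tnth_nth tnth_mktuple.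
  rewrite !big_ord_recl big_ord0 addr0 !rmorphD /= !blZ.
  rewrite !(tnth_nth 0) /= bl0 bl1 rmorph1.
  rewrite h0 (_ : lift ord0 ord0 = 1) ?h1; last exact: val_inj.
  rewrite (_ : lift ord0 _ = ord_max) ?h2; last exact: val_inj.
  rewrite /dir -!mul_polyC polyCD polyCM; ring.
- by rewrite /affine_eq !rmorphD /= hx hy.
- by rewrite /affine_eq !rmorphM /= hx hy.
Qed.

End Eta.

Lemma order2_coef (K : fieldType) (x y u v : {poly {poly K}}) (c d : K) :
  y`_0 = 0 -> y`_1 = 0 -> v`_0 = 0 -> v`_1 = d *: 'X -> u`_0 = c%:P -> x = y + u * v ->
  x`_0 = 0 /\ x`_1 = (c * d) *: 'X.
Proof.
move=> y0 y1 v0 v1 u0 ->; rewrite !coefD y0 y1 coefM_0 coefM_1 v0 v1 u0 !mulr0 !add0r addr0.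
by rewrite mul_polyC scalerA.
Qed.

(** Contraction of the 2-form A /\ G = F T with two vectors. *)
Lemma contract_form (R : nzRingType) (S : comNzRingType) (b : {rmorphism R -> S}) n
    (a0 a1 : 'I_n -> S) (A G : 'I_n -> R) (T : 'I_n -> 'I_n -> R) F :
  (forall l m, A l * G m - A m * G l = F * T l m) ->
  (\sum_l a0 l * b (A l)) * (\sum_l a1 l * b (G l))
    - (\sum_l a1 l * b (A l)) * (\sum_l a0 l * b (G l))
    = b F * \sum_l \sum_m a0 l * a1 m * b (T l m).
Proof.
move=> h; rewrite [X in _ - X]mulrC !mulr_suml mulr_sumr -sumrB; apply: eq_bigr => l _.
rewrite !mulr_sumr -sumrB; apply: eq_bigr => m _.
rewrite [RHS]mulrCA -rmorphM -h rmorphB !rmorphM; ring.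
Qed.

Section Local.
Variable K : fieldType.
Local Opaque lsub beta eta bl.

(** The strict transform is obtained by dividing by some power of X; either this
   power is at least N or its exponent n is less than N. *)
Lemma strict_exists (b : 'I_2 -> {mpoly K[2]}) N :
  (exists g, forall k, b k = 'X_ord0 ^+ N * g k) \/
  exists n w, [/\ (n < N)%N, forall k, b k = 'X_ord0 ^+ n * w k
    & ~ exists g : 'I_2 -> {mpoly K[2]}, forall k, w k = 'X_ord0 * g k].
Proof.
elim: N => [|N [[g hg]|[n [w [h1 h2 h3]]]]].
- by left; exists b => k; rewrite expr0 mul1r.
- have [[g' hg']|hn] := EM (exists g' : 'I_2 -> {mpoly K[2]}, forall k, g k = 'X_ord0 * g' k).
    by left; exists g' => k; rewrite hg hg' exprSr mulrA.
  by right; exists N, g; split.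
- by right; exists n, w; split=> //; apply: ltnW.
Qed.

Variables (F : {mpoly K[3]}) (A : 'I_3 -> {mpoly K[3]}) (M : 'M[K]_3).
Variables (q0 q1 p : 'I_3 -> K).
Hypotheses (hM0 : forall i, M ord0 i = q0 i) (hM1 : forall i, M 1 i = q1 i)
  (hM2 : forall i, M ord_max i = p i).
Hypothesis hMu : M \in unitmx.
Hypotheses (Fp : F.@[p] = 0) (d0 : dd F p q0 = 0) (d1 : dd F p q1 != 0).
Hypothesis hR : \sum_l 'X_l * A l = 0.
Hypothesis hinv : forall l m, exists T, A l * F^`M(m) - A m * F^`M(l) = F * T.

Let f := affine_eq M F.
Let w := affine_form M A.
Variable bt : {rmorphism {mpoly K[3]} -> {poly {poly K}}}.
Hypothesis hbt : forall P, bt P = beta p q0 q1 P.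

Hypothesis hord : forall k, order_ge 2 f (w k).
Hypothesis hpre : forall f' w', strict_curve f f' -> strict_form w w' ->
  forall x : 'I_2 -> K, x ord0 = 0 -> f'.@[x] = 0 -> ~ (forall k, (w' k).@[x] = 0).

Let W0 := \sum_l (q0 l)%:P%:P * bt (A l).
Let W1 := \sum_l (q1 l)%:P%:P * bt (A l).

Lemma bl_form0 : bl (w ord0) = W0.
Proof.
rewrite /w /affine_form rmorph_sum; apply: eq_bigr => l _; rewrite /= blZ.
by rewrite (bl_affine _ hM0 hM1 hM2) -hbt (_ : widen_ord _ _ = ord0) ?hM0 //; apply: val_inj.
Qed.

Lemma bl_form1 : bl (w ord_max) = W1.
Proof.
rewrite /w /affine_form rmorph_sum; apply: eq_bigr => l _; rewrite /= blZ.
by rewrite (bl_affine _ hM0 hM1 hM2) -hbt (_ : widen_ord _ _ = 1) ?hM1 //; apply: val_inj.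
Qed.

Lemma bl_f : bl f = bt F. Proof. by rewrite hbt; exact: bl_affine. Qed.

Lemma btF0 : (bt F)`_0 = 0. Proof. by rewrite hbt beta0 Fp. Qed.
Lemma btF1 : (bt F)`_1 = dd F p q1 *: 'X.
Proof. by rewrite hbt beta1 d0 add0r. Qed.

Lemma strict_curve_exists : exists2 f', strict_curve f f' & f'.@[fun=> 0] = 0.
Proof.
have [|f' hf'] := @eta_dvd K 1 (blowup f).
  by move=> [] // _; rewrite blE bl_f btF0.
have [_ e1] := eta_dvdE hf'; rewrite blE bl_f btF1 in e1.
exists f'; last by rewrite -eta_at0 -e1 hornerZ hornerX mulr0.
split; first by exists 1%N.
move=> [g hg]; rewrite -[X in X * g]expr1 in hg; have [/(_ 0%N isT) e2 _] := eta_dvdE hg.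
move: e1; rewrite e2 => /eqP; rewrite scaler_eq0 polyX_eq0 orbF.
by rewrite (negPf d1).
Qed.

(** The form belongs to (f) + (X, Y)^2, and q0 is tangent to the curve. *)
Lemma form_jet k : exists c : K, (bl (w k))`_0 = 0 /\ (bl (w k))`_1 = (c * dd F p q1) *: 'X.
Proof.
have [h hh] := hord k; exists (h.@[fun=> 0]).
have hb := bl_order hh.
have e := bl_split (w k) h f; rewrite bl_f in e.
exact: (order2_coef (hb 0%N isT) (hb 1%N isT) btF0 btF1 (bl_coef0 h) e).
Qed.

(** Contract A /\ dF = F T with q0 and q1. The coefficient of x shows that the
   contraction of T vanishes at p; the coefficient of x^2, at t = 0, is then W0 times
   the derivative of F in the direction q1. *)
Lemma invariance_jet : W0`_0 = 0 -> W0`_1 = 0 -> W1`_0 = 0 -> W1`_1 = 0 -> (W0`_2).[0] = 0.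
Proof.
move=> z00 z01 z10 z11.
have [T hT] : exists T, forall l m, A l * F^`M(m) - A m * F^`M(l) = F * T l m.
  have h l m : exists T, A l * F^`M(m) - A m * F^`M(l) = F * T := hinv l m.
  by exists (fun l m => sval (cid (h l m))) => l m; case: cid.
pose G q := \sum_l (q l)%:P%:P * bt F^`M(l).
pose U := \sum_l \sum_m (q0 l)%:P%:P * (q1 m)%:P%:P * bt (T l m).
have e : W0 * G q1 - W1 * G q0 = bt F * U.
  exact: (contract_form bt (fun l => (q0 l)%:P%:P) (fun l => (q1 l)%:P%:P) hT).
have gG q : (G q)`_0 = (dd F p q)%:P.
  rewrite coef_sum /dd rmorph_sum; apply: eq_bigr => l _ /=.
  by rewrite coefCM hbt beta0 -polyCM.
clearbody W0 W1 U; clear hT T.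
have e1 := congr1 (fun x : {poly {poly K}} => x`_1) e.
have e2 := congr1 (fun x : {poly {poly K}} => x`_2) e.
rewrite /= !coefB !coefM_1 z00 z01 z10 z11 !mul0r !addr0 subrr btF0 btF1 mul0r add0r in e1.
have U0 : U`_0 = 0.
  apply/eqP; move/eqP: e1; rewrite eq_sym mulf_eq0 scaler_eq0 polyX_eq0 orbF.
  by rewrite (negPf d1).
rewrite /= !coefB !coefM_2 z00 z01 z10 z11 !gG d0 btF0 btF1 U0 polyC0 in e2.
rewrite !mul0r !mulr0 !add0r !addr0 subr0 in e2.
move/(congr1 (horner_eval 0)): e2; rewrite /horner_eval !hornerM hornerZ hornerX hornerC.
by rewrite mulr0 mul0r => /eqP; rewrite mulf_eq0 (negPf d1) orbF => /eqP.
Qed.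

Let dr := \sum_l (dir q0 q1 l)%:P * bt (A l).
Lemma dirW : dr = W0 + 'X%:P * W1.
Proof.
rewrite /dr /W0 /W1 mulr_sumr -big_split; apply: eq_bigr => l _ /=.
rewrite /dir polyCD -mul_polyC polyCM; ring.
Qed.

(** The point (0, 0) is on the strict transform of the curve. If the pull-back of the
   form were divisible by x^n and not by x^(n+1), with n < 3, its quotient by x^n
   would vanish at this point: for n = 0 and n = 1 by the form of the first jets, for
   n = 2 because W0 and W1 are then of order 2 and the invariance applies. Hence x^3
   divides the pull-back. *)
Lemma blowup_jets : dr`_0 = 0 /\ dr`_1 = 0 /\ dr`_2 = 0 /\ W1`_0 = 0 /\ W1`_1 = 0.
Proof.
have eb0 : eta (blowup_form w ord0) = dr.
  rewrite dirW /blowup_form eqxx rmorphD rmorphM /= !blE bl_form0 bl_form1.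
  by congr (_ + _ * _); rewrite eta1.
have eb1 : eta (blowup_form w ord_max) = 'X * W1.
  by rewrite /blowup_form /= rmorphM /= !blE bl_form1 eta0.
have [c0 [z00 z01]] := form_jet ord0; have [c1 [z10 z11]] := form_jet ord_max.
rewrite bl_form0 in z00 z01; rewrite bl_form1 in z10 z11.
have [[g hg]|[n [w' [n3 hw hnd]]]] := strict_exists (blowup_form w) 3.
  have [h0 _] := eta_dvdE (hg ord0); have [h1 _] := eta_dvdE (hg ord_max).
  rewrite eb0 in h0; rewrite eb1 in h1.
  have := h1 1%N isT; have := h1 2%N isT; rewrite !coefXM /= => -> ->.
  by rewrite !h0.
exfalso; have [f' hf' f'0] := strict_curve_exists.
apply: (hpre hf' (w' := w')) f'0 _ => //; first by split=> //; exists n.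
have [h0 v0] := eta_dvdE (hw ord0); have [h1 v1] := eta_dvdE (hw ord_max).
rewrite eb0 in h0 v0; rewrite eb1 in h1 v1.
have at1 : ((eta (w' ord_max))`_0).[0] = 0.
  rewrite -v1 coefXM; case: (n) n3 => [|[|[|//]]] _ /=; rewrite ?horner0 ?z10 ?horner0 //.
  by rewrite z11 hornerZ hornerX mulr0.
have at0 : ((eta (w' ord0))`_0).[0] = 0.
  rewrite -v0 dirW coefD coefCM hornerD hornerM hornerX mul0r addr0.
  case: (n) n3 h0 => [|[|[|//]]] _ h0; first by rewrite z00 horner0.
    by rewrite z01 hornerZ hornerX mulr0.
  have := h0 1%N isT; rewrite dirW coefD coefCM z01 z11 => e.
  have e0 : c0 * dd F p q1 = 0.
    by move/(congr1 (fun x : {poly K} => x`_1)): e;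
      rewrite coefD coefXM !coefZ coefX /= coefX /= !(mulr0, mulr1, addr0) coef0.
  have e1 : c1 * dd F p q1 = 0.
    by move/(congr1 (fun x : {poly K} => x`_2)): e;
      rewrite coefD coefXM !coefZ !coefX /= !(mulr0, mulr1, add0r) coef0.
  by apply: invariance_jet => //; rewrite ?z01 ?z11 ?e0 ?e1 scale0r.
by move=> k; rewrite -eta_at0; case: (ord2P k) => ->.
Qed.

(** The coefficients of x in the contractions of A with q0, q1 and, by the radial
   relation, p are all 0; these vectors form a basis. *)
Lemma local_jets : (forall l, (bt (A l))`_1 = 0) /\ dr`_2 = 0.
Proof.
have [r0 [r1 [r2 [w0 w1]]]] := blowup_jets; split=> //.
have z01 : W0`_1 = 0 by move: r1; rewrite dirW coefD coefCM w1 mulr0 addr0.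
have hp : \sum_l (p l)%:P * (bt (A l))`_1 = 0.
  have : bt (\sum_l 'X_l * A l) = 0 by rewrite hR rmorph0.
  rewrite rmorph_sum /= => /(congr1 (fun x : {poly {poly K}} => x`_1)).
  rewrite coef0 coef_sum.
  rewrite (eq_bigr (fun l => (p l)%:P * (bt (A l))`_1 + dir q0 q1 l * (bt (A l))`_0)).
    rewrite big_split /= => h; rewrite -[RHS]h -[LHS]addr0; congr (_ + _); rewrite -[LHS]r0.
    by rewrite /dr coef_sum; apply: eq_bigr => l _; rewrite coefCM.
  move=> l _; rewrite rmorphM /= hbt [beta _ _ _ 'X_l]lsubX coefM_1 !coefD !coefC !coefZ !coefX /=.
  by rewrite !(mulr0, mulr1, addr0, add0r).
pose x : 'cV[{poly K}]_3 := \col_l (bt (A l))`_1.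
have Mx : map_mx polyC M *m x = 0.
  apply/matrixP => i j; rewrite !mxE.
  case: (@ord3P ord0 1 ord_max isT i) => ->.
  - rewrite -[RHS]z01 coef_sum; apply: eq_bigr => l _; rewrite !mxE hM0 coefCM //.
  - rewrite -[RHS]w1 coef_sum; apply: eq_bigr => l _; rewrite !mxE coefCM.
    by rewrite -hM1; congr (_%:P * _); congr (M _ _); apply: val_inj.
  - rewrite -[RHS]hp; apply: eq_bigr => l _; rewrite !mxE.
    by rewrite -hM2; congr (_%:P * _); congr (M _ _); apply: val_inj.
have x0 : x = 0.
  have hu : map_mx polyC (invmx M) *m map_mx polyC M = 1%:M.
    by rewrite -map_mxM mulVmx // map_mx1.
  by rewrite -[x]mul1mx -hu -mulmxA Mx mulmx0.
by move=> l; move/matrixP/(_ l 0): x0; rewrite !mxE.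
Qed.

End Local.

(** * Charts centred at a point *)

Section Chart.
Variable K : numClosedFieldType.
Implicit Types (g : {mpoly K[2]}) (P : {mpoly K[3]}).

Lemma bl_coef g n : ((bl g)`_(mdeg n))`_(n ord_max) = g@_n.
Proof.
rewrite [in LHS](mpolyE g) [in RHS](mpolyE g) rmorph_sum !raddf_sum coef_sum coef_sum /=.
apply: eq_bigr => m _; rewrite blZ bl_mon coefCM coefCM coefXnM mcoeffZ mcoeffX.
congr (_ * _); have deg2 (k : 'X_{1..2}) : mdeg k = (k ord0 + k ord_max)%N.
  rewrite mdegE !big_ord_recl big_ord0 addn0; congr (_ + k _)%N; exact: val_inj.
have [<-|h] := eqVneq m n; first by rewrite ltnn subnn coefC eqxx coefXn eqxx.
case: ltnP => hd; first by rewrite coef0.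
rewrite coefC; case: eqP => he; last by rewrite coef0.
rewrite coefXn; case: eqP => // e; case/eqP: h; apply/mnmP => i.
move: e he hd; rewrite !deg2 => e he hd.
have [e0 e1] : m ord0 = n ord0 /\ m ord_max = n ord_max by lia.
by case: (ord2P i) => ->.
Qed.

Lemma affine_eq_morph (M : 'M[K]_3) :
  exists b : {rmorphism {mpoly K[3]} -> {mpoly K[2]}}, forall P, b P = affine_eq M P.
Proof.
by exists (comp_mpoly [tuple \sum_(k < 3) M k i *: tnth (chart_coords K) k | i < 3]).
Qed.

Variables (F : {mpoly K[3]}) (A : 'I_3 -> {mpoly K[3]}).

(** The part of pre-regularity that concerns the points of the exceptional line over
   the origin of the chart. *)
Definition regular_blowup (M : 'M[K]_3) := forall f' w',
  strict_curve (affine_eq M F) f' -> strict_form (affine_form M A) w' ->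
  forall x : 'I_2 -> K, x ord0 = 0 -> f'.@[x] = 0 -> ~ (forall k, (w' k).@[x] = 0).

Definition chart_mx (q0 q1 p : 'I_3 -> K) : 'M[K]_3 :=
  \matrix_(i, j) (if i == ord0 then q0 j else if i == 1 then q1 j else p j).

(** The linear form g vanishes at p and q0 and not at q1. *)
Lemma basis_unit (g q0 q1 p : 'I_3 -> K) :
  \sum_k q0 k * g k = 0 -> \sum_k p k * g k = 0 -> \sum_k q1 k * g k != 0 ->
  indep2 p q0 -> chart_mx q0 q1 p \in unitmx.
Proof.
move=> d0 dp d1 [i [j hij]].
rewrite -row_free_unit -kermx_eq0; apply/eqP/row_matrixP => r; rewrite row0.
have : row r (kermx (chart_mx q0 q1 p)) *m chart_mx q0 q1 p = 0.
  by rewrite -row_mul mulmx_ker row0.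
move: (row r _) => c hc.
have e k : c 0 ord0 * q0 k + c 0 1 * q1 k + c 0 ord_max * p k = 0.
  have := congr1 (fun x : 'rV[K]_3 => x 0 k) hc; rewrite !mxE.
  rewrite !big_ord_recl big_ord0 addr0 !mxE /= => <-.
  rewrite addrA; congr (_ + c 0 _ * _ + c 0 _ * _); exact: val_inj.
have c1 : c 0 1 = 0.
  have : \sum_k (c 0 ord0 * q0 k + c 0 1 * q1 k + c 0 ord_max * p k) * g k = 0.
    by apply: big1 => k _; rewrite e mul0r.
  rewrite (eq_bigr (fun k => c 0 ord0 * (q0 k * g k) + c 0 1 * (q1 k * g k)
    + c 0 ord_max * (p k * g k))); last by move=> k _; ring.
  rewrite !big_split /= -!mulr_sumr d0 dp !mulr0 add0r addr0.
  by move/eqP; rewrite mulf_eq0 (negPf d1) orbF => /eqP.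
have [x ex] : exists x, c 0 ord0 = x by eexists.
have [y ey] : exists y, c 0 ord_max = y by eexists.
rewrite ex ey in e.
have cross z (a b : 'I_3 -> K) : (forall k, z * a k + y * b k = 0) ->
    z * (b i * a j - b j * a i) = 0.
  move=> h; have -> : z * (b i * a j - b j * a i)
    = b i * (z * a j + y * b j) - b j * (z * a i + y * b i) by ring.
  by rewrite !h !mulr0 subrr.
have c0 : x = 0.
  have /eqP : x * (p i * q0 j - p j * q0 i) = 0.
    by apply: cross => k; rewrite -[RHS](e k) c1 mul0r addr0.
  by rewrite mulf_eq0 (negPf hij) orbF => /eqP.
have c2 : y = 0.
  have h k : y * p k = 0 by rewrite -[RHS](e k) c0 c1 !mul0r !add0r.
  apply/eqP; have /eqP : y * (p i * q0 j - p j * q0 i) = 0.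
    by rewrite mulrBr !mulrA !h !mul0r subrr.
  by rewrite mulf_eq0 (negPf hij) orbF.
apply/rowP => k; rewrite mxE.
by case: (@ord3P ord0 1 ord_max isT k) => ->; rewrite ?ex ?ey ?c1.
Qed.

Lemma chart_mx_unit d q0 q1 p : F \is d.-homog -> F.@[p] = 0 -> dd F p q0 = 0 -> dd F p q1 != 0 ->
  indep2 p q0 -> chart_mx q0 q1 p \in unitmx.
Proof.
move=> hF Fp d0 d1; apply: basis_unit d0 _ d1.
by rewrite -/(dd F p p) (dd_self p hF) Fp mul0rn.
Qed.

Lemma chart_local d p q0 q1 : F \is d.-homog -> \sum_l 'X_l * A l = 0 ->
  (forall l m, exists T, A l * F^`M(m) - A m * F^`M(l) = F * T) ->
  (forall M : 'M[K]_3, M \in unitmx -> (forall i, M ord_max i = p i) ->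
     (forall k, order_ge 2 (affine_eq M F) (affine_form M A k)) /\ regular_blowup M) ->
  (exists l, p l != 0) -> F.@[p] = 0 ->
  dd F p q0 = 0 -> dd F p q1 != 0 -> indep2 p q0 ->
  (forall l, (beta p q0 q1 (A l))`_1 = 0) /\
  (\sum_l (dir q0 q1 l)%:P * beta p q0 q1 (A l))`_2 = 0.
Proof.
move=> hF hR hinv hM p0 Fp d0 d1 hi.
have hu := chart_mx_unit hF Fp d0 d1 hi.
have m0 i : chart_mx q0 q1 p ord0 i = q0 i by rewrite mxE.
have m1 i : chart_mx q0 q1 p 1 i = q1 i by rewrite mxE.
have m2 i : chart_mx q0 q1 p ord_max i = p i by rewrite mxE.
have [ho hr] := hM _ hu m2.
exact: (local_jets m0 m1 m2 hu Fp d0 d1 hR hinv (bt := beta p q0 q1) (fun=> erefl) ho hr).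
Qed.

Lemma beta_jet p q0 q1 P : P.@[p] = 0 -> (forall q, dd P p q = 0) ->
  forall k, (k < 2)%N -> (beta p q0 q1 P)`_k = 0.
Proof.
move=> Pp dP [|[|//]] _; first by rewrite beta0 Pp.
by rewrite beta1 !dP scale0r addr0.
Qed.

Lemma poly_order_mul (S : comNzRingType) (x y z : {poly S}) :
  (forall k, (k < 2)%N -> x`_k = 0) -> y`_0 = 0 ->
  forall k, (k < 3)%N -> (x * y * z)`_k = 0.
Proof.
move=> hx hy k hk.
have -> : x = drop_poly 2 x * 'X^2.
  rewrite -[LHS](poly_take_drop 2) [X in X + _](_ : _ = 0) ?add0r //.
  by apply/polyP => i; rewrite coef_take_poly coef0; case: ifP => // /hx.
have -> : y = drop_poly 1 y * 'X^1.
  rewrite -[LHS](poly_take_drop 1) [X in X + _](_ : _ = 0) ?add0r //.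
  by apply/polyP => i; rewrite coef_take_poly coef0; case: i => [|i] //.
have -> : drop_poly 2 x * 'X^2 * (drop_poly 1 y * 'X^1) * z = 'X^3 * (drop_poly 2 x * drop_poly 1 y * z).
  by rewrite (exprD _ 2 1); ring.
by rewrite coefXnM hk.
Qed.

(** G - mu F vanishes to order 2 at p and h to order 1, so the multiplicity of the
   foliation at p is at least 3. *)
Lemma order3_form (M : 'M[K]_3) p (G h mu : {mpoly K[3]}) (B : 'I_3 -> {mpoly K[3]}) :
  (forall i, M ord_max i = p i) ->
  (forall l, A l = G * h * F^`M(l) + F * B l) -> h.@[p] = 0 ->
  (G - mu * F).@[p] = 0 -> (forall q, dd (G - mu * F) p q = 0) ->
  forall k, order_ge 3 (affine_eq M F) (affine_form M A k).
Proof.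
move=> hM eA hp Gp dG k.
have [b hb] := affine_eq_morph M.
pose q l := M (widen_ord (leqnSn 2) k) l.
pose H := \sum_l q l *: F^`M(l).
exists (b (\sum_l q l *: B l + mu * h * H)) => n hn.
have -> : affine_form M A k - b (\sum_l q l *: B l + mu * h * H) * affine_eq M F
    = b ((G - mu * F) * h * H).
  have -> : affine_form M A k = b (\sum_l q l *: A l).
    rewrite rmorph_sum; apply: eq_bigr => l _ /=.
    by rewrite -[q l *: A l]mul_mpolyC rmorphM !hb {2}/affine_eq comp_mpolyC mul_mpolyC.
  rewrite -hb -rmorphM -rmorphB; congr (b _).
  have -> : \sum_l q l *: A l = G * h * H + F * \sum_l q l *: B l.
    rewrite /H !mulr_sumr -big_split; apply: eq_bigr => l _ /=.
    by rewrite eA scalerDr !scalerAr.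
  by ring.
rewrite -bl_coef hb.
rewrite (bl_affine _ (q0 := fun i => M ord0 i) (q1 := fun i => M 1 i) _ _ hM) //.
rewrite !rmorphM poly_order_mul ?coef0 //.
  exact: beta_jet.
by rewrite beta0 hp.
Qed.

End Chart.

(** * Generic choices *)

Section PolyFun.
Variable K : numFieldType.
Implicit Types (f g : 'M[K]_3 -> K) (T a b : 'M[K]_3).

(** Functions on matrices whose restrictions to lines are polynomial; this is enough
   for generic choices. *)
Definition polyfun f := forall a b, exists q : {poly K}, forall t, f (a + t *: b) = q.[t].

Lemma polyfun_ext f g : f =1 g -> polyfun f -> polyfun g.
Proof. by move=> e h x y; have [q hq] := h x y; exists q => t; rewrite -e. Qed.

Lemma polyfunC c : polyfun (fun=> c).
Proof. by move=> x y; exists c%:P => t; rewrite hornerC. Qed.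

Lemma polyfunT i j : polyfun (fun T => T i j).
Proof.
move=> x y; exists ((x i j)%:P + y i j *: 'X) => t.
by rewrite !mxE !hornerE mulrC.
Qed.

Lemma polyfunD f g : polyfun f -> polyfun g -> polyfun (fun T => f T + g T).
Proof.
move=> hf hg x y; have [q hq] := hf x y; have [r hr] := hg x y.
by exists (q + r) => t; rewrite hornerD hq hr.
Qed.

Lemma polyfunM f g : polyfun f -> polyfun g -> polyfun (fun T => f T * g T).
Proof.
move=> hf hg x y; have [q hq] := hf x y; have [r hr] := hg x y.
by exists (q * r) => t; rewrite hornerM hq hr.
Qed.

Lemma polyfun_sum (I : Type) (s : seq I) (P : pred I) (f : I -> 'M[K]_3 -> K) :
  (forall i, polyfun (f i)) -> polyfun (fun T => \sum_(i <- s | P i) f i T).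
Proof.
move=> h; elim: s => [|i s IH].
  by apply: polyfun_ext (polyfunC 0) => T /=; rewrite big_nil.
apply: (@polyfun_ext (fun T => (if P i then f i T else 0) + \sum_(i <- s | P i) f i T)).
  by move=> T; rewrite big_cons; case: ifP; rewrite ?add0r.
by apply: polyfunD => //; case: (P i); [exact: h|exact: polyfunC].
Qed.

Lemma polyfun_prod (I : Type) (s : seq I) (P : pred I) (f : I -> 'M[K]_3 -> K) :
  (forall i, polyfun (f i)) -> polyfun (fun T => \prod_(i <- s | P i) f i T).
Proof.
move=> h; elim: s => [|i s IH].
  by apply: polyfun_ext (polyfunC 1) => T /=; rewrite big_nil.
apply: (@polyfun_ext (fun T => (if P i then f i T else 1) * \prod_(i <- s | P i) f i T)).
  by move=> T; rewrite big_cons; case: ifP; rewrite ?mul1r.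
by apply: polyfunM => //; case: (P i); [exact: h|exact: polyfunC].
Qed.

Lemma polyfun_det n (G : 'M[K]_3 -> 'M[K]_n) :
  (forall i j, polyfun (fun T => G T i j)) -> polyfun (fun T => \det (G T)).
Proof.
move=> h; apply: polyfun_sum => s; apply: polyfunM; first exact: polyfunC.
by apply: polyfun_prod => i; apply: h.
Qed.

Lemma polyfun_adj i j : polyfun (fun T => (\adj T) i j).
Proof.
apply: (@polyfun_ext (fun T => cofactor T j i)) => [T|]; first by rewrite mxE.
apply: polyfunM; first exact: polyfunC.
apply: polyfun_det => k l; apply: (@polyfun_ext (fun T => T (lift j k) (lift i l))) => [T|].
  by rewrite !mxE.
exact: polyfunT.
Qed.

Lemma polyfun_meval n (P : {mpoly K[n]}) (h : 'I_n -> 'M[K]_3 -> K) :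
  (forall i, polyfun (h i)) -> polyfun (fun T => P.@[fun i => h i T]).
Proof.
move=> hh; elim/mpoly_ring_ind: P => [c|i|p q hp hq|p q hp hq].
- by apply: (@polyfun_ext (fun=> c)) => [T|]; rewrite ?mevalC //; apply: polyfunC.
- by apply: (@polyfun_ext (h i)) => [T|]; rewrite ?mevalXU.
- by apply: (polyfun_ext _ (polyfunD hp hq)) => T /=; rewrite mevalD.
- by apply: (polyfun_ext _ (polyfunM hp hq)) => T /=; rewrite mevalM.
Qed.

Lemma polyfun_ev (P : {mpoly K[3]}) i j m :
  polyfun (fun T => (ev (T i) (T j) P)`_m).
Proof.
elim/mpoly_ring_ind: P m => [c|k|p q hp hq|p q hp hq] m.
- apply: (@polyfun_ext (fun=> (c%:P)`_m)) => [T|]; last exact: polyfunC.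
  by rewrite [ev _ _ _]lsubC.
- apply: (@polyfun_ext (fun T => T i k * (m == 0%N)%:R + T j k * (m == 1%N)%:R)) => [T|].
    rewrite [ev _ _ _]lsubX coefD coefC coefZ coefX.
    by case: eqP => _; rewrite ?mulr1 ?mulr0.
  by apply: polyfunD; apply: polyfunM; (exact: polyfunT || exact: polyfunC).
- by apply: (polyfun_ext _ (polyfunD (hp m) (hq m))) => T /=; rewrite rmorphD coefD.
- apply: (@polyfun_ext (fun T => \sum_(k < m.+1) (ev (T i) (T j) p)`_k * (ev (T i) (T j) q)`_(m - k))).
    by move=> T; rewrite rmorphM coefM.
  by apply: polyfun_sum => k; apply: polyfunM.
Qed.

Lemma poly_nonroot (p : {poly K}) : p != 0 -> exists t, p.[t] != 0.
Proof.
move=> p0; apply: contrapT => h.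
have hr t : root p t by apply/rootP/eqP; apply: contraT => ht; case: h; exists t.
have := max_poly_roots p0 (rs := [seq i%:R | i <- iota 0 (size p)]).
rewrite size_map size_iota ltnn => /(_ _ _)/negP; case=> //.
  by apply/allP => t _; apply: hr.
rewrite map_inj_uniq ?iota_uniq // => i j /eqP.
by rewrite eqr_nat => /eqP.
Qed.

(** Functions that do not vanish at a general matrix. *)
Definition nz f := polyfun f /\ exists a, f a != 0.

(** On the line through a nonzero of f and a nonzero of g, both functions are nonzero
   polynomials. *)
Lemma nzM f g : nz f -> nz g -> nz (fun T => f T * g T).
Proof.
move=> [hf [x fx]] [hg [y gy]]; split; first exact: polyfunM.
have [q hq] := hf x (y - x); have [r hr] := hg x (y - x).
have q0 : q != 0.
  by apply: contraNneq fx => e; rewrite -[x]addr0 -(scale0r (y - x)) hq e horner0.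
have r0 : r != 0.
  apply: contraNneq gy => e; rewrite -[y](subrK x) addrC -[y - x]scale1r hr.
  by rewrite e horner0.
have [t ht] := poly_nonroot (mulf_neq0 q0 r0).
by exists (x + t *: (y - x)); rewrite hq hr -hornerM.
Qed.

Lemma nz_prod (I : Type) (s : seq I) (f : I -> 'M[K]_3 -> K) :
  (forall i, nz (f i)) -> nz (fun T => \prod_(i <- s) f i T).
Proof.
move=> h; split; first by apply: polyfun_prod => i; case: (h i).
elim: s => [|i s [x IH]]; first by exists 0; rewrite big_nil oner_eq0.
have [] := @nzM (f i) (fun T => \prod_(i <- s) f i T) (h i) _.
  by split; [apply: polyfun_prod => j; case: (h j)|exists x].
by move=> _ [y hy]; exists y; rewrite big_cons.
Qed.

End PolyFun.

Lemma poly_eq_fun (K : numFieldType) t0 (p q : {poly K}) :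
  (forall t, t != t0 -> p.[t] = q.[t]) -> p = q.
Proof.
move=> h; apply/eqP; rewrite -subr_eq0; apply: contraT => hn.
have hX : (p - q) * ('X - t0%:P) != 0 by rewrite mulf_neq0 // polyXsubC_eq0.
have [t] := poly_nonroot hX; rewrite hornerM hornerXsubC mulf_eq0 subr_eq0 negb_or.
by move=> /andP[ht t1]; move: ht; rewrite hornerD hornerN h // subrr eqxx.
Qed.

Section Sylvester.
Variable K : numClosedFieldType.

(** The Sylvester matrix in a fixed size, so that its determinant is polynomial in
   the coefficients of p and q even when the degrees drop. *)
Definition sylv4 (p q : {poly K}) : 'M[K]_(3 + 4) :=
  col_mx (\matrix_(i < 3, j < 3 + 4) ('X^i * p)`_j) (\matrix_(i < 4, j < 3 + 4) ('X^i * q)`_j).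

(** The powers of a common root form a vector of the kernel. *)
Lemma sylv4_coprime (p q : {poly K}) : (size p <= 5)%N -> (size q <= 4)%N -> \det (sylv4 p q) != 0 ->
  coprimep p q.
Proof.
move=> sp sq hd; apply: contraT => hn.
have [x hx] : exists x, root (gcdp p q) x by apply/closed_rootP.
move: hx; rewrite root_gcd => /andP[/eqP px /eqP qx].
pose c : 'cV[K]_(3 + 4) := \col_j x ^+ j.
have key (r : {poly K}) i : (size ('X^i * r)%R <= 3 + 4)%N -> r.[x] = 0 ->
    \sum_(j < 3 + 4) ('X^i * r)`_j * c j 0 = 0.
  move=> hs hr; have e : ('X^i * r).[x] = 0 by rewrite hornerM hr mulr0.
  by rewrite -[RHS]e (horner_coef_wide _ hs); apply: eq_bigr => j _; rewrite mxE.
have sX i (r : {poly K}) k : (size r <= k)%N -> (size ('X^i * r)%R <= i + k)%N.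
  move=> h; have [->|r0] := eqVneq r 0; first by rewrite mulr0 size_poly0.
  by rewrite mulrC size_mulXn // leq_add2l.
have : sylv4 p q *m c = 0.
  rewrite /sylv4 mul_col_mx -[RHS]col_mx0; congr col_mx; apply/matrixP => i j; rewrite ord1 !mxE.
    rewrite -[RHS](key p i) //; first by apply: eq_bigr => k _; rewrite mxE.
    by apply: leq_trans (sX _ _ _ sp) _; case: i => [[|[|[|]]]].
  rewrite -[RHS](key q i) //; first by apply: eq_bigr => k _; rewrite mxE.
  by apply: leq_trans (sX _ _ _ sq) _; case: i => [[|[|[|[|]]]]].
have hu : sylv4 p q \in unitmx by rewrite unitmxE unitfE.
move=> e; have : c = 0 by rewrite -[c](mulKmx hu) e mulmx0.
move/matrixP/(_ 0 0); rewrite !mxE expr0 => /eqP.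
by rewrite oner_eq0.
Qed.

(** A row of the kernel is a relation U p + V q = 0 where V has degree less than p. *)
Lemma sylv4_neq0 (p q : {poly K}) : size p = 5%N -> (size q <= 4)%N -> coprimep p q -> \det (sylv4 p q) != 0.
Proof.
move=> sp sq hc; rewrite -unitfE -unitmxE -row_free_unit -kermx_eq0.
apply/eqP/row_matrixP => r; rewrite row0.
have : row r (kermx (sylv4 p q)) *m sylv4 p q = 0 by rewrite -row_mul mulmx_ker row0.
move: (row r _) => v hv.
pose U := \poly_(i < 3) (if insub i is Some i' then lsubmx v 0 i' else 0).
pose V := \poly_(i < 4) (if insub i is Some i' then rsubmx v 0 i' else 0).
have UE : U = \sum_(i < 3) lsubmx v 0 i *: 'X^i.
  by rewrite /U poly_def; apply: eq_bigr => i _; rewrite valK.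
have VE : V = \sum_(i < 4) rsubmx v 0 i *: 'X^i.
  by rewrite /V poly_def; apply: eq_bigr => i _; rewrite valK.
have e : U * p + V * q = 0.
  apply/polyP => j; rewrite coef0.
  have [hj|hj] := ltnP j 7; last first.
    have hU := size_polyMleq U p; have hV := size_polyMleq V q.
    have sU : (size U <= 3)%N by apply: size_poly.
    have sV : (size V <= 4)%N by apply: size_poly.
    rewrite coefD !nth_default ?addr0 //.
      apply: leq_trans hV _; apply: leq_trans hj.
      by move: (leq_add sV sq); move: (_ + _)%N => [|k].
    apply: leq_trans hU _; apply: leq_trans hj; rewrite sp addnS /=.
    by rewrite (leq_add sU (leqnn 4)).
  have hv' : lsubmx v *m (\matrix_(i < 3, j < 3 + 4) ('X^i * p)`_j)
      + rsubmx v *m (\matrix_(i < 4, j < 3 + 4) ('X^i * q)`_j) = 0.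
    by rewrite -mul_row_col hsubmxK.
  have := congr1 (fun x : 'rV[K]_(3 + 4) => x 0 (Ordinal hj)) hv'; rewrite !mxE => h.
  rewrite -[RHS]h UE VE !mulr_suml coefD !coef_sum.
  by congr (_ + _); apply: eq_bigr => i _; rewrite !mxE -scalerAl coefZ.
have V0 : V = 0.
  apply/eqP; apply: contraT => hV.
  have dv : p %| V * q.
    by rewrite -[V * q](addKr (U * p)) e addr0 -mulNr dvdp_mull.
  rewrite Gauss_dvdpl // in dv; have := dvdp_leq hV dv; rewrite sp leqNgt.
  by rewrite ltnS (size_poly _ _).
have U0 : U = 0.
  apply/eqP; move: e; rewrite V0 mul0r addr0 => /eqP; rewrite mulf_eq0 -(size_poly_eq0 p) sp.
  by rewrite orbF.
rewrite -[v]hsubmxK -[RHS]row_mx0; congr row_mx; apply/rowP => i; rewrite [RHS]mxE.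
  have := congr1 (fun r : {poly K} => r`_i) U0.
  by rewrite coef0 coef_poly ltn_ord valK.
have := congr1 (fun r : {poly K} => r`_i) V0.
by rewrite coef0 coef_poly ltn_ord valK.
Qed.

End Sylvester.

(** * Generic triangles *)

Section Gradients.
Variable K : numClosedFieldType.
Variable F : {mpoly K[3]}.
Hypothesis hF : F \is 4.-homog.
Hypothesis hsm : forall v, (exists i, v i != 0) -> F.@[v] = 0 ->
  exists i, (F^`M(i)).@[v] != 0.

(** Otherwise F is invariant by the translations along w, so that
   F (w + s q) = s^4 F(q) for all s and q, and w is a singular point. *)
Lemma gradient_span w : (exists i, w i != 0) -> exists v, dd F v w != 0.
Proof.
move=> w0; apply: contrapT => hn.
have dz v : dd F v w = 0 by apply/eqP; apply: contraT => h; case: hn; exists v.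
have const v t : F.@[fun i => v i + t * w i] = F.@[v].
  have d0 : (ev v w F)^`() = 0.
    by apply: (poly_eq_fun (t0 := 0)) => s _; rewrite deriv_ev horner0 -[RHS](dz (fun i => v i + s * w i)).
  have e : ev v w F = ((ev v w F)`_0)%:P.
    apply/polyP => -[|m]; rewrite coefC //=.
    have /eqP := congr1 (fun p : {poly K} => p`_m) d0.
    by rewrite coef_deriv coef0 mulrn_eq0 /= => /eqP.
  by rewrite -horner_ev e hornerC -horner_coef0 ev_at0.
have Fw : F.@[w] = 0.
  have := const (fun=> 0) 1; rewrite (@meval_eq _ _ _ w) => [->|i].
    rewrite (@meval_eq _ _ _ (fun i => 0 * w i)) => [|i]; last by rewrite mul0r.
    by rewrite (meval_homog _ _ hF) expr0n mul0r.
  by rewrite add0r mul1r.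
have grad0 q : dd F w q = 0.
  have e : ev w q F = F.@[q] *: 'X^4.
    apply: (poly_eq_fun (t0 := 0)) => s _; rewrite horner_ev hornerZ hornerXn mulrC -(meval_homog _ _ hF).
    by rewrite -(const (fun i => s * q i) 1); apply: meval_eq => i; rewrite mul1r addrC.
  have := congr1 (fun p : {poly K} => p^`().[0]) e; rewrite deriv_ev derivZ derivXn hornerZ.
  rewrite hornerMn hornerXn expr0n mul0rn mulr0 => <-.
  by apply: eq_bigr => i _; congr (_ * _); apply: meval_eq => l; rewrite mul0r addr0.
have [i /eqP[]] := hsm w0 Fw; rewrite -[LHS]mul1r.
rewrite -(grad0 (e_ i)) /dd (bigD1 i) //= big1 => [|j /negPf hj]; first by rewrite /e_ eqxx addr0.
by rewrite /e_ hj mul0r.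
Qed.

Let g (v : 'I_3 -> K) : 'rV[K]_3 := \row_l (F^`M(l)).@[v].

Lemma gradient_step n (B : 'M[K]_(n, 3)) : (\rank B < 3)%N ->
  exists v, (\rank B < \rank (B + g v)%MS)%N.
Proof.
move=> hB.
have [w hw] : exists w : 'rV[K]_3, ((w <= kermx B^T)%MS) && (w != 0).
  suff /rowV0Pn[w h1 h2] : kermx B^T != 0 by exists w; rewrite h1.
  by rewrite kermx_eq0 -row_leq_rank mxrank_tr -ltnNge.
move: hw; rewrite sub_kermx => /andP[/eqP hw w0].
have Bw : B *m w^T = 0 by apply: trmx_inj; rewrite trmx_mul trmxK hw trmx0.
have [v hv] : exists v, dd F v (w 0) != 0.
  by apply: gradient_span; move/rV0Pn: w0.
exists v; apply: rank_ltmx; rewrite ltmxE addsmxSl addsmx_sub submx_refl /=.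
apply: contra hv => /submxP[D hD]; apply/eqP.
have := congr1 (fun x : 'M[K]_1 => x 0 0) (congr1 (mulmx^~ w^T) hD).
rewrite -mulmxA Bw mulmx0 !mxE => <-; apply: eq_bigr => l _.
by rewrite !mxE mulrC.
Qed.

(** The gradients span the space, so three of them are chosen one after the other. *)
Lemma gradients_independent : exists T : 'M[K]_3,
  \det (\matrix_(m, l) (F^`M(l)).@[T m]) != 0.
Proof.
pose Z : 'M[K]_3 := 0.
have [v0 h0'] : exists v, (0 < \rank (Z + g v)%MS)%N.
  have [|v hv] := @gradient_step 3 Z; first by rewrite mxrank0.
  by exists v; apply: leq_trans hv.
set B0 := (Z + g v0)%MS in h0'.
have grow n (B : 'M[K]_(n, 3)) r : (r < 3)%N -> (r <= \rank B)%N ->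
    exists v, (r < \rank (B + g v)%MS)%N.
  move=> r3 hB; have [hr|hr] := ltnP (\rank B) 3.
    by have [v hv] := gradient_step hr; exists v; apply: leq_ltn_trans hv.
  by exists v0; apply: leq_trans r3 (leq_trans hr _); apply/mxrankS/addsmxSl.
have [v1 h1] := grow _ _ 1%N isT h0'; have [v2 h2] := grow _ _ 2%N isT h1.
exists (\matrix_(i, j) (if i == ord0 then v0 j else if i == 1 then v1 j else v2 j)).
set G := \matrix_(m, l) _; rewrite -unitfE -unitmxE -row_full_unit.
have sG : ((B0 + g v1 + g v2)%MS <= G)%MS.
  rewrite /B0 !addsmx_sub sub0mx /=.
  have e (v : 'I_3 -> K) i : (forall j, (\matrix_(i, j) (if i == ord0 then v0 j else if i == 1
      then v1 j else v2 j) : 'M[K]_3) i j = v j) -> (g v <= G)%MS.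
    move=> h; have -> : g v = row i G; last exact: row_sub.
    by apply/rowP => l; rewrite !mxE; apply: meval_eq => j; rewrite h.
  apply/andP; split; [apply/andP; split|].
  - by apply: (e _ ord0) => j; rewrite mxE.
  - by apply: (e _ 1) => j; rewrite mxE.
  - by apply: (e _ ord_max) => j; rewrite mxE.
by rewrite /row_full eqn_leq rank_leq_col (leq_trans h2) // mxrankS.
Qed.

(** The vertices of the triangle are the rows of T. *)
Record good_triangle (T : 'M[K]_3) : Prop := GoodTriangle {
  good_unit : T \in unitmx;
  good_vertex : forall i, F.@[T i] != 0;
  good_side : forall j k, j != k -> separable_poly (ev (T j) (T k) F);
  good_grad : \det (\matrix_(m, l) (F^`M(l)).@[T m]) != 0 }.

(** The coordinates of p in the triangle T, multiplied by det T. *)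
Definition barycentric (T : 'M[K]_3) (p : 'I_3 -> K) k := \sum_l p l * (\adj T) l k.

Lemma sylv4_ev (u w : 'I_3 -> K) : F.@[w] != 0 ->
  (separable_poly (ev u w F)) = (\det (sylv4 (ev u w F) (ev u w F)^`()) != 0).
Proof.
move=> hw; have s5 := size_ev_eq u hF hw.
have s4 : (size (ev u w F)^`() <= 4)%N by rewrite -ltnS -s5 lt_size_deriv // -size_poly_gt0 s5.
rewrite separable.separable_poly.unlock; apply/idP/idP => [h|h]; first exact: sylv4_neq0.
by apply: sylv4_coprime; rewrite ?s5.
Qed.

Lemma nz_vertex i w : F.@[w] != 0 -> nz (fun T => F.@[T i]).
Proof.
move=> hw; split; first by apply: (polyfun_meval F (h := fun l T => T i l)) => l; apply: polyfunT.
exists (\matrix_(i, j) w j); rewrite (@meval_eq _ _ _ w) // => j; by rewrite mxE.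
Qed.

(** The line through u and w can be taken as the side through rows j and k. *)
Lemma nz_side j k u w : j != k -> F.@[w] != 0 -> separable_poly (ev u w F) ->
  nz (fun T => \det (sylv4 (ev (T j) (T k) F) (ev (T j) (T k) F)^`())).
Proof.
move=> hjk hw hs; split.
  apply: polyfun_det => x y.
  have sh (r : 'M[K]_3 -> {poly K}) n m : (forall m, polyfun (fun T => (r T)`_m)) ->
      polyfun (fun T => ('X^n * r T)`_m).
    move=> hr; apply: (@polyfun_ext _ (fun T => if (m < n)%N then 0 else (r T)`_(m - n))).
      by move=> T; rewrite coefXnM.
    by case: (m < n)%N => //; apply: polyfunC.
  case: (split_ordP x) => i ->.
    apply: (@polyfun_ext _ (fun T => ('X^i * ev (T j) (T k) F)`_y)).
      by move=> T; rewrite col_mxEu mxE.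
    by apply: sh => m; apply: polyfun_ev.
  apply: (@polyfun_ext _ (fun T => ('X^i * (ev (T j) (T k) F)^`())`_y)).
    by move=> T; rewrite col_mxEd mxE.
  apply: sh => m.
  apply: (@polyfun_ext _ (fun T => (ev (T j) (T k) F)`_m.+1 * m.+1%:R)).
    by move=> T; rewrite coef_deriv mulr_natr.
  by apply: polyfunM; [apply: polyfun_ev|apply: polyfunC].
pose T := \matrix_(i < 3, l < 3) (if i == j then u l else w l).
have eT : ev (T j) (T k) F = ev u w F.
  rewrite /ev /lsub; apply: mmap_ext => i.
  by rewrite !mxE eqxx eq_sym (negPf hjk).
by exists T; rewrite eT -sylv4_ev.
Qed.

Lemma nz_barycentric p k : (exists i, p i != 0) -> nz (fun T => barycentric T p k).
Proof.
move=> [i pi]; split.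
  by apply: polyfun_sum => l; apply: polyfunM; [apply: polyfunC|apply: polyfun_adj].
have u : (tperm_mx i k : 'M[K]_3) \in unitmx by exact: unitmx_perm.
exists (invmx (tperm_mx i k)); rewrite /barycentric.
have e : \adj (invmx (tperm_mx i k)) = \det (invmx (tperm_mx i k : 'M[K]_3)) *: tperm_mx i k.
  have hu : invmx (tperm_mx i k : 'M[K]_3) \in unitmx by rewrite unitmx_inv.
  rewrite -[LHS]mulmx1 -(mulmxV hu) mulmxA mul_adj_mx invmxK.
  by rewrite mul_scalar_mx.
under eq_bigr do rewrite e mxE mulrCA.
rewrite -mulr_sumr mulf_neq0 //.
  by rewrite -unitfE -unitmxE unitmx_inv.
rewrite (bigD1 i) //= big1 => [|l hl].
  by rewrite !mxE tpermL eqxx mulr1 addr0.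
rewrite !mxE; case: eqP => // e'; last by rewrite mulr0.
by case/eqP: hl; apply: (@perm_inj _ (tperm i k)); rewrite e' tpermL.
Qed.

(** Each condition says that a function polynomial on lines, and not identically
   zero, takes a nonzero value at T. *)
Theorem generic_triangle u w n (pts : 'I_n -> 'I_3 -> K) :
  F.@[w] != 0 -> separable_poly (ev u w F) -> (forall i, exists l, pts i l != 0) ->
  forall f, nz f -> exists T,
    [/\ good_triangle T, forall i k, barycentric T (pts i) k != 0 & f T != 0].
Proof.
move=> hw hs hp f hf.
pose f3 (x : 'I_3 * 'I_3) T := if x.1 == x.2 then 1 else
  \det (sylv4 (ev (T x.1) (T x.2) F) (ev (T x.1) (T x.2) F)^`()).
have h1 : nz (fun T : 'M[K]_3 => \det T).
  by split; [apply: polyfun_det => i j; apply: polyfunT|exists 1; rewrite det1 oner_eq0].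
have h2 : nz (fun T => \prod_i F.@[T i]) by apply: nz_prod => i; apply: nz_vertex hw.
have h3 : nz (fun T => \prod_(x : 'I_3 * 'I_3) f3 x T).
  apply: nz_prod => x; rewrite /f3; case: eqP => e.
    by split; [apply: polyfunC|exists 0; rewrite oner_eq0].
  by apply: nz_side hw hs; apply/eqP.
have h4 : nz (fun T => \det (\matrix_(m, l) (F^`M(l)).@[T m])).
  split; last exact: gradients_independent.
  apply: polyfun_det => i j; apply: (@polyfun_ext _ (fun T => (F^`M(j)).@[T i])).
    by move=> T; rewrite mxE.
  by apply: (polyfun_meval _ (h := fun l T => T i l)) => l; apply: polyfunT.
have h5 : nz (fun T => \prod_(x : 'I_n * 'I_3) barycentric T (pts x.1) x.2).
  by apply: nz_prod => x; apply: nz_barycentric.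
have [_ [T]] := nzM h1 (nzM h2 (nzM h3 (nzM h4 (nzM h5 hf)))).
rewrite !mulf_eq0 !negb_or => /andP[t1 /andP[t2 /andP[t3 /andP[t4 /andP[t5 t6]]]]].
have v i : F.@[T i] != 0 by move/prodf_neq0: t2; apply.
exists T; split=> //; last by move=> i k; move/prodf_neq0: t5 => /(_ (i, k) isT).
split=> //; first by rewrite unitmxE unitfE.
move=> j k hjk; rewrite sylv4_ev //.
by move/prodf_neq0: t3 => /(_ (j, k) isT); rewrite /f3 /= (negPf hjk).
Qed.

End Gradients.

(** * Bitangent lines *)

Section Bitangent.
Variable K : numClosedFieldType.
Variable F : {mpoly K[3]}.
Hypothesis hF : F \is 4.-homog.
Hypothesis hsm : forall v, (exists i, v i != 0) -> F.@[v] = 0 ->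
  exists i, (F^`M(i)).@[v] != 0.

(** Exchanging the points p and q reverses the coefficients of the binary form. *)
Lemma ev_reverse (p q : 'I_3 -> K) i : (i <= 4)%N -> (ev p q F)`_i = (ev q p F)`_(4 - i).
Proof.
move=> hi; have -> : ev p q F = \poly_(k < 5) (ev q p F)`_(4 - k).
  apply: (poly_eq_fun (t0 := 0)) => t t0.
  rewrite horner_ev (@meval_eq _ _ _ (fun i => t * (q i + t^-1 * p i))) => [|k]; last first.
    by rewrite mulrDr mulrA divff // mul1r addrC.
  rewrite (meval_homog _ _ hF) -horner_ev horner_poly.
  rewrite (horner_coef_wide _ (size_ev q p hF)) mulr_sumr (reindex_inj rev_ord_inj) /=.
  apply: eq_bigr => k _; rewrite subSS mulrCA; congr (_ * _).
  have k4 : (k <= 4)%N by rewrite -ltnS.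
  by rewrite exprVn -exprB ?unitfE ?leq_subr // subKn.
by rewrite coef_poly ltnS hi.
Qed.

(** The line l = 0 is tangent to the curve at p. *)
Definition tang (l : {mpoly K[3]}) (p : 'I_3 -> K) :=
  [/\ exists i, p i != 0, l.@[p] = 0, F.@[p] = 0 & exists c, forall q, dd l p q = c * dd F p q].

Lemma tang_dd l p q : l \is 1.-homog -> l != 0 -> tang l p -> l.@[q] = 0 -> dd F p q = 0.
Proof.
move=> hl l0 [_ _ _ [c hc]] lq.
have := hc q; rewrite dd_linear // lq => /esym/eqP; rewrite mulf_eq0 => /orP[/eqP c0|/eqP //].
have [v] := linear_neq0 hl l0; rewrite -(dd_linear p v hl) hc c0 mul0r.
by rewrite eqxx.
Qed.

(** Tangency at p and q cancels all the coefficients but the middle one of the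
   restriction of F to the line. If this one vanished too, F would be a multiple of l
   and the zeros of the other factor on the line would be singular points. *)
Lemma bitan_exists l p q : l \is 1.-homog -> l != 0 -> tang l p -> tang l q -> indep2 p q ->
  bitan F l p q.
Proof.
move=> hl l0 tp tq hpq.
have [pn lp Fp _] := tp; have [qn lq Fq _] := tq.
have dpq := tang_dd hl l0 tp lq; have dqp := tang_dd hl l0 tq lp.
pose w i := q i - p i.
have [r lr] : exists r, l.@[r] = 1.
  have [v lv] := linear_neq0 hl l0; exists (fun i => (l.@[v])^-1 * v i).
  by rewrite (meval_homog _ _ hl) expr1 mulVf.
have lw : l.@[w] = 0.
  rewrite meval_linear //; under eq_bigr do rewrite mulrBl.
  by rewrite sumrB -!meval_linear // lp lq subrr.
have hpw : indep2 p w.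
  case: hpq => i [j hij]; exists i, j; rewrite /w.
  by rewrite (_ : _ - _ = p i * q j - p j * q i) //; ring.
have hu : chart_mx w r p \in unitmx.
  apply: (basis_unit (g := fun k => l@_U_(k))) => //; rewrite -?meval_linear //.
  by rewrite lr oner_eq0.
set M := chart_mx w r p in hu.
pose nu k : {mpoly K[3]} := \sum_j (invmx M) j k *: 'X_j.
have hnu k : nu k \is 1.-homog by apply: rpred_sum => j _; apply: dhomogZ; apply: dhomogXU.
have enu k (v : 'I_3 -> K) m : (forall j, v j = M m j) -> (nu k).@[v] = (m == k)%:R.
  move=> hv; rewrite meval_linear //.
  have -> : (m == k)%:R = (M *m invmx M) m k by rewrite mulmxV // mxE.
  rewrite mxE; apply: eq_bigr => j _; rewrite hv; congr (_ * _).
  rewrite /nu raddf_sum (bigD1 j) //= big1 => [|i /negPf hi].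
    by rewrite mcoeffZ mcoeffX eqxx mulr1 addr0.
  by rewrite mcoeffZ mcoeffX eq_mnm1 hi mulr0.
have el : l = nu 1.
  rewrite (linear_form hl) /nu; apply: eq_bigr => j _; congr (_ *: _).
  have : M *m (\col_j l@_U_(j)) = delta_mx 1 0.
    apply/matrixP => i k; rewrite ord1 !mxE.
    have e v : (forall j, v j = M i j) -> \sum_j M i j * (\col_j l@_U_(j)) j 0 = l.@[v].
      by move=> hv; rewrite meval_linear //; apply: eq_bigr => j' _; rewrite mxE hv.
    case: (@ord3P ord0 1 ord_max isT i) => ei; subst i.
    - by rewrite (e w) // => j'; rewrite mxE.
    - by rewrite (e r) // => j'; rewrite mxE.
    - by rewrite (e p) // => j'; rewrite mxE.
  move/(congr1 (mulmx (invmx M))); rewrite mulKmx // -colE.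
  by move/matrixP/(_ j 0); rewrite !mxE.
have ev_lin k : ev p w (nu k) = (ord_max == k)%:R%:P + (ord0 == k)%:R *: 'X.
  by rewrite ev_linear // (enu k p ord_max) ?(enu k w ord0) // => j; rewrite mxE.
have fr : frame p w r (nu ord_max) (nu ord0) l.
  split=> //.
    move=> i; rewrite el.
    have e : 'X_i = \sum_k M k i *: nu k.
      rewrite /nu; under eq_bigr do rewrite scaler_sumr.
      rewrite exchange_big /= (bigD1 i) //= [X in _ + X]big1 => [|j /negPf hj].
        rewrite addr0 -[LHS]scale1r; under eq_bigr do rewrite scalerA mulrC.
        rewrite -scaler_suml; congr (_ *: _).
        have := congr1 (fun x : 'M[K]_3 => x i i) (mulVmx hu); rewrite !mxE eqxx => e1.
        apply: (etrans (esym e1)); by apply: eq_bigr => k _; rewrite !mxE.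
      under eq_bigr do rewrite scalerA mulrC.
      rewrite -scaler_suml (_ : \sum_k _ = 0) ?scale0r //.
      have := congr1 (fun x : 'M[K]_3 => x j i) (mulVmx hu); rewrite !mxE hj => e1.
      by apply: (etrans _ e1); apply: eq_bigr => k _; rewrite !mxE.
    rewrite e !big_ord_recl big_ord0 addr0 !mxE /=.
    have -> : lift ord0 ord0 = 1 :> 'I_3 by apply: val_inj.
    have -> : lift ord0 (lift ord0 ord0) = ord_max :> 'I_3 by apply: val_inj.
    by rewrite addrA [LHS]addrC addrA.
  by rewrite el !ev_lin /= !scale1r !scale0r !addr0 ?add0r.
set c := (ev p q F)`_2.
have eP : ev p q F = c *: 'X^2.
  apply/polyP => i; rewrite coefZ coefXn.
  case: i => [|[|[|[|[|i]]]]] /=; rewrite ?mulr1 ?mulr0 //.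
  - by rewrite -horner_coef0 ev_at0.
  - by rewrite coef1_ev.
  - by rewrite ev_reverse // coef1_ev.
  - by rewrite ev_reverse // -horner_coef0 ev_at0.
  - by rewrite nth_default // (leq_trans (size_ev _ _ hF)).
have eW : ev p w F = c *: (('X - 0%:P) ^+ 2 * ('X - 1%:P) ^+ 2).
  apply: (poly_eq_fun (t0 := 1)) => t t1; have t1' : 1 - t != 0 by rewrite subr_eq0 eq_sym.
  rewrite horner_ev (@meval_eq _ _ _ (fun i => (1 - t) * (p i + t / (1 - t) * q i))); last first.
    by move=> i; rewrite /w; field.
  rewrite (meval_homog _ _ hF) -horner_ev eP !(hornerZ, hornerM, horner_exp, hornerX, hornerXsubC).
  by field.
have Fw : F.@[w] = c.
  rewrite -(coef_ev p w hF) eW subr0 coefZ coefXnM /= expr2 coefM !big_ord_recl big_ord0.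
  by rewrite !(coefB, coefX, coefC) /= !(subr0, mul0r, mulr0, mul1r, mulr1, add0r, addr0).
have c0 : c != 0.
  apply/eqP => c0; have [G hG eG] := vanish_line fr hF (etrans eW (etrans (congr1 (fun x => x *: _) c0) (scale0r _))).
  have [v [v0 lv Gv]] : exists v, [/\ exists i, v i != 0, l.@[v] = 0 & G.@[v] = 0].
    have w0 : exists i, w i != 0.
      case: hpw => i [j hij]; apply: contrapT => hn; case/eqP: hij.
      have h k : w k = 0 by apply/eqP; apply: contraT => h; case: hn; exists k.
      by rewrite !h !mulr0 subrr.
    have [s1|s1] := eqVneq (size (ev p w G)) 1%N.
      by exists w; split=> //; rewrite -(coef_ev p w hG) nth_default ?s1.
    have /closed_rootP[x /rootP hx] := s1.
    exists (fun i => p i + x * w i); split.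
    - case: hpw => i [j hij]; apply: contrapT => hn; case/eqP: hij.
      have h k : p k + x * w k = 0 by apply/eqP; apply: contraT => h; case: hn; exists k.
      have h' k : p k = - (x * w k) by apply/eqP; rewrite -addr_eq0 h.
      by rewrite !h'; ring.
    - rewrite -horner_ev; case: fr => _ _ _ _ [_ _ ->]; exact: horner0.
    - by rewrite -horner_ev.
  have Fv : F.@[v] = 0 by rewrite eG mevalM lv mul0r.
  have [i /eqP[]] := hsm v0 Fv.
  by rewrite eG mderivM mevalD !mevalM lv Gv mulr0 mul0r addr0.
exists p, w, r, (nu ord_max), (nu ord0); split=> //; first by rewrite Fw.
exists 0, 1, c; split=> //; first by rewrite eq_sym oner_eq0.
- by move=> i; rewrite mul0r addr0.
- by move=> i; rewrite /w mul1r addrC subrK.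
Qed.

End Bitangent.

(** * Linear changes of coordinates *)

Section Transport.
Variable K : fieldType.
Implicit Types (P Q : {mpoly K[3]}) (T S M : 'M[K]_3) (s p q : 'I_3 -> K).

(** P as a function of the coordinates s of the point s T. *)
Definition tr T P : {mpoly K[3]} := P \mPo [tuple \sum_k T k i *: 'X_k | i < 3].
HB.instance Definition _ T := GRing.RMorphism.copy (tr T)
  (comp_mpoly [tuple \sum_k T k i *: 'X_k | i < 3]).

(** The product s T, for a row vector given by its entries. *)
Definition app s T : 'I_3 -> K := fun i => \sum_k s k * T k i.

Lemma trC T c : tr T c%:MP = c%:MP. Proof. exact: comp_mpolyC. Qed.

Lemma trX T i : tr T 'X_i = \sum_k T k i *: 'X_k.
Proof. by rewrite /tr comp_mpolyXU -tnth_nth tnth_mktuple. Qed.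

Lemma meval_tr T P s : (tr T P).@[s] = P.@[app s T].
Proof.
rewrite /tr comp_mpoly_meval; apply: meval_eq => i; rewrite tnth_mktuple raddf_sum /=.
by apply: eq_bigr => k _; rewrite mevalZ mevalXU mulrC.
Qed.

Lemma tr_homog T P d : P \is d.-homog -> tr T P \is d.-homog.
Proof.
move=> /dhomogP hP; rewrite /tr comp_mpolyE big_seq; apply: rpred_sum => m hm.
have <- : mdeg m = d := hP _ hm.
apply: dhomogZ.
have h i : tnth [tuple \sum_k T k i *: ('X_k : {mpoly K[3]}) | i < 3] i ^+ m i \is (m i).-homog.
  rewrite tnth_mktuple; have ht : \sum_k T k i *: ('X_k : {mpoly K[3]}) \is 1.-homog.
    by apply: rpred_sum => k _; apply: dhomogZ; apply: dhomogXU.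
  by have := dhomogMn (m i) ht; rewrite mul1n.
rewrite mdegE !big_ord_recl !big_ord0 mulr1 addn0.
by apply: dhomogM => //; apply: dhomogM.
Qed.

Lemma deriv_tr T P k : (tr T P)^`M(k) = \sum_i T k i *: tr T P^`M(i).
Proof.
elim/mpoly_ring_ind: P => [c|i|p q hp hq|p q hp hq].
- by rewrite trC mderivC big1 // => i _; rewrite mderivC raddf0 scaler0.
- have dX (a b : 'I_3) : ('X_a : {mpoly K[3]})^`M(b) = (a == b)%:R.
    rewrite deriv_linear; last exact: dhomogXU.
    by rewrite mcoeffX eq_mnm1; case: eqP; rewrite ?mpolyC1 ?mpolyC0.
  rewrite trX raddf_sum /=.
  transitivity ((T k i)%:MP : {mpoly K[3]}).
    rewrite (bigD1 k) //= big1 => [|j /negPf hj]; last by rewrite mderivZ dX hj scaler0.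
    by rewrite mderivZ dX eqxx addr0 -mul_mpolyC mulr1.
  rewrite (bigD1 i) //= big1 => [|j /negPf hj].
    by rewrite dX eqxx rmorph1 addr0 -mul_mpolyC mulr1.
  by rewrite dX eq_sym hj rmorph0 scaler0.
- rewrite rmorphD mderivD hp hq -big_split; apply: eq_bigr => i _ /=.
  by rewrite mderivD rmorphD scalerDr.
- rewrite rmorphM mderivM hp hq mulr_suml mulr_sumr -big_split; apply: eq_bigr => i _ /=.
  by rewrite mderivM rmorphD !rmorphM scalerDr scalerAl scalerAr.
Qed.

Lemma dd_tr T P s q : dd (tr T P) s q = dd P (app s T) (app q T).
Proof.
rewrite /dd (eq_bigr (fun k => \sum_i q k * (T k i * (P^`M(i)).@[app s T]))).
  rewrite exchange_big; apply: eq_bigr => i _ /=.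
  by rewrite /app mulr_suml; apply: eq_bigr => k _; rewrite mulrA.
move=> k _; rewrite deriv_tr raddf_sum mulr_sumr; apply: eq_bigr => i _ /=.
by rewrite mevalZ meval_tr.
Qed.

Lemma ev_tr T P s q : ev s q (tr T P) = ev (app s T) (app q T) P.
Proof.
elim/mpoly_ring_ind: P => [c|i|x y hx hy|x y hx hy].
- by rewrite trC [LHS]lsubC [RHS]lsubC.
- rewrite trX raddf_sum /= [RHS]lsubX /app rmorph_sum scaler_suml -big_split.
  apply: eq_bigr => k _ /=; rewrite [LHS]lsubZ lsubX -!mul_polyC !polyCM /=; ring.
- by rewrite !rmorphD /= hx hy.
- by rewrite !rmorphM /= hx hy.
Qed.

Lemma affine_tr M T P : affine_eq M (tr T P) = affine_eq (M *m T) P.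
Proof.
elim/mpoly_ring_ind: P => [c|i|x y hx hy|x y hx hy].
- by rewrite trC /affine_eq !comp_mpolyC.
- rewrite trX /affine_eq raddf_sum comp_mpolyXU -tnth_nth tnth_mktuple.
  rewrite (eq_bigr (fun k => \sum_l (M l k * T k i) *: tnth (chart_coords K) l)).
    rewrite exchange_big; apply: eq_bigr => l _ /=.
    by rewrite -scaler_suml mxE.
  move=> k _ /=; rewrite comp_mpolyZ comp_mpolyXU -tnth_nth tnth_mktuple scaler_sumr.
  by apply: eq_bigr => l _; rewrite scalerA mulrC.
- by rewrite /affine_eq !rmorphD /= -/(affine_eq _ _) -!/(affine_eq _ _) hx hy.
- by rewrite /affine_eq !rmorphM /= -!/(affine_eq _ _) hx hy.
Qed.

Lemma affine_eq_sum (I : finType) M (f : I -> {mpoly K[3]}) :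
  affine_eq M (\sum_i f i) = \sum_i affine_eq M (f i).
Proof. by rewrite /affine_eq raddf_sum. Qed.

Lemma affine_eqZ M c P : affine_eq M (c *: P) = c *: affine_eq M P.
Proof. by rewrite /affine_eq comp_mpolyZ. Qed.

(** The pull-back of the 1-form A by s |-> s T. *)
Definition trA T (A : 'I_3 -> {mpoly K[3]}) k := \sum_i T k i *: tr T (A i).

Lemma affine_form_tr M T A k : affine_form M (trA T A) k = affine_form (M *m T) A k.
Proof.
rewrite /affine_form /trA.
rewrite (eq_bigr (fun l => \sum_i (M (widen_ord (leqnSn 2) k) l * T l i) *: affine_eq (M *m T) (A i))).
  by rewrite exchange_big; apply: eq_bigr => i _ /=; rewrite -scaler_suml mxE.
move=> l _; rewrite affine_eq_sum scaler_sumr; apply: eq_bigr => i _ /=.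
by rewrite affine_eqZ affine_tr scalerA.
Qed.

Lemma radial_tr T A : \sum_i 'X_i * A i = 0 -> \sum_k 'X_k * trA T A k = 0.
Proof.
move=> h; transitivity (tr T (\sum_i 'X_i * A i)); last by rewrite h rmorph0.
rewrite rmorph_sum (eq_bigr (fun k => \sum_i T k i *: ('X_k * tr T (A i)))).
  rewrite exchange_big; apply: eq_bigr => i _ /=.
  by rewrite rmorphM /= trX mulr_suml; apply: eq_bigr => k _; rewrite scalerAl.
by move=> k _; rewrite /trA mulr_sumr; apply: eq_bigr => i _; rewrite scalerAr.
Qed.

Lemma invariant_tr T A F : leaves_invariant A F -> leaves_invariant (trA T A) (tr T F).
Proof.
move=> h l m; have /fin_all_exists[U hU] : forall x : 'I_3 * 'I_3,
  exists U, A x.1 * F^`M(x.2) - A x.2 * F^`M(x.1) = F * U by move=> x; apply: h.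
have e := @contract_form _ _ (tr T) _ (fun i => (T l i)%:MP) (fun i => (T m i)%:MP) A
  (fun i => F^`M(i)) (fun i j => U (i, j)) F (fun i j => hU (i, j)).
exists (\sum_i \sum_j (T l i)%:MP * (T m j)%:MP * tr T (U (i, j))).
rewrite -e /trA !deriv_tr; congr (_ * _ - _ * _); apply: eq_bigr => i _ /=;
  by rewrite mul_mpolyC.
Qed.

Lemma appM s T S : app (app s T) S =1 app s (T *m S).
Proof.
move=> i; rewrite /app (eq_bigr (fun k => \sum_l s l * (T l k * S k i))).
  by rewrite exchange_big; apply: eq_bigr => l _ /=; rewrite -mulr_sumr mxE.
by move=> k _; rewrite mulr_suml; apply: eq_bigr => l _; rewrite mulrA.
Qed.

Lemma app1 s : app s 1%:M =1 s.
Proof.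
move=> i; rewrite /app (bigD1 i) //= big1 => [|k /negPf hk]; first by rewrite !mxE eqxx mulr1 addr0.
by rewrite !mxE hk mulr0.
Qed.

Lemma app_neq0 s T : T \in unitmx -> (exists i, s i != 0) -> exists i, app s T i != 0.
Proof.
move=> hT [i si]; apply: contrapT => hn; case/eqP: si.
rewrite -[LHS]app1 -(mulmxV hT) -appM.
apply: big1 => k _; rewrite (_ : app s T k = 0) ?mul0r //.
by apply/eqP; apply: contraT => h; case: hn; exists k.
Qed.

Lemma app_unitK T s : T \in unitmx -> app (app s T) (invmx T) = s.
Proof. by move=> hT; apply: funext => i; rewrite appM mulmxV // app1. Qed.

Lemma app_unitVK T s : T \in unitmx -> app (app s (invmx T)) T = s.
Proof. by move=> hT; apply: funext => i; rewrite appM mulVmx // app1. Qed.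

Lemma app_e (i : 'I_3) T : app (fun l => (l == i)%:R) T =1 T i.
Proof.
move=> j; rewrite /app (bigD1 i) //= big1 => [|k /negPf ->]; last by rewrite mul0r.
by rewrite eqxx mul1r addr0.
Qed.

End Transport.

(** * Tangency and transversality *)

Section Rows.
Variable K : fieldType.
Implicit Types (v w : 'rV[K]_3) (P : {mpoly K[3]}).

Lemma row_neq0P v : v != 0 <-> exists i, v ord0 i != 0.
Proof. by split=> [/rV0Pn //|h]; apply/rV0Pn. Qed.

Lemma on_curveP P v : on_curve P v <-> (exists i, v ord0 i != 0) /\ P.@[v ord0] = 0.
Proof.
rewrite /on_curve; split=> [/andP[/row_neq0P h /eqP]|[/row_neq0P -> /eqP]] //.
Qed.

Lemma same_pointP v w : (exists i, v ord0 i != 0) ->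
  same_point v w <-> exists2 t, t != 0 & v ord0 =1 (fun i => t * w ord0 i).
Proof.
move=> /row_neq0P v0; split=> [/andP[/sub_rVP[t et] _]|[t t0 et]].
  exists t; last by move=> i; rewrite et mxE.
  by apply: contraNneq v0 => t0; rewrite et t0 scale0r.
have e : v = t *: w by apply/rowP => i; rewrite !mxE et.
apply/andP; split; first by rewrite e scalemx_sub.
by rewrite -[w](scalerK t0) -e scalemx_sub.
Qed.

Lemma mul_row_grad P v (q : 'I_3 -> K) : ((\row_i q i) *m (grad P v)^T) 0 0 = dd P (v ord0) q.
Proof. by rewrite mxE; apply: eq_bigr => i _; rewrite !mxE. Qed.

(** The second gradient is not 0, so dependency means that the first one is a
   multiple of it. *)
Lemma indep_gradP P F v : grad F v != 0 ->
  ~~ indep_grad P F v <-> exists c, forall q, dd P (v ord0) q = c * dd F (v ord0) q.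
Proof.
move=> g0; split.
  rewrite /indep_grad -kermx_eq0 => /rowV0Pn[u]; rewrite sub_kermx => /eqP hu u0.
  move: hu u0; rewrite -[u]hsubmxK mul_row_col.
  rewrite [lsubmx u]mx11_scalar [rsubmx u]mx11_scalar !mul_scalar_mx.
  move: (lsubmx u 0 0) (rsubmx u 0 0) => x y e u0.
  have [x0|x0] := eqVneq x 0.
    move: e; rewrite x0 scale0r add0r => /eqP; rewrite scaler_eq0 (negPf g0) orbF => /eqP y0.
    by move: u0; rewrite x0 y0 !raddf0 row_mx0 eqxx.
  exists (- (y / x)) => q; rewrite -!mul_row_grad.
  have -> : grad P v = - (y / x) *: grad F v.
    apply: (scalerI x0); rewrite scalerA mulrN mulrCA divff // mulr1 scaleNr.
    by apply/eqP; rewrite -addr_eq0 e.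
  by rewrite linearZ /= -scalemxAr mxE.
move=> [c hc]; have e : grad P v = c *: grad F v.
  apply/rowP => i; have := hc (fun j => (j == i)%:R).
  rewrite /dd (bigD1 i) //= big1 => [|j /negPf ->]; last by rewrite mul0r.
  rewrite [in RHS](bigD1 i) //= big1 => [|j /negPf ->]; last by rewrite mul0r.
  by rewrite eqxx !mul1r !addr0 !mxE.
apply/negP => h; move/row_freeP: h => [B hB].
have : row_mx (1%:M : 'M[K]_1) (- c)%:M *m col_mx (grad P v) (grad F v) = 0.
  by rewrite mul_row_col mul1mx mul_scalar_mx e scaleNr subrr.
move/(congr1 (mulmx^~ B)); rewrite -mulmxA hB mulmx1 mul0mx.
by move/matrixP/(_ 0 (lshift 1 0)); rewrite row_mxEl !mxE eqxx => /eqP; rewrite oner_eq0.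
Qed.
End Rows.

Section Geometry.
Variable K : numClosedFieldType.
Variable F : {mpoly K[3]}.
Hypothesis hF : F \is 4.-homog.
Hypothesis hsm : forall v, (exists i, v i != 0) -> F.@[v] = 0 ->
  exists i, (F^`M(i)).@[v] != 0.

Lemma dd_scale d (P : {mpoly K[3]}) t p q : P \is d.-homog ->
  dd P (fun i => t * p i) q = t ^+ d.-1 * dd P p q.
Proof.
move=> hP; rewrite /dd mulr_sumr; apply: eq_bigr => i _.
by rewrite (meval_homog _ _ (dhomog_deriv i hP)) mulrCA.
Qed.

Lemma bitan_zero l p q v : bitan F l p q -> (exists i, v i != 0) -> l.@[v] = 0 -> F.@[v] = 0 ->
  exists2 t, t != 0 & v =1 (fun i => t * p i) \/ v =1 (fun i => t * q i).
Proof.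
move=> [u [w [r [x [y [fr hw [t1 [t2 [c [t12 c0 eF e1 e2]]]]]]]]]] v0 lv Fv.
case: fr => hx hy hl hX _.
have ev i : v i = u i * x.@[v] + w i * y.@[v].
  by have := congr1 (meval v) (hX i); rewrite !mevalD !mevalZ mevalXU lv mulr0 addr0.
have x0 : x.@[v] != 0.
  apply: contraNneq hw => x0; move: Fv.
  rewrite (@meval_eq _ _ _ (fun i => y.@[v] * w i)) => [|i]; last first.
    by rewrite ev x0 mulr0 add0r mulrC.
  rewrite (meval_homog _ _ hF) => /eqP; rewrite mulf_eq0 expf_eq0 /= => /orP[/eqP y0|->//].
  by case: v0 => i; rewrite ev x0 y0 !mulr0 addr0 eqxx.
exists x.@[v] => //; set t := y.@[v] / x.@[v].
have ev' i : v i = x.@[v] * (u i + t * w i) by rewrite ev /t; field.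
have : F.@[fun i => u i + t * w i] = 0.
  move: Fv; rewrite (meval_eq _ ev') (meval_homog _ _ hF) => /eqP.
  by rewrite mulf_eq0 expf_eq0 (negPf x0) /= => /eqP.
rewrite -horner_ev eF hornerZ hornerM !horner_exp !hornerXsubC => /eqP.
rewrite !mulf_eq0 (negPf c0) /= ?expf_eq0 ?orbb /= !subr_eq0 => /orP[] /eqP et; [left|right] => i.
  by rewrite ev' et -e1.
by rewrite ev' et -e2.
Qed.

Lemma linear_eqZ (l l' : {mpoly K[3]}) c : l \is 1.-homog -> l' \is 1.-homog ->
  (forall q, l'.@[q] = c * l.@[q]) -> l' = c *: l.
Proof.
move=> hl hl' h; rewrite (linear_form hl) (linear_form hl') scaler_sumr; apply: eq_bigr => i _.
by rewrite scalerA !linear_coef // h.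
Qed.

(** Otherwise r is one of the points of tangency of l, and l' is the tangent line to
   the curve there, that is l. *)
Lemma bitan_cross l l' p q r : bitan F l p q -> l \is 1.-homog -> l != 0 -> l' \is 1.-homog ->
  tang F l p -> tang F l q -> tang F l' r -> (forall c, l' <> c *: l) -> l.@[r] != 0.
Proof.
move=> hb hl l0 hl' tp tq [r0 lr Fr [c' hc']] hne; apply/eqP => h.
have key p' t : tang F l p' -> t != 0 -> r =1 (fun i => t * p' i) -> False.
  move=> [_ _ _ [c hc]] t0 er.
  have c0 : c != 0.
    have [v] := linear_neq0 hl l0; rewrite -(dd_linear p' v hl) hc.
    by apply: contraNneq => ->; rewrite mul0r.
  apply: (hne (c' * t ^+ 3 / c)); apply: linear_eqZ => // x.
  rewrite -(dd_linear r x hl') hc' -(dd_linear p' x hl) hc.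
  have -> : dd F r x = t ^+ 3 * dd F p' x.
    by rewrite -(dd_scale _ _ _ hF) (_ : r = (fun i => t * p' i)) //; apply: funext.
  by field.
by have [t t0 [e|e]] := bitan_zero hb r0 h Fr; [apply: (key _ _ tp t0 e)|apply: (key _ _ tq t0 e)].
Qed.

Lemma separable_simple_roots (p : {poly K}) : (forall x, root p x -> p^`().[x] != 0) -> p != 0 ->
  separable_poly p.
Proof.
move=> h p0; rewrite separable.separable_poly.unlock; apply: contraT => hn.
have [x] : exists x, root (gcdp p p^`()) x by apply/closed_rootP.
by rewrite root_gcd => /andP[px /rootP dx]; have := h x px; rewrite dx eqxx.
Qed.

Section Line.
Variable l : {mpoly K[3]}.
Hypotheses (hl : l \is 1.-homog) (l0 : l != 0).
Hypothesis htr : forall v, (exists i, v i != 0) -> l.@[v] = 0 -> F.@[v] = 0 ->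
  forall c, ~ (forall q, dd l v q = c * dd F v q).

(** v, x and a point off the line form a basis; if the derivative of F vanished in
   the directions v and x, the gradient of l would be a multiple of that of F. *)
Lemma line_dd v x : l.@[v] = 0 -> F.@[v] = 0 -> l.@[x] = 0 -> indep2 v x -> dd F v x != 0.
Proof.
move=> lv Fv lx hi; apply/eqP => dx.
have v0 : exists i, v i != 0.
  case: hi => i [j hij]; apply: contrapT => hn; case/eqP: hij.
  have h k : v k = 0 by apply/eqP; apply: contraT => h; case: hn; exists k.
  by rewrite !h !mul0r subrr.
have [r lr] := linear_neq0 hl l0.
have hu : chart_mx x r v \in unitmx.
  by apply: (basis_unit (g := fun k => l@_U_(k))) => //; rewrite -?meval_linear.
have dd_lin (P : {mpoly K[3]}) q : exists a b c, 
   dd P v q = a * dd P v x + b * dd P v r + c * dd P v v /\ 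
   l.@[q] = a * l.@[x] + b * l.@[r] + c * l.@[v].
  pose y := (\row_i q i) *m invmx (chart_mx x r v).
  have ey i : q i = y 0 ord0 * x i + y 0 1 * r i + y 0 ord_max * v i.
    have : (y *m chart_mx x r v) 0 i = q i by rewrite mulmxKV // mxE.
    by rewrite mxE (@sum3 ord0 1 ord_max isT) !mxE.
  exists (y 0 ord0), (y 0 1), (y 0 ord_max); split.
    by rewrite /dd !mulr_sumr -!big_split; apply: eq_bigr => i _ /=; rewrite ey; ring.
  rewrite !meval_linear // !mulr_sumr -!big_split; apply: eq_bigr => i _ /=; rewrite ey; ring.
have dv : dd F v v = 0 by rewrite (dd_self v hF) Fv mul0rn.
have dr : dd F v r != 0.
  have [i Fi] := hsm v0 Fv; apply: contraNneq Fi => dr.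
  have [a [b [c [h _]]]] := dd_lin F (e_ i).
  by rewrite -dd_e h dx dr dv !mulr0 !addr0.
apply: (htr v0 lv Fv (c := l.@[r] / dd F v r)) => q.
have [a [b [c [-> e]]]] := dd_lin F q.
rewrite dd_linear // e lx lv dx dv; field.
exact: dr.
Qed.

(** A transverse line is not contained in the curve, so w can be chosen on it and off
   the curve; the roots are simple by transversality. *)
Lemma separable_line : exists u w, F.@[w] != 0 /\ separable_poly (ev u w F).
Proof.
have [i ci] : exists i, l@_U_(i) != 0.
  apply: contrapT => hn; case/eqP: l0; rewrite (linear_form hl) big1 // => i _.
  suff -> : l@_U_(i) = 0 by rewrite scale0r.
  by apply/eqP; apply: contraT => h; case: hn; exists i.
have [j [k hu]] := exists3 i; have [[h1 h2 h3] [h4 h5 h6]] := neq3 hu.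
pose p m : K := l@_U_(i) * e_ j m - l@_U_(j) * e_ i m.
pose q m : K := l@_U_(i) * e_ k m - l@_U_(k) * e_ i m.
have lp : l.@[p] = 0.
  by rewrite meval_linear // (sum3 hu) /p /e_ !eqxx ?h1 ?h2 ?h3 ?h4 ?h5 ?h6 /= ?mulr1n ?mulr0n; ring.
have lq : l.@[q] = 0.
  by rewrite meval_linear // (sum3 hu) /q /e_ !eqxx ?h1 ?h2 ?h3 ?h4 ?h5 ?h6 /= ?mulr1n ?mulr0n; ring.
have hpq : p j * q k - p k * q j != 0.
  rewrite /p /q /e_ !eqxx ?h1 ?h2 ?h3 ?h4 ?h5 ?h6 /=.
  by rewrite !(mulr0, subr0, mulr1, mul0r) mulf_neq0.
have lpq t : l.@[fun m => p m + t * q m] = 0.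
  by rewrite -horner_ev ev_linear // lp lq polyC0 scale0r addr0 horner0.
have hP : ev p q F != 0.
  apply/eqP => h; have Fp : F.@[p] = 0 by rewrite -(ev_at0 p q) h horner0.
  have := line_dd lp Fp lq; rewrite -coef1_ev h coef0 eqxx => H.
  by have : false by apply: H; exists j, k.
have [t ht] := poly_nonroot hP; rewrite horner_ev in ht.
pose w m := p m + t * q m.
exists q, w; split=> //.
have hqw : indep2 q w.
  exists k, j; rewrite /w (_ : _ - _ = p j * q k - p k * q j) //; ring.
apply: separable_simple_roots; last by rewrite -size_poly_gt0 (size_ev_eq q hF ht).
move=> x /rootP; rewrite horner_ev deriv_ev => hx.
apply: line_dd (lpq t) _ => //.
  have := lpq t; rewrite -/w => lw.
  by rewrite -horner_ev ev_linear // lq lw polyC0 scale0r addr0 horner0.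
case: hqw => a [b hab]; exists a, b.
by have -> : (q a + x * w a) * w b - (q b + x * w b) * w a = q a * w b - q b * w a by ring.
Qed.
End Line.
End Geometry.

(** * The cubic of a triangle *)

Section Triangle.
Variable K : numClosedFieldType.
Variable F : {mpoly K[3]}.
Hypothesis hF : F \is 4.-homog.
Hypothesis hsm : forall v, (exists i, v i != 0) -> F.@[v] = 0 ->
  exists i, (F^`M(i)).@[v] != 0.
Variable T : 'M[K]_3.
Hypothesis good : good_triangle F T.
Let hT : T \in unitmx := good_unit good.
Let hT' : invmx T \in unitmx. Proof. by rewrite unitmx_inv. Qed.
Local Notation F' := (tr T F).

Let appK s := app_unitK s hT.
Let appVK s := app_unitVK s hT.

Lemma app_vertex i : app (e_ i) T = T i :> ('I_3 -> K).
Proof. by apply: funext => j; rewrite app_e. Qed.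

Lemma good_hF : F' \is 4.-homog. Proof. exact: tr_homog. Qed.

Lemma good_hsm v : (exists i, v i != 0) -> F'.@[v] = 0 -> exists i, (F'^`M(i)).@[v] != 0.
Proof.
move=> v0; rewrite meval_tr => Fv; have [i Fi] := hsm (app_neq0 hT v0) Fv.
apply: contrapT => hn; case/eqP: Fi.
rewrite -dd_e -[e_ i]appVK -dd_tr /dd big1 // => k _.
suff -> : (F'^`M(k)).@[v] = 0 by rewrite mulr0.
by apply/eqP; apply: contraT => h; case: hn; exists k.
Qed.

Lemma good_hvert i : F'.@[e_ i] != 0.
Proof. by rewrite meval_tr app_vertex (good_vertex good). Qed.

Lemma good_hsep j k : j != k -> separable_poly (ev (e_ j) (e_ k) F').
Proof. by move=> h; rewrite ev_tr !app_vertex (good_side good). Qed.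

Lemma good_hind c : (forall l, \sum_m c m * (F'^`M(l)).@[e_ m] = 0) -> forall m, c m = 0.
Proof.
move=> h; set G := \matrix_(m, l) (F^`M(l)).@[T m].
have hG : G \in unitmx by rewrite unitmxE unitfE (good_grad good).
have e : (\row_m c m) *m G *m T^T = 0.
  apply/rowP => l; rewrite -mulmxA mxE [RHS]mxE -[RHS](h l); apply: eq_bigr => m _.
  rewrite !mxE deriv_tr raddf_sum; congr (_ * _); apply: eq_bigr => i _ /=.
  by rewrite !mxE mevalZ meval_tr app_vertex mulrC.
have : (\row_m c m) = 0.
  have hTt : T^T \in unitmx by rewrite unitmx_tr.
  rewrite -[LHS](mulmxK hG) -[X in X *m _](mulmxK hTt) e !mul0mx //.
by move=> /rowP h' m; have := h' m; rewrite !mxE.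
Qed.

(** The product of the equations of the three sides of the triangle T. *)
Definition side_cubic := tr (invmx T) (xyz K).
(** The equation of the side opposite to the first vertex. *)
Definition side_line := tr (invmx T) ('X_ord0 : {mpoly K[3]}).

Lemma side_cubic_homog : side_cubic \is 3.-homog.
Proof. exact/tr_homog/xyz_homog. Qed.

Lemma side_line_homog : side_line \is 1.-homog.
Proof. exact/tr_homog/dhomogXU. Qed.

Lemma side_line_neq0 : side_line != 0.
Proof.
apply/eqP => h; have := congr1 (meval (app (e_ ord0) T)) h.
by rewrite meval0 meval_tr appK mevalXU /e_ eqxx => /eqP; rewrite oner_eq0.
Qed.

(** The sides of a good triangle are transverse to the curve. *)
Lemma side_direction i v : app v (invmx T) i = 0 -> (exists l, v l != 0) -> F.@[v] = 0 ->
  exists2 q, app q (invmx T) i = 0 & dd F v q != 0.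
Proof.
move=> vi v0 Fv; have [j [k hu]] := exists3 i; have [[h1 h2 h3] _] := neq3 hu.
have s0 := app_neq0 hT' v0.
have Fs : F'.@[app v (invmx T)] = 0 by rewrite meval_tr appVK.
have [_ _ hd] := side_point good_hF good_hvert good_hsep hu vi s0 Fs.
exists (app (e_ j) T); first by rewrite appK /e_ h1.
by rewrite -[v]appVK -dd_tr dd_e.
Qed.

Lemma side_line_transverse v c : (exists l, v l != 0) -> side_line.@[v] = 0 -> F.@[v] = 0 ->
  ~ (forall q, dd side_line v q = c * dd F v q).
Proof.
move=> v0; rewrite meval_tr mevalXU => vi Fv h.
have [q hq dq] := side_direction vi v0 Fv.
have := h q; rewrite dd_tr ddX hq => /esym/eqP; rewrite mulf_eq0 (negPf dq) orbF => /eqP c0.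
have := h (app (e_ ord0) T); rewrite dd_tr ddX appK c0 mul0r /e_ eqxx => /eqP.
by rewrite oner_eq0.
Qed.

Lemma xyz_zero (s : 'I_3 -> K) : (xyz K).@[s] = 0 -> exists i, s i = 0.
Proof.
rewrite /xyz rmorph_prod /= => /eqP; rewrite prodf_seq_eq0 => /hasP[i _ /=].
by rewrite mevalXU => /eqP; exists i.
Qed.

Lemma xyz_prod (s : 'I_3 -> K) : (xyz K).@[s] = \prod_i s i.
Proof. by rewrite /xyz rmorph_prod /=; apply: eq_bigr => i _; rewrite mevalXU. Qed.

Lemma side_cubic_transverse v c : (exists l, v l != 0) -> side_cubic.@[v] = 0 -> F.@[v] = 0 ->
  ~ (forall q, dd side_cubic v q = c * dd F v q).
Proof.
move=> v0; rewrite meval_tr => /xyz_zero[i vi] Fv h.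
have [j [k hu]] := exists3 i.
have s0 := app_neq0 hT' v0.
have Fs : F'.@[app v (invmx T)] = 0 by rewrite meval_tr appVK.
have [sj sk _] := side_point good_hF good_hvert good_hsep hu vi s0 Fs.
have hd q : dd side_cubic v q = app q (invmx T) i * (app v (invmx T) j * app v (invmx T) k).
  rewrite dd_tr /dd (sum3 hu); have [-> -> ->] := dC_side hu vi.
  by rewrite !mulr0 !addr0.
have [q hq dq] := side_direction vi v0 Fv.
have := h q; rewrite hd hq mul0r => /esym/eqP; rewrite mulf_eq0 (negPf dq) orbF => /eqP c0.
have := h (app (e_ i) T); rewrite hd appK c0 mul0r /e_ eqxx mul1r => /eqP.
by rewrite mulf_eq0 (negPf sj) (negPf sk).
Qed.

Lemma side_roots (i j k : 'I_3) : uniq [:: i; j; k] -> exists rs : seq K,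
  [/\ size rs = 4%N, uniq rs & forall x, x \in rs = (F'.@[fun l => e_ j l + x * e_ k l] == 0)].
Proof.
move=> hu; have [[h1 h2 h3] _] := neq3 hu.
have [rs hrs] := closed_field_poly_normal (ev (e_ j) (e_ k) F').
have sP := size_ev_eq (e_ j) good_hF (good_hvert k).
have lc : lead_coef (ev (e_ j) (e_ k) F') != 0 by rewrite lead_coef_eq0 -size_poly_gt0 sP.
exists rs; split.
- by move: sP; rewrite hrs size_scale // size_prod_XsubC => -[].
- rewrite -separable_prod_XsubC.
  have := good_hsep (negbT h3); rewrite hrs.
  by rewrite (eqp_separable (eqp_scale _ lc)).
- move=> x; have := congr1 (fun p : {poly K} => root p x) hrs.
  by rewrite /= rootZ // root_prod_XsubC => <-; rewrite rootE horner_ev.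
Qed.

(** On the side X_i = 0, a point of the curve has its coordinate j different from 0,
   and is normalized by it. *)
Lemma side_root_point (i j k : 'I_3) v : uniq [:: i; j; k] -> app v (invmx T) i = 0 ->
    (exists l, v l != 0) -> F.@[v] = 0 ->
  exists x, F'.@[fun l => e_ j l + x * e_ k l] = 0 /\
    exists2 t, t != 0 & v = (fun l => t * app (fun l => e_ j l + x * e_ k l) T l).
Proof.
move=> hu vi v0 Fv; have s0 := app_neq0 hT' v0.
have Fs : F'.@[app v (invmx T)] = 0 by rewrite meval_tr appVK.
have [sj sk _] := side_point good_hF good_hvert good_hsep hu vi s0 Fs.
have es := side_param hu vi sj; move: Fs.
set s := app v (invmx T) in es sj *; rewrite (meval_eq _ es) (meval_homog _ _ good_hF) => /eqP.
rewrite mulf_eq0 expf_eq0 (negPf sj) /= => /eqP Fx.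
exists (s k / s j); split=> //; exists (s j) => //.
apply: funext => l; rewrite -[LHS](congr1 (fun f => f l) (appVK v)) -/s /app mulr_sumr.
by apply: eq_bigr => m _; rewrite es mulrA.
Qed.

End Triangle.

(** * The contradiction for an arbitrary triangle *)

Section Contradiction.
Variable K : numClosedFieldType.
Variable F : {mpoly K[3]}.
Hypothesis hF : F \is 4.-homog.
Hypothesis hsm : forall v, (exists i, v i != 0) -> F.@[v] = 0 ->
  exists i, (F^`M(i)).@[v] != 0.
Variable T : 'M[K]_3.
Hypothesis good : good_triangle F T.
Let hT : T \in unitmx := good_unit good.
Let appK s := app_unitK s hT.
Let appVK s := app_unitVK s hT.
Local Notation F' := (tr T F).
Local Notation C := (side_cubic T).
Local Notation pull p := (app p (invmx T)).

Variables (l1 l2 : {mpoly K[3]}) (p1 p2 p3 p4 : 'I_3 -> K).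
Hypotheses (hl1 : l1 \is 1.-homog) (hl2 : l2 \is 1.-homog) (l10 : l1 != 0) (l20 : l2 != 0).
Hypotheses (t1 : tang F l1 p1) (t2 : tang F l1 p2) (t3 : tang F l2 p3) (t4 : tang F l2 p4).
Hypotheses (hi12 : indep2 p1 p2) (hi34 : indep2 p3 p4).
Hypotheses (h13 : l1.@[p3] != 0) (h14 : l1.@[p4] != 0).
Local Notation L := (l1 * l2).
Hypotheses (hC1 : C.@[p1] != 0) (hC2 : C.@[p2] != 0) (hC3 : C.@[p3] != 0) (hC4 : C.@[p4] != 0).

Variables (k1 k2 k3 k4 a1 a2 a3 a4 : K).
Hypotheses (ha1 : forall q, dd L p1 q = a1 * dd F p1 q) (ha2 : forall q, dd L p2 q = a2 * dd F p2 q)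
  (ha3 : forall q, dd L p3 q = a3 * dd F p3 q) (ha4 : forall q, dd L p4 q = a4 * dd F p4 q).
Hypothesis hk : forall l, k1 * p1 l + k2 * p2 l + k3 * p3 l + k4 * p4 l = 0.
Hypothesis hne : k1 * (a1 * C.@[p1]) + k2 * (a2 * C.@[p2]) + k3 * (a3 * C.@[p3])
  + k4 * (a4 * C.@[p4]) != 0.

Variables (d : nat) (A : 'I_3 -> {mpoly K[3]}).
Hypothesis hA : forall l, A l \is d.+1.-homog.
Hypothesis hR : \sum_l 'X_l * A l = 0.
Hypothesis hinv : leaves_invariant A F.
Hypothesis hsingQ : forall v, (exists l, v l != 0) -> F.@[v] = 0 ->
  (forall l, (A l).@[v] = 0) <-> (L * C).@[v] = 0.
Hypothesis hchart : forall v, (exists l, v l != 0) -> F.@[v] = 0 -> (L * C).@[v] = 0 ->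
  forall M : 'M[K]_3, M \in unitmx -> (forall i, M ord_max i = v i) ->
  ((forall k, order_ge 2 (affine_eq M F) (affine_form M A k)) /\ regular_blowup F A M) /\
  ~ (forall k, order_ge 3 (affine_eq M F) (affine_form M A k)).

Lemma tang_tr l p : tang F l p -> tang F' (tr T l) (pull p).
Proof.
move=> [p0 lp Fp [c hc]]; split.
- by apply: app_neq0 => //; rewrite unitmx_inv.
- by rewrite meval_tr appVK.
- by rewrite meval_tr appVK.
- by exists c => q; rewrite !dd_tr appVK.
Qed.

Lemma indep2_tr p q : indep2 p q -> indep2 (pull p) (pull q).
Proof.
move=> hpq; have p0 : exists l, pull p l != 0.
  apply: app_neq0; first by rewrite unitmx_inv.
  case: hpq => i [j hij]; apply: contrapT => hn; case/eqP: hij.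
  have h k : p k = 0 by apply/eqP; apply: contraT => h; case: hn; exists k.
  by rewrite !h !mul0r subrr.
apply: contrapT => hn; have [t et] := not_indep2 p0 hn.
have e l : q l = t * p l.
  rewrite -(congr1 (fun f => f l) (appVK q)) -(congr1 (fun f => f l) (appVK p)).
  by rewrite /app mulr_sumr; apply: eq_bigr => k _; rewrite mulrA -et.
by case: hpq => i [j /eqP[]]; rewrite !e; ring.
Qed.

Lemma tr_neq0 (l : {mpoly K[3]}) : l \is 1.-homog -> l != 0 -> tr T l != 0.
Proof.
move=> hl l0; have [v lv] := linear_neq0 hl l0; apply: contraNneq lv => h.
have := meval_tr T l (pull v); rewrite appVK // => <-.
by rewrite h meval0.
Qed.

Lemma exists_chart (v : 'I_3 -> K) : (exists l, v l != 0) ->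
  exists2 M : 'M[K]_3, M \in unitmx & forall i, M ord_max i = v i.
Proof.
move=> [i vi]; have [j [k hu]] := exists3 i; have [[e1 e2 e3] [e4 e5 e6]] := neq3 hu.
exists (chart_mx (e_ j) (e_ k) v); last by move=> m; rewrite mxE.
pose g m : K := v i * e_ k m - v k * e_ i m.
apply: (basis_unit (g := g)).
- by rewrite (sum3 hu) /g /e_ !eqxx ?e1 ?e2 ?e3 ?e4 ?e5 ?e6 /= ?mulr1n ?mulr0n; ring.
- by rewrite (sum3 hu) /g /e_ !eqxx ?e1 ?e2 ?e3 ?e4 ?e5 ?e6 /= ?mulr1n ?mulr0n; ring.
- rewrite (sum3 hu) /g /e_ !eqxx ?e1 ?e2 ?e3 ?e4 ?e5 ?e6 /= ?mulr1n ?mulr0n.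
  by rewrite !(mul0r, mulr0, add0r, addr0, mul1r, subr0, mulr1).
- by exists i, j; rewrite /e_ eqxx e1 mulr1 mulr0 subr0.
Qed.

Lemma trA_eval p l : (trA T A l).@[p] = \sum_i T l i * (A i).@[app p T].
Proof. by rewrite /trA raddf_sum; apply: eq_bigr => i _ /=; rewrite mevalZ meval_tr. Qed.

Lemma trA_zero p : (forall l, (trA T A l).@[p] = 0) -> forall i, (A i).@[app p T] = 0.
Proof.
move=> h; have e : T *m \col_i (A i).@[app p T] = 0.
  apply/matrixP => l j; rewrite !mxE -[RHS](h l) trA_eval.
  by apply: eq_bigr => i _; rewrite mxE.
have /matrixP e' : \col_i (A i).@[app p T] = 0 by rewrite -[LHS](mulKmx hT) e mulmx0.
by move=> i; have := e' i 0; rewrite !mxE.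
Qed.

Lemma trLC p : (tr T l1 * tr T l2 * xyz K).@[p] = (L * C).@[app p T].
Proof. by rewrite !mevalM !meval_tr appK. Qed.

Lemma trdL p q : dd (tr T l1 * tr T l2) p q = dd L (app p T) (app q T).
Proof. by rewrite -rmorphM dd_tr. Qed.

Lemma affine_formT (M : 'M[K]_3) : affine_form M (trA T A) = affine_form (M *m T) A.
Proof. by apply: funext => k; rewrite affine_form_tr. Qed.

Lemma chartT p : (exists l, p l != 0) -> F'.@[p] = 0 -> (tr T l1 * tr T l2 * xyz K).@[p] = 0 ->
  forall M : 'M[K]_3, M \in unitmx -> (forall i, M ord_max i = p i) ->
  ((forall k, order_ge 2 (affine_eq M F') (affine_form M (trA T A) k)) /\
     regular_blowup F' (trA T A) M) /\
  ~ (forall k, order_ge 3 (affine_eq M F') (affine_form M (trA T A) k)).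
Proof.
move=> p0; rewrite meval_tr trLC => Fp LCp M hM hMp.
have hMT : M *m T \in unitmx by rewrite unitmx_mul hM.
have hMTp i : (M *m T) ord_max i = app p T i.
  by rewrite mxE; apply: eq_bigr => k _; rewrite hMp.
have := hchart (app_neq0 hT p0) Fp LCp hMT hMTp.
by rewrite /regular_blowup !affine_tr affine_formT.
Qed.

(** All the data are carried to the coordinates of the triangle T, where a chart M
   becomes the chart M T in the original coordinates. *)
Lemma no_preregular_triangle : False.
Proof.
have hF' := tr_homog T hF.
have hsm' := good_hsm hsm good.
have hl1' := tr_homog T hl1; have hl2' := tr_homog T hl2.
have b1 := bitan_exists hF' hsm' hl1' (tr_neq0 hl1 l10) (tang_tr t1) (tang_tr t2) (indep2_tr hi12).
have b2 := bitan_exists hF' hsm' hl2' (tr_neq0 hl2 l20) (tang_tr t3) (tang_tr t4) (indep2_tr hi34).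
have hCp p : (xyz K).@[pull p] = C.@[p] by rewrite meval_tr.
have htA l : trA T A l \is d.+1.-homog.
  by apply: rpred_sum => i _; apply: dhomogZ; apply: tr_homog.
have hL' : tr T l1 * tr T l2 \is 2.-homog by apply: (dhomogM (d := 1)).
have aL p c : (forall q, dd L p q = c * dd F p q) ->
    forall q, dd (tr T l1 * tr T l2) (pull p) q = c * dd F' (pull p) q.
  by move=> h q; rewrite trdL appVK // h dd_tr appVK.
have zeroL p : (exists l, p l != 0) -> F'.@[p] = 0 -> (tr T l1 * tr T l2).@[p] = 0 ->
    (xyz K).@[p] != 0 /\ exists c, forall q, dd (tr T l1 * tr T l2) p q = c * dd F' p q.
  move=> p0 Fp; have key r c t : t != 0 -> C.@[r] != 0 -> (forall q, dd L r q = c * dd F r q) ->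
      p =1 (fun i => t * pull r i) ->
      (xyz K).@[p] != 0 /\ exists c, forall q, dd (tr T l1 * tr T l2) p q = c * dd F' p q.
    move=> tn0 Cr hc e; split.
      rewrite (meval_eq _ e) (meval_homog _ _ (xyz_homog K)) hCp.
      by rewrite mulf_neq0 // expf_neq0.
    exists (c / t ^+ 2) => q; rewrite (_ : p = fun i => t * pull r i); last exact: funext.
    rewrite (dd_scale _ _ _ hL') (dd_scale _ _ _ hF') (aL r c) //=.
    by field.
  rewrite mevalM => /eqP; rewrite mulf_eq0 => /orP[] /eqP lp.
    by have [t tn0 [e|e]] := bitan_zero hF' b1 p0 lp Fp; apply: (key _ _ t) e.
  by have [t tn0 [e|e]] := bitan_zero hF' b2 p0 lp Fp; apply: (key _ _ t) e.
apply: (@no_preregular K F' hF' hsm' (good_hvert good) (good_hsep good) (good_hind good)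
  (tr T l1) (tr T l2) (pull p1) (pull p2) (pull p3) (pull p4) b1 b2 _ _ _ _ _ _
  d (trA T A) htA (radial_tr T hR) (invariant_tr T hinv) _ _ _
  k1 k2 k3 k4 a1 a2 a3 a4 (aL _ _ ha1) (aL _ _ ha2) (aL _ _ ha3) (aL _ _ ha4)).
- by rewrite hCp.
- by rewrite hCp.
- by rewrite hCp.
- by rewrite hCp.
- by rewrite meval_tr appVK.
- by rewrite meval_tr appVK.
- move=> p p0; rewrite meval_tr trLC => Fp LCp l.
  have /hsingQ hs := Fp; have hz := (hs (app_neq0 hT p0)).2 LCp.
  by rewrite trA_eval big1 // => i _; rewrite hz mulr0.
- move=> p q0 q1 p0 Fp LCp e0 e1 hi.
  apply: (chart_local hF' (radial_tr T hR) (invariant_tr T hinv) _ p0 Fp e0 e1 hi) => M hM hMp.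
  exact: (chartT p0 Fp LCp hM hMp).1.
- move=> h B eA v v0 Fv; apply/eqP => hv.
  have Av l : (trA T A l).@[v] = 0 by rewrite eA mevalD !mevalM hv Fv !mulr0 !mul0r addr0.
  have Fv' : F.@[app v T] = 0 by rewrite -meval_tr.
  have LCv : (tr T l1 * tr T l2 * xyz K).@[v] = 0.
    by rewrite trLC; apply/(hsingQ (app_neq0 hT v0) Fv'); apply: trA_zero.
  have [M hM hMv] := exists_chart v0.
  apply: (chartT v0 Fv LCv hM hMv).2.
  have [mu [m0 m1]] : exists mu, (tr T l1 * tr T l2 * xyz K ^+ 2 - mu * F').@[v] = 0 /\
      forall q, dd (tr T l1 * tr T l2 * xyz K ^+ 2 - mu * F') v q = 0.
    have ddN P q : dd (- P) v q = - dd P v q.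
      by rewrite -mulN1r ddM mevalN meval1 mulN1r (_ : dd (-1) v q = 0) ?mul0r ?add0r //;
        rewrite /dd big1 // => i _; rewrite -mpolyC1 -mpolyCN mderivC meval0 mulr0.
    have [C0|Cn0] := eqVneq (xyz K).@[v] 0.
      exists 0; rewrite mul0r subr0; split; first by rewrite !mevalM C0 !mul0r mulr0.
      by move=> q; rewrite ddM expr2 !ddM !mevalM C0 !(mulr0, mul0r, addr0).
    have L0 : (tr T l1 * tr T l2).@[v] = 0.
      by move: LCv; rewrite mevalM => /eqP; rewrite mulf_eq0 (negPf Cn0) orbF => /eqP.
    have [_ [c hc]] := zeroL v v0 Fv L0.
    exists (c *: xyz K ^+ 2); split.
      by rewrite mevalB mevalM L0 [(_ * tr T F).@[v]]mevalM Fv mulr0 mul0r subrr.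
    move=> q; rewrite ddD ddN [dd (_ * tr T F) v q]ddM [dd (_ * xyz K ^+ 2) v q]ddM L0 Fv hc mul0r mulr0 !addr0 mevalZ; ring.
  exact: (order3_form hMv eA hv m0 m1).
- move=> l; rewrite /app !mulr_sumr -!big_split big1 // => i _ /=.
  by rewrite !mulrA -!mulrDl hk mul0r.
- by rewrite !hCp.
Qed.

End Contradiction.

(** * The sixteen points *)

Section Points.
Variable K : numClosedFieldType.
Variable F : {mpoly K[3]}.
Hypothesis hF : F \is 4.-homog.
Variable T : 'M[K]_3.
Hypothesis good : good_triangle F T.
Let hT : T \in unitmx := good_unit good.
Local Notation F' := (tr T F).
Local Notation C := (side_cubic T).

Lemma row_app (s : 'I_3 -> K) : (\row_l app s T l) ord0 = app s T.
Proof. by apply: funext => l; rewrite mxE. Qed.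

Lemma app_scale t (s : 'I_3 -> K) l : app (fun m => t * s m) T l = t * app s T l.
Proof. by rewrite /app mulr_sumr; apply: eq_bigr => m _; rewrite mulrA. Qed.

(** Point (i, m) is given by the m-th root of F on side i. In the coordinates of the
   triangle its only zero coordinate has index i, and another one is 1; this makes
   points with different parameters distinct. *)
Lemma twelve_points : exists S : 'I_12 -> 'rV[K]_3,
  [/\ forall j, on_curve F (S j) /\ C.@[S j ord0] = 0,
      forall j j', same_point (S j) (S j') -> j = j'
    & forall v, on_curve F v -> C.@[v ord0] = 0 -> exists j, same_point (S j) v].
Proof.
have ex3 (i : 'I_3) : exists x : 'I_3 * 'I_3, uniq [:: i; x.1; x.2].
  by have [j [k hu]] := exists3 i; exists (j, k).
have /fin_all_exists[nx hnx] := ex3.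
have /fin_all_exists[rs hrs] := fun i => side_roots hF good (hnx i).
pose s (x : 'I_3 * 'I_4) : 'I_3 -> K :=
  fun l => e_ (nx x.1).1 l + (rs x.1)`_x.2 * e_ (nx x.1).2 l.
have sE (x : 'I_3 * 'I_4) : [/\ s x x.1 = 0, s x (nx x.1).1 = 1 & s x (nx x.1).2 = (rs x.1)`_x.2].
  have [[h1 h2 h3] [h4 h5 h6]] := neq3 (hnx x.1).
  by rewrite /s /e_ !eqxx h1 h2 h3 h6 /= !(mulr0, mulr1, addr0, add0r).
have sF (x : 'I_3 * 'I_4) : F'.@[s x] = 0.
  apply/eqP; have [sz _ <-] := hrs x.1; by rewrite mem_nth // sz.
have sN0 (x : 'I_3 * 'I_4) : exists l, s x l != 0.
  by exists (nx x.1).1; have [_ -> _] := sE x; rewrite oner_eq0.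
have sR (x : 'I_3 * 'I_4) : (rs x.1)`_x.2 != 0.
  apply/eqP => h; have := good_hvert good (nx x.1).1.
  rewrite (@meval_eq _ _ _ (s x)) ?sF ?eqxx // => l.
  by rewrite /s h mul0r addr0.
have s_inj (x y : 'I_3 * 'I_4) t : s x =1 (fun l => t * s y l) -> x = y.
  move=> e; have [x1 x2 x3] := sE x; have [y1 y2 y3] := sE y.
  have e1 : x.1 = y.1.
    have := e y.1; rewrite y1 mulr0; case: (ord3P (hnx x.1) y.1) => -> //.
      by rewrite x2 => /eqP; rewrite oner_eq0.
    by rewrite x3 => /eqP; rewrite (negPf (sR x)).
  rewrite -e1 in y2 y3; have := e (nx x.1).1; rewrite x2 y2 mulr1 => t1.
  have := e (nx x.1).2; rewrite x3 y3 -t1 mul1r => e2.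
  have [sz hu _] := hrs x.1.
  have hx : (x.2 < size (rs x.1))%N by rewrite sz.
  have hy : (y.2 < size (rs x.1))%N by rewrite sz.
  have : x.2 = y.2 :> nat by apply/eqP; rewrite -(nth_uniq 0 hx hy hu) e2.
  by case: x y e1 {e x1 x2 x3 y1 y2 y3 t1 e2 sz hu hx hy} => a b [a' b'] /= -> /val_inj ->.
have hc : 12 = #|{: 'I_3 * 'I_4}| by rewrite card_prod !card_ord.
pose S (j : 'I_12) : 'rV[K]_3 := \row_l app (s (enum_val (cast_ord hc j))) T l.
have SE j : S j ord0 = app (s (enum_val (cast_ord hc j))) T by exact: row_app.
have SN0 j : exists l, S j ord0 l != 0 by rewrite SE; apply: app_neq0.
exists S; split.
- move=> j; split; first by apply/on_curveP; split=> //; rewrite SE -meval_tr.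
  rewrite SE meval_tr app_unitK //; apply: C_side (_ : s _ (enum_val (cast_ord hc j)).1 = 0).
  by case: (sE (enum_val (cast_ord hc j))).
- move=> j j' /same_pointP-/(_ (SN0 j))[t t0]; rewrite !SE => e.
  apply: (@cast_ord_inj _ _ hc); apply: enum_val_inj; apply: (s_inj _ _ t) => l.
  have e' : app (s (enum_val (cast_ord hc j))) T = app (fun l => t * s (enum_val (cast_ord hc j')) l) T.
    by apply: funext => m; rewrite e app_scale.
  by have := congr1 (fun f => app f (invmx T) l) e'; rewrite !app_unitK.
- move=> v /on_curveP[v0 Fv] Cv; have [i vi] : exists i, app (v ord0) (invmx T) i = 0.
    by apply: xyz_zero; rewrite -meval_tr.
  have [x [Fx [t t0 et]]] := side_root_point hF good (hnx i) vi v0 Fv.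
  have [sz hu hx] := hrs i.
  have xr : x \in rs i by rewrite hx Fx.
  have hm : (index x (rs i) < 4)%N by rewrite -sz index_mem.
  exists (cast_ord (esym hc) (enum_rank (i, Ordinal hm))).
  apply/(same_pointP _ (SN0 _)); exists t^-1; first by rewrite invr_eq0.
  move=> l; rewrite SE cast_ordKV enum_rankK et mulKf //.
  rewrite (_ : s (i, Ordinal hm) = (fun l => e_ (nx i).1 l + x * e_ (nx i).2 l)) //.
  by apply: funext => m; rewrite /s /= nth_index.
Qed.
End Points.

Section SamePoint.
Variable K : fieldType.
Implicit Types v w : 'rV[K]_3.

Lemma same_point_sym v w : same_point v w = same_point w v.
Proof. by rewrite /same_point andbC. Qed.

Lemma same_point_zero d (P : {mpoly K[3]}) v w : P \is d.-homog -> v != 0 -> same_point v w ->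
  P.@[w ord0] = 0 -> P.@[v ord0] = 0.
Proof.
move=> hP /row_neq0P v0 /(same_pointP _ v0)[t _ e] h.
by rewrite (meval_eq _ e) (meval_homog _ _ hP) h mulr0.
Qed.

Lemma config_divisor_at (F linf : {mpoly K[3]}) (Q : 'I_16 -> 'rV[K]_3) m L j :
  (forall i j, same_point (Q i) (Q j) -> i = j) -> ~~ on_curve linf (Q j) ->
  config_divisor F linf Q m L (Q j) = (m j)%:Z.
Proof.
move=> hinj /negPf hl; rewrite /config_divisor hl andbF muln0 subr0.
rewrite (bigD1 j) //= big1 => [|i hi].
  by rewrite /same_point submx_refl muln1 addr0.
case: (boolP (same_point (Q i) (Q j))) => [/hinj e|_]; last by rewrite muln0.
by rewrite e eqxx in hi.
Qed.
End SamePoint.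

Section Sixteen.
Variable K : numClosedFieldType.
Variable F : {mpoly K[3]}.
Hypothesis hF : F \is 4.-homog.
Variable T : 'M[K]_3.
Hypothesis good : good_triangle F T.
Local Notation C := (side_cubic T).

Lemma sixteen_points (w : 'I_4 -> 'rV[K]_3) :
  (forall k, on_curve F (w k) /\ C.@[w k ord0] != 0) ->
  (forall k k', same_point (w k) (w k') -> k = k') ->
  exists Q : 'I_16 -> 'rV[K]_3,
  [/\ forall j, on_curve F (Q j), forall i j, same_point (Q i) (Q j) -> i = j,
      forall j : 'I_16, (j < 12)%N -> C.@[Q j ord0] = 0,
      forall (k : 'I_4) (j : 'I_16), j = (12 + k)%N :> nat -> Q j = w k
    & forall v, on_curve F v -> C.@[v ord0] = 0 -> exists j, same_point (Q j) v].
Proof.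
move=> hw hinj; have [S [S1 S2 S3]] := twelve_points hF good.
have hC := side_cubic_homog T.
pose Q (j : 'I_(12 + 4)) := match split j with inl i => S i | inr k => w k end.
have Ql i : Q (lshift 4 i) = S i by rewrite /Q -[lshift 4 i]/(unsplit (inl i)) unsplitK.
have Qr k : Q (rshift 12 k) = w k by rewrite /Q -[rshift 12 k]/(unsplit (inr k)) unsplitK.
have cross i k : same_point (S i) (w k) = false.
  apply/negP; rewrite same_point_sym => h; have [wF /eqP[]] := hw k.
  by apply: (same_point_zero hC _ h); [case/andP: wF|case: (S1 i)].
exists Q; split.
- move=> j; case: (@split_ordP 12 4 j) => [i ->|k ->]; rewrite ?Ql ?Qr.
    by case: (S1 i).
  by case: (hw k).
- move=> j j'; case: (@split_ordP 12 4 j) => [i ->|k ->]; case: (@split_ordP 12 4 j') => [i' ->|k' ->];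
    rewrite ?Ql ?Qr.
  + by move/S2 ->.
  + by rewrite cross.
  + by rewrite same_point_sym cross.
  + by move/hinj ->.
- move=> j; case: (@split_ordP 12 4 j) => [i ->|k ->]; rewrite ?Ql ?Qr; first by case: (S1 i).
  by move=> h; case: (notF h).
- move=> k j e; rewrite (_ : j = rshift 12 k) ?Qr //.
  by apply: val_inj; exact: e.
- move=> v vF vC; have [j hj] := S3 v vF vC.
  by exists (lshift 4 j); rewrite Ql.
Qed.
End Sixteen.

Section Tangency.
Variable K : numClosedFieldType.
Variable F : {mpoly K[3]}.
Hypothesis hF : smooth_quartic F.

Lemma smooth_fun (v : 'I_3 -> K) : (exists i, v i != 0) -> F.@[v] = 0 ->
  exists i, (F^`M(i)).@[v] != 0.
Proof.
move=> v0 Fv; pose r : 'rV[K]_3 := \row_i v i.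
have er : r ord0 = v by apply: funext => i; rewrite mxE.
have rF : on_curve F r by apply/on_curveP; rewrite er.
have /row_neq0P[i h] := hF.2 r rF; exists i.
by move: h; rewrite mxE er.
Qed.

Lemma tangent_tang l v : tangent_at l F v -> tang F l (v ord0).
Proof.
move=> [/on_curveP[v0 lv] vF nt]; have [_ Fv] := (on_curveP _ _).1 vF.
by split=> //; apply/(indep_gradP _ (hF.2 v vF)).
Qed.

Lemma not_same_indep (v w : 'rV[K]_3) : v != 0 -> w != 0 -> ~~ same_point v w -> indep2 (v ord0) (w ord0).
Proof.
move=> v0 w0 h; apply: contrapT => hn.
have [t et] := not_indep2 ((row_neq0P v).1 v0) hn.
case/negP: h; rewrite same_point_sym; apply/(same_pointP _ ((row_neq0P w).1 w0)).
exists t => //; apply: contraNneq w0 => t0; apply/eqP/rowP => i.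
by rewrite et t0 mul0r mxE.
Qed.

Lemma transverse_fun P v c : transverse P F -> (exists l, v l != 0) -> P.@[v] = 0 -> F.@[v] = 0 ->
  ~ (forall q, dd P v q = c * dd F v q).
Proof.
move=> htr v0 Pv Fv h; pose r : 'rV[K]_3 := \row_i v i.
have er : r ord0 = v by apply: funext => i; rewrite mxE.
have rF : on_curve F r by apply/on_curveP; rewrite er.
have rP : on_curve P r by apply/on_curveP; rewrite er.
have := htr r rP rF; apply/negP/(indep_gradP _ (hF.2 r rF)).
by rewrite er; exists c.
Qed.

Lemma fun_transverse P : (forall v c, (exists l, v l != 0) -> P.@[v] = 0 -> F.@[v] = 0 ->
  ~ (forall q, dd P v q = c * dd F v q)) -> transverse P F.
Proof.
move=> h v /on_curveP[v0 Pv] vF; have [_ Fv] := (on_curveP _ _).1 vF.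
apply: contraT => /(indep_gradP _ (hF.2 v vF))[c hc].
by case: (h _ c v0 Pv Fv).
Qed.

End Tangency.

(** * The Neeman example *)

Section Weights.
Variable K : numClosedFieldType.
Variable F : {mpoly K[3]}.
Implicit Types p : 'I_3 -> K.

Lemma barycentric_app T p k : T \in unitmx -> barycentric T p k = \det T * app p (invmx T) k.
Proof.
move=> hT; rewrite /barycentric /app mulr_sumr; apply: eq_bigr => l _.
have d0 : \det T != 0 by rewrite -unitfE -unitmxE.
have -> : invmx T l k = (\det T)^-1 * (\adj T) l k by rewrite /invmx hT !mxE.
by rewrite mulrCA mulVKf.
Qed.

Lemma side_cubic_barycentric T p : T \in unitmx ->
  (\det T) ^+ 3 * (side_cubic T).@[p] = \prod_k barycentric T p k.
Proof.
move=> hT; rewrite meval_tr xyz_prod (eq_bigr _ (fun k _ => barycentric_app p k hT)).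
by rewrite big_split prodr_const card_ord.
Qed.

Definition weighted (p : 'I_4 -> 'I_3 -> K) (c : 'I_4 -> K) (T : 'M[K]_3) :=
  \sum_i c i * \prod_k barycentric T (p i) k.

(** At the triangle whose vertices are the three points p (s k), these points have a
   zero coordinate and only p i0 contributes. *)
Lemma nz_weighted (p : 'I_4 -> 'I_3 -> K) (c y : 'I_4 -> K) (s : 'I_3 -> 'I_4) (i0 : 'I_4) :
  c i0 != 0 -> chart_mx (p (s ord0)) (p (s 1)) (p (s ord_max)) \in unitmx ->
  (forall i, i = i0 \/ exists k, i = s k) -> (forall k, y (s k) != 0) ->
  (forall l, p i0 l = \sum_k y (s k) * p (s k) l) ->
  nz (weighted p c).
Proof.
move=> c0; set B := chart_mx _ _ _ => hB hs hy hp; split.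
  apply: polyfun_sum => i; apply: polyfunM; first exact: polyfunC.
  apply: polyfun_prod => k; apply: polyfun_sum => l.
  by apply: polyfunM; [apply: polyfunC|apply: polyfun_adj].
have Bs k : p (s k) = app (e_ k) B.
  apply: funext => l; rewrite app_e.
  by case: (@ord3P ord0 1 ord_max isT k) => ->; rewrite mxE.
have z i : i != i0 -> \prod_k barycentric B (p i) k = 0.
  case: (hs i) => [->|[k ->]]; first by rewrite eqxx.
  move=> _; have [j [m hu]] := exists3 k; have [[h1 h2 h3] [h4 h5 h6]] := neq3 hu.
  rewrite (bigD1 j) //= barycentric_app // Bs app_unitK //.
  by rewrite /e_ h4 mulr0 mul0r.
exists B; rewrite /weighted (bigD1 i0) //= [X in _ + X]big1 ?addr0 => [|i hi]; last by rewrite z ?mulr0.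
rewrite mulf_neq0 //; apply/prodf_neq0 => k _.
rewrite barycentric_app // mulf_neq0 //; first by rewrite -unitfE -unitmxE.
have -> : p i0 = app (fun k => y (s k)) B.
  apply: funext => l; rewrite hp /app; apply: eq_bigr => m _; rewrite Bs app_e //.
by rewrite app_unitK.
Qed.

End Weights.

Section Example.
Variable K : numClosedFieldType.
Variable F : {mpoly K[3]}.
Hypothesis hF : smooth_quartic F.
Let hF4 := hF.1.
Let hsm := smooth_fun hF.
Variables (linf0 l1 l2 : {mpoly K[3]}).
Hypotheses (hlinf0 : is_line linf0) (htr0 : transverse linf0 F).
Hypotheses (hb1 : bitangent l1 F) (hb2 : bitangent l2 F).
Hypothesis hne : forall c, l2 <> c *: l1.

(** C is the cubic of a first general triangle. The line at infinity is a side of a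
   second one, chosen once the 16 points are known. *)
Theorem neeman_not_preregular : exists (linf l1 l2 C : {mpoly K[3]}) (Q : 'I_16 -> 'rV[K]_3),
    neeman_example F linf l1 l2 C Q /\
    (let D := config_divisor F linf Q (fun=> 1%N) 4 in
     forall (d : nat) (A : 'I_3 -> {mpoly K[3]}),
       foliation d A -> leaves_invariant A F ->
       trace_divisor A F linf Q (fun v => 2%:Z * D v) ->
       ~ pre_regular A F Q).
Proof.
have [[hl1 l10] [v1 [v2 [tt1 tt2 n12]]]] := hb1.
have [[hl2 l20] [v3 [v4 [tt3 tt4 n34]]]] := hb2.
have vF l v : tangent_at l F v -> on_curve F v by case.
have vN l v : tangent_at l F v -> v != 0 by move=> /vF/andP[].
have t1 := tangent_tang hF tt1; have t2 := tangent_tang hF tt2.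
have t3 := tangent_tang hF tt3; have t4 := tangent_tang hF tt4.
have i12 := not_same_indep (vN _ _ tt1) (vN _ _ tt2) n12.
have i34 := not_same_indep (vN _ _ tt3) (vN _ _ tt4) n34.
have b1 := bitan_exists hF4 hsm hl1 l10 t1 t2 i12.
have b2 := bitan_exists hF4 hsm hl2 l20 t3 t4 i34.
have hne' c : l1 <> c *: l2.
  move=> e; have c0 : c != 0 by apply: contraNneq l10 => c0; rewrite e c0 scale0r.
  by apply: (hne (c := c^-1)); rewrite e scalerA mulVf // scale1r.
have h13 := bitan_cross hF4 b1 hl1 l10 hl2 t1 t2 t3 hne.
have h14 := bitan_cross hF4 b1 hl1 l10 hl2 t1 t2 t4 hne.
have h21 := bitan_cross hF4 b2 hl2 l20 hl1 t3 t4 t1 hne'.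
have h22 := bitan_cross hF4 b2 hl2 l20 hl1 t3 t4 t2 hne'.
have [_ l1v1 F1 [c1 hc1]] := t1; have [_ l1v2 F2 [c2 hc2]] := t2.
have [_ l2v3 F3 [c3 hc3]] := t3; have [_ l2v4 F4 [c4 hc4]] := t4.
set L := l1 * l2.
have ha1 q : dd L (v1 ord0) q = (c1 * l2.@[v1 ord0]) * dd F (v1 ord0) q.
  by rewrite ddM hc1 l1v1 mul0r addr0; ring.
have ha2 q : dd L (v2 ord0) q = (c2 * l2.@[v2 ord0]) * dd F (v2 ord0) q.
  by rewrite ddM hc2 l1v2 mul0r addr0; ring.
have ha3 q : dd L (v3 ord0) q = (c3 * l1.@[v3 ord0]) * dd F (v3 ord0) q.
  by rewrite ddM hc3 l2v3 mulr0 add0r; ring.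
have ha4 q : dd L (v4 ord0) q = (c4 * l1.@[v4 ord0]) * dd F (v4 ord0) q.
  by rewrite ddM hc4 l2v4 mulr0 add0r; ring.
have c40 : c4 * l1.@[v4 ord0] != 0.
  rewrite mulf_neq0 //; have [x] := linear_neq0 hl2 l20.
  by rewrite -(dd_linear (v4 ord0) x hl2) hc4; apply: contraNneq => ->; rewrite mul0r.
(* Three of the points of tangency form a basis; y gives the fourth one. *)
have hB : chart_mx (v1 ord0) (v3 ord0) (v2 ord0) \in unitmx.
  apply: (basis_unit (g := fun k => l1@_U_(k))); rewrite -?meval_linear //.
  by case: i12 => i [j hij]; exists j, i; rewrite mulrC [X in _ - X]mulrC.
set B := chart_mx _ _ _ in hB.
pose y := app (v4 ord0) (invmx B).
have ey l : v4 ord0 l = y ord0 * v1 ord0 l + y 1 * v3 ord0 l + y ord_max * v2 ord0 l.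
  rewrite -(congr1 (fun f => f l) (app_unitVK (v4 ord0) hB)) /app -/(app _ _) -/y.
  by rewrite (@sum3 ord0 1 ord_max isT) !mxE.
have ly (l : {mpoly K[3]}) : l \is 1.-homog -> l.@[v4 ord0] =
    y ord0 * l.@[v1 ord0] + y 1 * l.@[v3 ord0] + y ord_max * l.@[v2 ord0].
  move=> hl; rewrite !meval_linear // !mulr_sumr -!big_split; apply: eq_bigr => i _ /=.
  by rewrite ey; ring.
have y1 : y 1 != 0.
  by apply: contraNneq h14 => y1; rewrite ly // l1v1 l1v2 y1 !mulr0 mul0r !addr0.
have yl2 : y ord0 * l2.@[v1 ord0] + y ord_max * l2.@[v2 ord0] = 0.
  by rewrite -[RHS]l2v4 ly // l2v3 mulr0 addr0.
(* None of the coordinates of the fourth point is 0: it is on l2 but not on l1, and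
   it is not the third point. *)
have ydep : ~ (y ord0 = 0 /\ y ord_max = 0).
  move=> [y0 y2]; case: i34 => i [j /eqP[]]; rewrite !ey y0 y2 !mul0r !addr0 !add0r; ring.
have y0 : y ord0 != 0.
  apply/eqP => y0; apply: ydep; split=> //; move: yl2; rewrite y0 mul0r add0r => /eqP.
  by rewrite mulf_eq0 (negPf h22) orbF => /eqP.
have y2 : y ord_max != 0.
  apply/eqP => y2; apply: ydep; split=> //; move: yl2; rewrite y2 mul0r addr0 => /eqP.
  by rewrite mulf_eq0 (negPf h21) orbF => /eqP.
pose v (i : 'I_4) : 'rV[K]_3 := nth 0 [:: v1; v2; v3; v4] i.
pose p i := v i ord0.
pose k (i : 'I_4) : K := nth 0 [:: y ord0; y ord_max; y 1; -1] i.
pose a (i : 'I_4) : K := nth 0 [:: c1 * l2.@[v1 ord0]; c2 * l2.@[v2 ord0];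
  c3 * l1.@[v3 ord0]; c4 * l1.@[v4 ord0]] i.
pose s (i : 'I_3) : 'I_4 := nth ord0 [:: inord 0; inord 2; inord 1] i.
have nzf : nz (weighted p (fun i => k i * a i)).
  apply: (@nz_weighted _ p _ k s (inord 3)).
  - by rewrite /k /a !inordK //= mulf_neq0 // oppr_eq0 oner_eq0.
  - by rewrite /p /v /s /= !inordK.
  - move=> [[|[|[|[|//]]]] hi]; [right; exists ord0|right; exists ord_max|right; exists 1|left];
      by apply: val_inj; rewrite /s /= inordK.
  - by move=> i; case: (@ord3P ord0 1 ord_max isT i) => ->; rewrite /k /s /= inordK.
  - move=> l; rewrite (@sum3 ord0 1 ord_max isT) /p /v /k /s /= !inordK //=.
have [u [w [hw hsep]]] := separable_line hF4 hsm hlinf0.1 hlinf0.2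
  (fun v v0 lv Fv c => transverse_fun hF htr0 v0 lv Fv (c := c)).
have vE (i : 'I_4) (P : 'rV[K]_3 -> Prop) : P v1 -> P v2 -> P v3 -> P v4 -> P (v i).
  by case: i => [[|[|[|[|//]]]] hi].
have vne i : on_curve F (v i) by apply: (vE i (fun x => on_curve F x)); eauto.
have pne i : exists l, p i l != 0 by apply/row_neq0P; have /andP[] := vne i.
have [T [good hT fT]] := generic_triangle hF4 hsm hw hsep pne nzf.
have Tu := good_unit good.
set C := side_cubic T.
have CN0 i : C.@[p i] != 0.
  have : \prod_k barycentric T (p i) k != 0 by apply/prodf_neq0 => m _; apply: hT.
  by rewrite -side_cubic_barycentric // mulf_eq0 negb_or => /andP[].
have hne4 : k (inord 0) * (a (inord 0) * C.@[v1 ord0]) + k (inord 1) * (a (inord 1) * C.@[v2 ord0])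
   + k (inord 2) * (a (inord 2) * C.@[v3 ord0]) + k (inord 3) * (a (inord 3) * C.@[v4 ord0]) != 0.
  have e : weighted p (fun i => k i * a i) T = (\det T) ^+ 3 * \sum_i k i * (a i * C.@[p i]).
    rewrite /weighted mulr_sumr; apply: eq_bigr => i _.
    by rewrite -side_cubic_barycentric // -/C; ring.
  move: fT; rewrite e mulf_eq0 negb_or => /andP[_].
  rewrite !big_ord_recl big_ord0 addr0 !addrA.
  have io (i : 'I_4) m : i = m :> nat -> (m < 4)%N -> i = inord m.
    by move=> e1 e2; apply: val_inj; rewrite /= inordK.
  rewrite -(io ord0 0%N) // -(io (lift ord0 ord0) 1%N) //.
  rewrite -(io (lift ord0 (lift ord0 ord0)) 2%N) //.
  by rewrite -(io (lift ord0 (lift ord0 (lift ord0 ord0))) 3%N).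
rewrite /k /a !inordK //= in hne4.
have same_ij (i j : 'I_4) : same_point (v i) (v j) -> i = j.
  have vz (l : {mpoly K[3]}) (x z : 'rV[K]_3) : l \is 1.-homog -> on_curve F z -> l.@[x ord0] = 0 ->
      l.@[z ord0] != 0 -> same_point z x = false.
    move=> hl /andP[z0 _] hx hz; apply/negP => h; case/eqP: hz.
    exact: (same_point_zero hl z0 h hx).
  have F1' := vF _ _ tt1; have F2' := vF _ _ tt2; have F3' := vF _ _ tt3; have F4' := vF _ _ tt4.
  have q13 := vz _ v1 v3 hl1 F3' l1v1 h13; have q23 := vz _ v2 v3 hl1 F3' l1v2 h13.
  have q14 := vz _ v1 v4 hl1 F4' l1v1 h14; have q24 := vz _ v2 v4 hl1 F4' l1v2 h14.
  have q31 := q13; have q32 := q23; have q41 := q14; have q42 := q24.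
  rewrite same_point_sym in q31; rewrite same_point_sym in q32.
  rewrite same_point_sym in q41; rewrite same_point_sym in q42.
  have q12 := negPf n12; have q34 := negPf n34.
  have q21 := q12; have q43 := q34.
  rewrite same_point_sym in q21; rewrite same_point_sym in q43.
  by case: i j => [[|[|[|[|//]]]] hi] [[|[|[|[|//]]]] hj]; rewrite /v /= ?q12 ?q13 ?q14 ?q23 ?q24 ?q34
    ?q21 ?q31 ?q41 ?q32 ?q42 ?q43 // => _; apply: val_inj.
have [Q [QF Qinj QC Qv Qcov]] := sixteen_points hF4 good
  (fun i => conj (vne i) (CN0 i)) same_ij.
have QN0 j : exists l, Q j ord0 l != 0 by apply/row_neq0P; have /andP[] := QF j.
have nz1 : nz (fun=> 1 : K) by split; [apply: polyfunC|exists 0; rewrite oner_eq0].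
have [T2 [good2 hT2 _]] := generic_triangle hF4 hsm hw hsep QN0 nz1.
have T2u := good_unit good2.
set linf := side_line T2.
have Qlinf j : ~~ on_curve linf (Q j).
  apply/negP => /on_curveP[_]; rewrite meval_tr mevalXU => h.
  by have := hT2 j ord0; rewrite barycentric_app // h mulr0 eqxx.
have Qi m (hm : (m < 4)%N) (j : 'I_16) : j = (12 + m)%N :> nat -> Q j = v (Ordinal hm).
  by move=> e; apply: Qv.
have ltc m : (m < 4)%N -> (12 + m < 16)%N by move=> hm; rewrite (ltn_add2l 12 m 4).
have Q1 : exists j, Q j = v1 by exists (Ordinal (ltc 0%N isT)); apply: (Qi 0%N isT).
have Q2 : exists j, Q j = v2 by exists (Ordinal (ltc 1%N isT)); apply: (Qi 1%N isT).
have Q3 : exists j, Q j = v3 by exists (Ordinal (ltc 2%N isT)); apply: (Qi 2%N isT).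
have Q4 : exists j, Q j = v4 by exists (Ordinal (ltc 3%N isT)); apply: (Qi 3%N isT).
have hC : C \is 3.-homog by apply: side_cubic_homog.
have hL : L \is 2.-homog by apply: (dhomogM (d := 1)).
have hLC : L * C \is 5.-homog by apply: (dhomogM (d := 2)).
have LC2 x : (l1 * l2 * C ^+ 2).@[x] = 0 <-> (L * C).@[x] = 0.
  rewrite -/L !mevalM; split=> /eqP; rewrite !mulf_eq0 => h; apply/eqP; rewrite ?mulf_eq0.
    by move: h; rewrite orbb.
  by rewrite orbb.
have QLC j : (L * C).@[Q j ord0] = 0.
  have [j12|j12] := ltnP j 12; first by rewrite mevalM (QC _ j12) mulr0.
  have hm : (j - 12 < 4)%N by rewrite ltn_subLR.
  rewrite (Qi _ hm); last by rewrite subnKC.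
  by apply: (vE _ (fun x => (L * C).@[x ord0] = 0));
    rewrite !mevalM ?l1v1 ?l1v2 ?l2v3 ?l2v4 ?mul0r ?mulr0 ?mul0r.
have covL (x : 'rV[K]_3) : on_curve F x -> L.@[x ord0] = 0 -> exists2 j, C.@[Q j ord0] != 0 & same_point (Q j) x.
  move=> /on_curveP[x0 Fx] Lx.
  have key (z : 'rV[K]_3) : (exists j, Q j = z) -> (exists i, z = v i) ->
     (exists2 t, t != 0 & x ord0 =1 (fun i => t * z ord0 i)) ->
     exists2 j, C.@[Q j ord0] != 0 & same_point (Q j) x.
    move=> [j <-] [i e] h; exists j; first by rewrite e CN0.
    by rewrite same_point_sym; apply/(same_pointP _ x0).
  have [s1 [s2 [s3 s4]]] : (exists i, v1 = v i) /\ (exists i, v2 = v i) /\ (exists i, v3 = v i) /\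
      (exists i, v4 = v i).
    by do !split; [exists (Ordinal (isT : 0 < 4)%N)|exists (Ordinal (isT : 1 < 4)%N)
      |exists (Ordinal (isT : 2 < 4)%N)|exists (Ordinal (isT : 3 < 4)%N)].
  move: Lx; rewrite mevalM => /eqP; rewrite mulf_eq0 => /orP[] /eqP lx.
    by have [t tn0 [e|e]] := bitan_zero hF4 b1 x0 lx Fx;
      [apply: (key _ Q1 s1)|apply: (key _ Q2 s2)]; exists t.
  by have [t tn0 [e|e]] := bitan_zero hF4 b2 x0 lx Fx;
    [apply: (key _ Q3 s3)|apply: (key _ Q4 s4)]; exists t.
have cov (x : 'rV[K]_3) : on_curve F x -> (L * C).@[x ord0] = 0 <-> exists j, same_point (Q j) x.
  move=> Fx; split=> [|[j hj]].
    rewrite mevalM => /eqP; rewrite mulf_eq0 => /orP[] /eqP h.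
      by have [j _ hj] := covL x Fx h; exists j.
    exact: Qcov.
  have xn : x != 0 by case/andP: Fx.
  by apply: (same_point_zero hLC xn _ (QLC j)); rewrite same_point_sym.
have example : neeman_example F linf l1 l2 C Q.
  split.
  - split; first by split; [apply: side_line_homog|apply: side_line_neq0 good2].
    by apply: (fun_transverse hF) => x c; apply: (side_line_transverse hF4 good2).
  - by split.
  - split=> //; first by apply: (fun_transverse hF) => x c; apply: (side_cubic_transverse hF4 good).
    move=> x Fx hx; have Lx : L.@[x ord0] = 0.
      by case/orP: hx => /on_curveP[_ h]; rewrite mevalM h ?mul0r ?mulr0.
    have [j Cj hj] := covL x Fx Lx; apply: contra Cj => /on_curveP[_ Cx]; apply/eqP.
    by apply: (same_point_zero hC _ hj Cx); apply/row_neq0P.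
  - split=> // x; split=> [/andP[Fx /on_curveP[_ /LC2 h]]|[xn [j hj]]].
      by split; [case/andP: Fx|apply/cov].
    have Fx : on_curve F x.
      apply/on_curveP; split; first exact/row_neq0P.
      apply: (same_point_zero hF4 xn (w := Q j)); first by rewrite same_point_sym.
      by have /on_curveP[] := QF j.
    rewrite Fx /=; apply/on_curveP; split; first exact/row_neq0P.
    by apply/LC2/cov => //; exists j.
  - split=> //.
    + by move=> j /QC h; apply/on_curveP.
    + move=> j /andP[h1 h2]; have hm : (j - 12 < 4)%N by rewrite ltn_subLR // (leq_trans h2).
      rewrite (Qi _ hm) ?subnKC //; move: hm; have : (j - 12 < 2)%N by rewrite ltn_subLR.
      by case: (j - 12)%N => [|[|//]] _ hm.
    + move=> j h; have h1 : (12 <= j)%N by apply: leq_trans h.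
      have hm : (j - 12 < 4)%N by rewrite ltn_subLR.
      rewrite (Qi _ hm) ?subnKC //; move: hm; have : (2 <= j - 12)%N by rewrite leq_subRL.
      by case: (j - 12)%N => [//|[//|[|[|//]]]] _ hm.
exists linf, l1, l2, C, Q; split=> // D d A [hA hR hfol] hinv [hsing [m [Lm [hm _ hD]]]] [_ _ hpre].
have m2 j : m j = 2%N.
  have := hD (Q j) ((row_neq0P _).2 (QN0 j)).
  by rewrite /D !config_divisor_at // => -[].
have toRow (x : 'I_3 -> K) : exists r : 'rV[K]_3, r ord0 = x.
  by exists (\row_i x i); apply: funext => i; rewrite mxE.
apply: (no_preregular_triangle hF4 hsm good hl1 hl2 l10 l20 t1 t2 t3 t4 i12 i34 h13 h14
  (CN0 (Ordinal (isT : 0 < 4)%N)) (CN0 (Ordinal (isT : 1 < 4)%N)) (CN0 (Ordinal (isT : 2 < 4)%N))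
  (CN0 (Ordinal (isT : 3 < 4)%N)) ha1 ha2 ha3 ha4 _ hne4 hA hR hinv).
- by move=> l; rewrite ey; ring.
- move=> x x0 Fx; have [r er] := toRow x; rewrite -er in x0 Fx *.
  have rF : on_curve F r by apply/on_curveP.
  by rewrite cov //; apply: hsing.
- move=> x x0 Fx LCx M Mu hM; have [r er] := toRow x; rewrite -er in x0 Fx LCx hM.
  have rF : on_curve F r by apply/on_curveP.
  have [j hj] := (cov r rF).1 LCx.
  have cM : centered_chart M (Q j).
    split=> //; rewrite same_point_sym (_ : chart_origin M = r) //.
    by apply/rowP => i; rewrite mxE hM.
  have := hm j M cM; rewrite m2 => -[o2 o3]; split=> //; split=> //.
  move=> f' w' hf hw' z z0 fz; exact: (hpre j M cM f' w' hf hw').2 z z0 fz.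
Qed.

End Example.

Unset Implicit Arguments.

Theorem mainTheorem1 (R : realType) (F : {mpoly R[i][3]})
    (hF : smooth_quartic F) (hgen : generic_quartic F) :
  exists (linf l1 l2 C : {mpoly R[i][3]}) (Q : 'I_16 -> 'rV[R[i]]_3),
    neeman_example F linf l1 l2 C Q /\
    (let D := config_divisor F linf Q (fun=> 1%N) 4 in
     forall (d : nat) (A : 'I_3 -> {mpoly R[i][3]}),
       foliation d A -> leaves_invariant A F ->
       trace_divisor A F linf Q (fun v => 2%:Z * D v) ->
       ~ pre_regular A F Q).
Proof.
case: hgen => M [linf [l1 [l2 [C [a [b /=]]]]]].
move=> [[[_ hlinf _] htr] [_ b0 h1 h2] [_ e1 e2] _ _].
apply: (@neeman_not_preregular _ F hF linf l1 l2 hlinf htr h1 h2) => c e.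
have e' : affine_eq M l2 = c *: affine_eq M l1 by rewrite e affine_eqZ.
move: e'; rewrite e1 e2 => /(congr1 (meval (fun=> 0))).
rewrite mevalZ !mevalD !mevalZ mevalC !mevalXU !mulr0 !addr0 add0r mulr0 => /eqP.
exact/negP.
Qed.
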